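(* Let $n\ge2$ and suppose $\beta=\sum_{i=1}^Mr_i[z_i]\in\mathbb Z[P^1_{\mathbb C(x)}]$ (with $r_i\in\mathbb Z$) is in the kernel of $\mathrm{symb}_n$, and suppose that there are multiplicatively independent functions $a_1,\dots,a_N\in\mathbb C(x)^*$ and integers $k_{ji},l_{ji}$ such that $$z_i=a_1^{k_{1i}}\cdots a_N^{k_{Ni}},\qquad 1-z_i=a_1^{l_{1i}}\cdots a_N^{l_{Ni}}\qquad (i=1,\dots,M).$$ Any choice of local log branches $\widetilde a_j=\log(a_j)$ of the $a_j$ determines a local $\widehat{\mathcal L}_n$ relation $$\sum_{i=1}^Mr_i\widehat{\mathcal L}_n(u_i,v_i)=c,$$ where $c$ is a constant and $u_i=\sum_{j=1}^Nk_{ji}\widetilde a_j$, $v_i=\sum_{j=1}^Nl_{ji}\widetilde a_j$.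
   Context: For a field $F$, $P^1_F=F\cup\{\infty\}$, $F^*=F\setminus\{0\}$, and $\mathrm{symb}_n:\mathbb Z[P^1_F]\to\wedge^2(F^* )\otimes\mathrm{Sym}^{n-2}(F^* )$ is the homomorphism $[z]\mapsto z\wedge(1-z)\otimes z^{\otimes(n-2)}$, with $[0],[1],[\infty]\mapsto0$; here $F=\mathbb C(x)$. $\widehat{\mathbb C}=\{(u,v)\in\mathbb C^2:e^u+e^v=1\}$. Write $(u,v)\in\widehat{\mathbb C}$ uniquely as $(\mathrm{Log}(z)+2p\pi i,\mathrm{Log}(1-z)+2q\pi i)$ with $z\in\mathbb C\setminus\{0,1\}$, $p,q\in\mathbb Z$, where $\mathrm{Log}$ is the main branch (argument in $(-\pi,\pi]$). With $\mathrm{Li}_1(z)=-\mathrm{Log}(1-z)$, $\mathrm{Li}_k(z)=\int_0^1\frac{\mathrm{Li}_{k-1}(tz)}{t}dt$ and $\mathcal Li_k(z;q)=\mathrm{Li}_k(z)-\frac{2q\pi i}{(k-1)!}\mathrm{Log}(z)^{k-1}$, the function $\widehat{\mathcal L}_n(u,v)=\sum_{r=0}^{n-1}\frac{(-1)^r}{r!}\mathcal Li_{n-r}(z;q)u^r-\frac{(-1)^n}{n!}u^{n-1}v$ is a holomorphic function $\widehat{\mathcal L}_n:\widehat{\mathbb C}\to\mathbb C/\frac{(2\pi i)^n}{(n-1)!}\mathbb Z$. ''Local'' means on a connected open subset of $\mathbb C$ on which the functions $a_j$ are holomorphic and nonvanishing and the chosen branches of $\log(a_j)$ are holomorphic; the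 relation says the left-hand side is constant there. *)

(* Defs.v *)
(* The complex numbers are [R[i]] for an arbitrary [R : realType]. *)
From HB Require Import structures.
From mathcomp Require Import all_boot all_order all_algebra.
From mathcomp Require Import all_classical all_reals all_analysis.
From mathcomp Require Import perm complex.
From mathcomp Require Import freeg.

Set Implicit Arguments.
Unset Strict Implicit.
Unset Printing Implicit Defensive.

Import Order.TTheory GRing.Theory Num.Theory numFieldNormedType.Exports.
Import ComplexField.Normc.

Local Open Scope classical_set_scope.
Local Open Scope ring_scope.
Local Open Scope complex_scope.

Section ZmodQuotient.
Variables (V : zmodType) (S : set V).

Definition is_subgroup (H : set V) : Prop :=
  H 0 /\ forall x y, H x -> H y -> H (x - y).

Definition gen_subgroup : {pred V} :=
  fun x => `[< smallest is_subgroup S x >].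

Fact gen_subgroup_zmod_closed : zmod_closed gen_subgroup.
Proof.
split=> [|x y]; first by apply/asboolP => H [[H0 _] _].
move=> /asboolP Hx /asboolP Hy; apply/asboolP => H HS.
by have [[_ HB] _] := HS; exact: HB (Hx _ HS) (Hy _ HS).
Qed.

HB.instance Definition _ :=
  GRing.isZmodClosed.Build V gen_subgroup gen_subgroup_zmod_closed.

(* V / <S> *)
Definition zquot : zmodType := Quotient.quot gen_subgroup.

Definition zproj (x : V) : zquot := (\pi_zquot x)%qT.

End ZmodQuotient.

Section TensorProduct.
Variables A B : zmodType.

Definition tensor_rel : set {freeg (A * B)} :=
  [set w | exists a a' b, w = << (a + a', b) >> - << (a, b) >> - << (a', b) >>]
  `|`
  [set w | exists a b b', w = << (a, b + b') >> - << (a, b) >> - << (a, b') >>].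

Definition tensor : zmodType := zquot tensor_rel.

Definition tens (a : A) (b : B) : tensor := zproj tensor_rel << (a, b) >>.

End TensorProduct.

Section ExteriorSquare.
Variable A : zmodType.

Definition ext2_rel : set (tensor A A) := [set w | exists a, w = tens a a].

Definition ext2 : zmodType := zquot ext2_rel.

Definition wedge (a b : A) : ext2 := zproj ext2_rel (tens a b).

End ExteriorSquare.

Section SymmetricPower.
Variables (m : nat) (A : zmodType).

Definition upd (f : {ffun 'I_m -> A}) (i : 'I_m) (a : A) : {ffun 'I_m -> A} :=
  [ffun j => if j == i then a else f j].

Definition sym_rel : set {freeg {ffun 'I_m -> A}} :=
  [set w | exists f i a b,
     w = << upd f i (a + b) >> - << upd f i a >> - << upd f i b >>]
  `|`
  [set w | exists (f : {ffun 'I_m -> A}) (s : 'S_m),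
     w = << [ffun j => f (s j)] >> - << f >>].

Definition sympower : zmodType := zquot sym_rel.

Definition sym_pow (a : A) : sympower := zproj sym_rel << [ffun=> a] >>.

End SymmetricPower.

(* F^*, written additively so that it is a Z-module *)
Section MultiplicativeGroup.
Variable F : fieldType.

Definition mulgrp := {x : F | x != 0}.

HB.instance Definition _ := Choice.on mulgrp.

Implicit Types x y : mulgrp.

Definition mulgrp_one : mulgrp := Sub 1 (oner_neq0 F).
Definition mulgrp_inv x : mulgrp :=
  Sub (val x)^-1 (etrans (congr1 negb (invr_eq0 _)) (valP x)).
Definition mulgrp_mul x y : mulgrp := Sub (val x * val y) (mulf_neq0 (valP x) (valP y)).

Fact mulgrp_mulA : associative mulgrp_mul.
Proof. by move=> x y z; apply: val_inj; rewrite /= mulrA. Qed.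
Fact mulgrp_mulC : commutative mulgrp_mul.
Proof. by move=> x y; apply: val_inj; rewrite /= mulrC. Qed.
Fact mulgrp_mul1 : left_id mulgrp_one mulgrp_mul.
Proof. by move=> x; apply: val_inj; rewrite /= mul1r. Qed.
Fact mulgrp_mulV : left_inverse mulgrp_one mulgrp_inv mulgrp_mul.
Proof. by move=> x; apply: val_inj; rewrite /= mulVf ?(valP x). Qed.

HB.instance Definition _ := GRing.isZmodule.Build mulgrp
  mulgrp_mulA mulgrp_mulC mulgrp_mul1 mulgrp_mulV.

End MultiplicativeGroup.

Section Symbol.
Variable F : fieldType.

(* [None] is the point at infinity. *)
Definition P1 := option F.

Definition symb_target (n : nat) : zmodType :=
  tensor (ext2 (mulgrp F)) (sympower (n - 2) (mulgrp F)).

Definition symb_gen (n : nat) (p : P1) : symb_target n :=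
  if p is Some z then
    match insub z : option (mulgrp F), insub (1 - z) : option (mulgrp F) with
    | Some x, Some y => tens (wedge x y) (sym_pow (n - 2) x)
    | _, _ => 0
    end
  else 0.

(* [zmodule] provides the int-module structure that [fglift] asks for. *)
Definition symb (n : nat) (beta : {freeg P1}) : symb_target n :=
  fglift (symb_gen n : P1 -> zmodule (symb_target n)) beta.

Definition mult_independent (N : nat) (a : 'I_N -> F) : Prop :=
  forall e : 'I_N -> int, \prod_(j < N) a j ^ e j = 1 -> forall j, e j = 0.

End Symbol.

Section RationalFunctions.
Variable K : fieldType.
Implicit Types (f : {fraction {poly K}}) (x : K).

(* Reduced numerator and denominator: [repr f] need not be in lowest terms. *)
Definition rf_num f : {poly K} :=
  let: (p, q) := frac (repr f) in p %/ gcdp p q.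
Definition rf_den f : {poly K} :=
  let: (p, q) := frac (repr f) in q %/ gcdp p q.

Definition rf_eval f x : K := (rf_num f).[x] / (rf_den f).[x].

Definition rf_regular f x : Prop := (rf_den f).[x] != 0.

End RationalFunctions.

Section Polylogarithms.
Variable R : realType.
Local Notation C := (R[i] : numFieldType).
Implicit Types (z u v : C) (q : int).

Definition Cexp z : C :=
  let: x +i* y := z in (expR x * cos y) +i* (expR x * sin y).

(* values in ]-pi, pi] for z != 0 *)
Definition Arg z : R :=
  let: x +i* y := z in
  if 0 <= y then acos (x / normc z) else - acos (x / normc z).

Definition Log z : C := ln (normc z) +i* Arg z.

Definition twopii : C := 0 +i* (2 * pi).

Definition Cintegral01 (f : R -> C) : C :=
  (\int[lebesgue_measure]_(t in `[0, 1]) complex.Re (f t)) +i*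
  (\int[lebesgue_measure]_(t in `[0, 1]) complex.Im (f t)).

(* Lebesgue integrals are needed: for real z > 1 the segment [0, z] meets the
   logarithmic singularity of [Li 1] at 1.  [Li 0] is never used. *)
Fixpoint Li (k : nat) : C -> C :=
  match k with
  | 0%N => fun=> 0
  | 1%N => fun z => - Log (1 - z)
  | k'.+1 => fun z => Cintegral01 (fun t => Li k' (t%:C * z) / t%:C)
  end.

Definition calLi (k : nat) z q : C :=
  Li k z - q%:~R * twopii / (k.-1)`!%:R * Log z ^+ k.-1.

Definition Chat : set (C * C) := [set w | Cexp w.1 + Cexp w.2 = 1].

(* For (u, v) in [Chat] and z = e^u, the unique integer q such that
   v = Log (1 - z) + 2 q pi i. *)
Definition sheet u v : int :=
  xget 0 [set q : int | v = Log (1 - Cexp u) + q%:~R * twopii].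

Definition Lhat_lift (n : nat) u v : C :=
  \sum_(r < n) (-1) ^+ r / r`!%:R * calLi (n - r) (Cexp u) (sheet u v) * u ^+ r
  - (-1) ^+ n / n`!%:R * u ^+ n.-1 * v.

(* C / ((2 pi i)^n / (n-1)!) Z *)
Definition Lhat_target (n : nat) : zmodType :=
  @zquot C [set twopii ^+ n / (n.-1)`!%:R].

(* Meaningful only for (u, v) in [Chat]. *)
Definition Lhat (n : nat) u v : Lhat_target n := zproj _ (Lhat_lift n u v).

End Polylogarithms.

(* Main.v *)
Require Import Defs.
From HB Require Import structures.
From mathcomp Require Import all_boot all_order all_algebra.
From mathcomp Require Import all_classical all_reals all_analysis.
From mathcomp Require Import perm complex.
From mathcomp Require Import freeg.
From mathcomp Require Import measurable_realfun.
From mathcomp Require Import ring lra.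

Set Implicit Arguments.
Unset Strict Implicit.
Unset Printing Implicit Defensive.

Import Order.TTheory GRing.Theory Num.Theory numFieldNormedType.Exports.
Import ComplexField.Normc.

Local Open Scope classical_set_scope.
Local Open Scope ring_scope.
Local Open Scope complex_scope.

(** Modulo the period (2 pi i)^n / (n-1)!, the value of Lhat_n only depends on
    the polylogarithms Li_k(e^u) up to their monodromy.  Indeed replacing each
    Li_(k+1) by Li_(k+1) + a w^k / k!, for constants a and w, changes the sum
    that defines Lhat_n by a (w - u)^(n-1) / (n-1)!, by the binomial formula
    ([Lhat_formulaB]).  The terms that carry the sheet number q have this form,
    with a in 2 pi i Z and w = Log(e^u); the jumps of Li_k(e^u) across the cut
    also do, with w = u - 2 pi i p.  In both cases w - u is in 2 pi i Z, so the
    change is a multiple of the period.  Hence, near each point, Lhat_n(u, v)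
    is the class of the number obtained by putting, in place of the Li_k(e^u),
    holomorphic functions phi_k such that phi_(k+1)' = phi_k and
    phi_0 = e^u / (1 - e^u) ([local_branch], [Lhat_branch]).

    Along u = u(x), v = v(x) on Chat, the derivative of this number telescopes,
    and v' = - u' e^u / (1 - e^u) leaves a rational multiple, depending on n
    only, of u^(n-2) (u v' - v u') ([Lhat_formula_deriv], [relation_deriv0]).
    The combination of these terms with coefficients r_i vanishes because beta
    has zero symbol: two homomorphisms f, g from F^* to the complex numbers
    induce on the target of the symbol the homomorphism
      (z ^ w) (x) s^(n-2)  |->  (f(z) g(w) - f(w) g(z)) f(s)^(n-2),
    and, the a_j being independent and the complex numbers divisible, f and g
    can be chosen with f(a_j) = log a_j(x) and g(a_j) = (log a_j)'(x)
    ([additive_extension], [symb_kernel_log]).  So the sum is locally constant,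
    and constant because U is connected.

    The analytic work is in [local_branch].  Away from the cut, the formula
    Li_(k+1)' = Li_k / z comes from a quadratic remainder estimate which holds
    along whole rays and is therefore stable under the integral that defines
    the next polylogarithm ([PL_invariant]).  At a point of the cut, Li_k is
    the limit of its values from below, by dominated convergence
    ([Li_below_cvg]); its imaginary part there is explicit ([Im_Li_gt1]) and,
    by the symmetry of Li_k under conjugation ([Li_conj]), gives the jump.
    The corrected function is then holomorphic across the cut by a removability
    argument which only needs continuity along vertical lines
    ([glue_deriv]). *)

(** * Complex derivatives through the modulus *)

(** The first order Taylor estimate, a form of differentiability that can be
    checked by hand for functions given by integrals. *)
Lemma is_derive_epsP (K : numFieldType) (F : K -> K) (x d : K) :
  is_derive x 1 F d <->
  forall e : K, 0 < e -> exists2 r : K, 0 < r &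
    forall w, `|w - x| < r -> `|F w - F x - d * (w - x)| <= e * `|w - x|.
Proof.
split=> [Fd e e0|H].
- have /derivable_nbhsP/eqaddoP := @ex_derive _ _ _ _ _ _ _ Fd.
  rewrite derive_val => /(_ e e0) /nbhs_norm0P[r r0 Hr].
  exists r => // w wr.
  have := Hr (w - x) wr.
  by rewrite !fctE /= [_%:A]mulr1 subrK opprD addrA [d * _]mulrC.
- have E : (fun h => h^-1 *: (F (h *: 1 + x) - F x)) @ 0^' --> d.
    apply/cvgrPdist_le => e e0; have [r r0 Hr] := H e e0.
    near=> h.
    have h0 : h != 0 by near: h; exact: nbhs_dnbhs_neq.
    have hr : `|h| < r by near: h; exact: dnbhs0_lt.
    have := Hr (h + x); rewrite addrK => /(_ hr) Hh.
    rewrite distrC [h%:A]mulr1 -(@ler_pM2r _ `|h|) ?normr_gt0//.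
    apply: le_trans Hh; rewrite -normrM mulrBl [_ *: _]mulrC.
    by rewrite -mulrA mulVf // mulr1.
  by apply: DeriveDef; [apply/cvg_ex; exists d | exact/cvg_lim].
Unshelve. all: by end_near. Qed.

Section Cplx.
Variable R : realType.
Local Notation C := (R[i] : numFieldType).
Implicit Types (z w h d : C) (F G : C -> C).

Lemma normrE z : `|z| = (normc z)%:C.
Proof. by []. Qed.

Lemma normc_ge0 z : 0 <= normc z.
Proof. by case: z => x y; exact: sqrtr_ge0. Qed.

Lemma normc_distC z w : normc (z - w) = normc (w - z).
Proof. by rewrite -opprB normcN. Qed.

Lemma normcR (x : R) : normc x%:C = `|x|.
Proof. by rewrite /= expr0n /= addr0 sqrtr_sqr. Qed.

Lemma normc_eq0 z : (normc z == 0) = (z == 0).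
Proof. by apply/eqP/eqP => [/eq0_normc//|->]; exact: normc0. Qed.

Lemma normc_gt0 z : (0 < normc z) = (z != 0).
Proof. by rewrite lt_def normc_ge0 andbT normc_eq0. Qed.

Lemma sqr_normc_ReIm z : normc z ^+ 2 = complex.Re z ^+ 2 + complex.Im z ^+ 2.
Proof. by case: z => x y; rewrite sqr_sqrtr // addr_ge0 ?sqr_ge0. Qed.

Lemma ler_Re_normc z : `|complex.Re z| <= normc z.
Proof.
by rewrite -sqrtr_sqr; case: z => x y; rewrite ler_sqrt ?addr_ge0 ?sqr_ge0// lerDl sqr_ge0.
Qed.

Lemma ler_Im_normc z : `|complex.Im z| <= normc z.
Proof.
by rewrite -sqrtr_sqr; case: z => x y; rewrite ler_sqrt ?addr_ge0 ?sqr_ge0// lerDr sqr_ge0.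
Qed.

Lemma complexReIm z : z = complex.Re z +i* complex.Im z.
Proof. by case: z. Qed.

Lemma ler_normc_ReIm z : normc z <= `|complex.Re z| + `|complex.Im z|.
Proof.
rewrite -(@ler_pXn2r _ 2) ?nnegrE ?addr_ge0 ?normc_ge0//.
rewrite sqr_normc_ReIm sqrrD !real_normK ?num_real// lerD2r lerDl.
by rewrite mulrn_wge0 // mulr_ge0.
Qed.

Lemma lec_re (x y : R) : ((x%:C : C) <= y%:C) = (x <= y).
Proof. exact: lecR. Qed.

(** All estimates below use the real-valued modulus [normc], for which real
    linear arithmetic applies, instead of the norm of the field C, whose
    values are complex numbers. *)
Lemma cderivP F z d : is_derive z 1 F d <->
  forall e : R, 0 < e -> exists2 r : R, 0 < r &
    forall w, normc (w - z) < r ->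
      normc (F w - F z - d * (w - z)) <= e * normc (w - z).
Proof.
split=> [/is_derive_epsP H e e0|H].
- have [|r r0 Hr] := H e%:C; first by rewrite ltcR.
  have [r' rE] : exists r', r = r'%:C.
    by exists (complex.Re r); case: r r0 {Hr} => a b; rewrite ltcE /= => /andP[/eqP-> _].
  move: r0 Hr; rewrite rE ltcR => r0 Hr; exists r' => // w wr.
  by rewrite -lec_re rmorphM /=; apply: Hr; rewrite normrE ltcR.
- apply/is_derive_epsP => e e0.
  have [e' eE] : exists r', e = r'%:C.
    by exists (complex.Re e); case: e e0 => a b; rewrite ltcE /= => /andP[/eqP-> _].
  move: e0; rewrite eE ltcR => e0; have [r r0 Hr] := H _ e0.
  exists r%:C; rewrite ?ltcR // => w; rewrite !normrE ltcR => /Hr.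
  by rewrite -lec_re rmorphM.
Qed.

Lemma cderiv_cont F z d : is_derive z 1 F d ->
  forall e : R, 0 < e -> exists2 r : R, 0 < r &
    forall w, normc (w - z) < r -> normc (F w - F z) < e.
Proof.
move=> /cderivP /(_ 1 ltr01) [r r0 Hr] e e0.
pose K := 1 + normc d; have K0 : 0 < K by rewrite ltr_wpDr ?normc_ge0.
exists (Num.min r (e / K)); first by rewrite lt_min r0 divr_gt0.
move=> w; rewrite lt_min ltr_pdivlMr // => /andP[/Hr wr wK].
apply: le_lt_trans wK; rewrite -[F w - F z](subrK (d * (w - z))).
apply: le_trans (le_normcD _ _) _.
by rewrite normcM /K; move: wr; lra.
Qed.

Lemma cderiv_comp F G z d d' : is_derive z 1 F d -> is_derive (F z) 1 G d' ->
  is_derive z 1 (fun w => G (F w)) (d' * d).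
Proof.
move=> dF dG; apply/cderivP => e e0.
pose K := normc d' + normc d + 2.
have K0 : 0 < K by have := normc_ge0 d; have := normc_ge0 d'; rewrite /K; lra.
have [q q0 Hq] := (cderivP _ _ _).1 dG (e / K) (divr_gt0 e0 K0).
have [r1 r10 Hr1] := cderiv_cont dF q0.
pose m := Num.min 1 (e / K).
have m0 : 0 < m by rewrite lt_min ltr01 divr_gt0.
have [r2 r20 Hr2] := (cderivP _ _ _).1 dF m m0.
exists (Num.min r1 r2); first by rewrite lt_min r10.
move=> w; rewrite lt_min => /andP[/Hr1/Hq H1 /Hr2 H2].
set x := normc (w - z) in H2 *; have x0 : 0 <= x := normc_ge0 _.
have mx1 : m * x <= x by rewrite ler_piMl // ge_min lexx.
have mx2 : m * x <= e / K * x by rewrite ler_wpM2r // ge_min lexx orbT.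
have H3 : normc (F w - F z) <= (1 + normc d) * x.
  rewrite -[F w - F z](subrK (d * (w - z))) (le_trans (le_normcD _ _))//.
  by rewrite normcM mulrDl mul1r lerD // (le_trans H2).
have -> : G (F w) - G (F z) - d' * d * (w - z) =
  (G (F w) - G (F z) - d' * (F w - F z)) + d' * (F w - F z - d * (w - z)) by ring.
apply: le_trans (le_normcD _ _) _; rewrite normcM.
have H4 : normc d' * normc (F w - F z - d * (w - z)) <= normc d' * (e / K * x).
  by rewrite ler_wpM2l ?normc_ge0 // (le_trans H2).
have H5 : e / K * normc (F w - F z) <= e / K * ((1 + normc d) * x).
  by rewrite ler_wpM2l // ltW // divr_gt0.
have -> : e * x = e / K * x * K by field; rewrite gt_eqF.
have : 0 <= e / K * x by rewrite mulr_ge0 // ltW // divr_gt0.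
rewrite mulrCA in H5; move: H1 H4 H5; set y := e / K * x; rewrite /K => H1 H4 H5 y0.
apply: le_trans (lerD (le_trans H1 H5) H4) _; lra.
Qed.

Lemma ReB z w : complex.Re (z - w) = complex.Re z - complex.Re w.
Proof. by case: z w => ? ? []. Qed.

Lemma ReMr z (x : R) : complex.Re (z * x%:C) = complex.Re z * x.
Proof. by case: z => a b /=; rewrite mulr0 subr0. Qed.

(** Brings complex derivatives within reach of the calculus of real functions:
    multiplying by a constant c before taking the real part gives access to
    every component of F. *)
Lemma is_derive_re_line F z h c (t : R) d : is_derive (z + t%:C * h : C) 1 F d ->
  is_derive t (1 : R) (fun s : R => complex.Re (c * F (z + s%:C * h))) (complex.Re (c * d * h)).
Proof.
move=> /cderivP H; apply/is_derive_epsP => e e0.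
pose K := (normc c + 1) * (normc h + 1).
have [c0 h0] : 0 < normc c + 1 /\ 0 < normc h + 1 by split; rewrite ltr_wpDl ?normc_ge0.
have K0 : 0 < K by exact: mulr_gt0.
have [r r0 Hr] := H (e / K) (divr_gt0 e0 K0).
exists (r / (normc h + 1)); first exact: divr_gt0.
move=> s; rewrite ltr_pdivlMr // => sr.
have E : z + s%:C * h - (z + t%:C * h) = (s - t)%:C * h.
  by rewrite rmorphB /=; ring.
have nE : normc (z + s%:C * h - (z + t%:C * h)) = `|s - t| * normc h.
  by rewrite E normcM normcR.
have sr' : normc (z + s%:C * h - (z + t%:C * h)) < r.
  by rewrite nE; apply: le_lt_trans sr; rewrite ler_wpM2l // lerDl.
have := Hr _ sr'; rewrite nE E => Hs.
have -> : complex.Re (c * F (z + s%:C * h)) - complex.Re (c * F (z + t%:C * h))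
    - complex.Re (c * d * h) * (s - t) =
    complex.Re (c * (F (z + s%:C * h) - F (z + t%:C * h) - d * ((s - t)%:C * h))).
  have -> : c * (F (z + s%:C * h) - F (z + t%:C * h) - d * ((s - t)%:C * h)) =
    c * F (z + s%:C * h) - c * F (z + t%:C * h) - c * d * h * (s - t)%:C by ring.
  by rewrite !ReB ReMr.
apply: le_trans (ler_Re_normc _) _; rewrite normcM.
apply: le_trans (ler_wpM2l (normc_ge0 _) Hs) _.
have -> : normc c * (e / K * (`|s - t| * normc h)) = (e * `|s - t|) * ((normc c * normc h) / K).
  by field; rewrite gt_eqF.
rewrite ler_piMr ?(mulr_ge0 (ltW e0)) // ler_pdivrMr // mul1r.
by rewrite ler_pM ?normc_ge0 // lerDl.
Qed.

Lemma normc_sqr_conj z : complex.Re (z^*%C * z) = normc z ^+ 2.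
Proof. by rewrite sqr_normc_ReIm; case: z => x y /=; ring. Qed.

Lemma normc_conj z : normc z^*%C = normc z.
Proof. by case: z => x y /=; rewrite sqrrN. Qed.

(** The mean value inequality. The real mean value theorem applies to the real
    part of conj(D) F along the segment, with D the increment of F: this
    function increases by the square of the modulus of D. *)
Lemma segment_bound F z h (e : R) :
  (forall t : R, 0 <= t <= 1 -> exists2 d, is_derive (z + t%:C * h : C) 1 F d & normc d <= e) ->
  normc (F (z + h) - F z) <= e * normc h.
Proof.
move=> H.
set D := F (z + h) - F z.
have [D0|D0] := eqVneq D 0.
  have [|d _ de] := H 0; first by rewrite lexx ler01.
  by rewrite D0 normc0 mulr_ge0 ?normc_ge0 // (le_trans (normc_ge0 _) de).
pose f (s : R) := complex.Re (D^*%C * F (z + s%:C * h)).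
pose f' (t : R) := 'D_1 f t.
have df (t : R) : 0 <= t <= 1 -> is_derive t 1 f (f' t) /\ f' t <= normc D * (e * normc h).
  move=> /H[d dF de]; have := is_derive_re_line (D^*%C) dF => Hd; split.
    by apply: DeriveDef => //; exact: (@ex_derive _ _ _ _ _ _ _ Hd).
  rewrite /f' (@derive_val _ _ _ _ _ _ _ Hd).
  apply: le_trans (ler_norm _) _; apply: le_trans (ler_Re_normc _) _.
  by rewrite !normcM normc_conj -mulrA ler_wpM2l ?normc_ge0// ler_wpM2r ?normc_ge0.
have [x xI||c c01 fc] := @MVT R f f' 0 1 ltr01.
- by apply: (df x _).1; move: xI; rewrite in_itv /= => /andP[/ltW-> /ltW->].
- apply: derivable_within_continuous => x; rewrite in_itv /= => /df[Hx _].
  exact: (@ex_derive _ _ _ _ _ _ _ Hx).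
move: c01; rewrite in_itv /= => /andP[/ltW c0 /ltW c1].
have := (df c _).2; rewrite c0 c1 => /(_ isT).
rewrite subr0 mulr1 in fc; rewrite -fc /f rmorph1 mul1r rmorph0 mul0r addr0.
rewrite -raddfB /= -mulrBr -/D normc_sqr_conj expr2.
by rewrite ler_pM2l // normc_gt0.
Qed.

End Cplx.

(** * The exponential and the principal logarithm *)

Section ExpLog.
Variable R : realType.
Local Notation C := (R[i] : numFieldType).
Implicit Types (z w h d : C) (F G : C -> C).

Lemma eqc_ReIm z w : complex.Re z = complex.Re w -> complex.Im z = complex.Im w -> z = w.
Proof. by case: z w => ? ? [? ?] /= -> ->. Qed.

Lemma CexpE z : Cexp z =
  expR (complex.Re z) * cos (complex.Im z) +i* (expR (complex.Re z) * sin (complex.Im z)).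
Proof. by case: z. Qed.

Lemma Cexp0 : Cexp (0 : C) = 1.
Proof. by rewrite /= expR0 cos0 sin0 mulr1 mulr0. Qed.

Lemma CexpD z w : Cexp (z + w) = Cexp z * Cexp w.
Proof.
case: z w => a b [c d] /=; rewrite expRD cosD sinD.
by apply: eqc_ReIm => /=; ring.
Qed.

Lemma normc_Cexp z : normc (Cexp z) = expR (complex.Re z).
Proof.
apply/eqP; rewrite -(@eqrXn2 _ 2) ?normc_ge0 ?expR_ge0// sqr_normc_ReIm CexpE /=.
by rewrite !exprMn -mulrDr cos2Dsin2 mulr1.
Qed.

Lemma Cexp_neq0 z : Cexp z != 0.
Proof. by rewrite -normc_gt0 normc_Cexp expR_gt0. Qed.

Lemma CexpN z : Cexp (- z) = (Cexp z)^-1.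
Proof.
by apply: (mulIf (Cexp_neq0 z)); rewrite -CexpD addNr Cexp0 mulVf ?Cexp_neq0.
Qed.

Lemma CexpMz z (k : int) : Cexp (z *~ k) = Cexp z ^ k.
Proof.
have H (m : nat) : Cexp (z *+ m) = Cexp z ^+ m.
  by elim: m => [|m IH]; rewrite ?Cexp0 // mulrS CexpD IH exprS.
by case: k => m; [exact: H | rewrite NegzE mulrNz CexpN H].
Qed.

Lemma Cexp_sum N (f : 'I_N -> C) : Cexp (\sum_j f j) = \prod_j Cexp (f j).
Proof. by apply: (big_morph _ CexpD Cexp0). Qed.

Lemma CexpR (x : R) : Cexp (x%:C : C) = (expR x)%:C.
Proof. by rewrite /= cos0 sin0 mulr1 mulr0. Qed.

Lemma Cexp_deriv0 : is_derive (0 : C) 1 (@Cexp R) 1.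
Proof.
apply/cderivP => e e0; pose e1 := Num.min 1 (e / 20).
have e10 : 0 < e1 by rewrite lt_min ltr01 divr_gt0.
have e11 : e1 <= 1 by rewrite ge_min lexx.
have e1e : e1 <= e / 20 by rewrite ge_min lexx orbT.
clearbody e1.
have dexp : is_derive (0 : R) 1 expR 1.
  by apply: is_derive_eq (expR0 R).
have dcos : is_derive (0 : R) 1 cos 0.
  by apply: is_derive_eq; rewrite sin0 oppr0.
have dsin : is_derive (0 : R) 1 sin 1.
  by apply: is_derive_eq; rewrite cos0.
have [r1 r10 H1] := (is_derive_epsP _ _ _).1 dexp _ e10.
have [r2 r20 H2] := (is_derive_epsP _ _ _).1 dcos _ e10.
have [r3 r30 H3] := (is_derive_epsP _ _ _).1 dsin _ e10.
exists (Num.min e1 (Num.min r1 (Num.min r2 r3))); first by rewrite !lt_min e10 r10 r20.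
move=> h; rewrite subr0 !lt_min mul1r Cexp0 => /and4P[he hr1 hr2 hr3].
have := ler_Re_normc h; have := ler_Im_normc h.
set x := complex.Re h; set y := complex.Im h => yh xh.
have {H1} := H1 x; rewrite subr0 expR0 mul1r => /(_ (le_lt_trans xh hr1)) H1.
have {H2} := H2 y; rewrite subr0 cos0 mul0r subr0 => /(_ (le_lt_trans yh hr2)) H2.
have {H3} := H3 y; rewrite subr0 sin0 mul1r subr0 => /(_ (le_lt_trans yh hr3)) H3.
set N := normc h in he yh xh *.
apply: le_trans (ler_normc_ReIm _) _.
have -> : complex.Re (Cexp h - 1 - h) = expR x * (cos y - 1) + (expR x - 1 - x).
  by rewrite /x /y; case: h {x y N he hr1 hr2 hr3 yh xh H1 H2 H3} => a b /=; ring.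
have -> : complex.Im (Cexp h - 1 - h) = expR x * (sin y - y) + (expR x - 1) * y.
  by rewrite /x /y; case: h {x y N he hr1 hr2 hr3 yh xh H1 H2 H3} => a b /=; ring.
have ex0 : `|expR x| <= 3 /\ `|expR x - 1| <= 2 * e1.
  have : `|expR x - 1| <= 2 * e1.
    rewrite -[expR x - 1](subrK x) (le_trans (ler_normD _ _))//.
    have : e1 * `|x| <= 1 * `|x| by rewrite ler_wpM2r.
    lra.
  split => //; rewrite -[expR x](subrK 1) (le_trans (ler_normD _ _))// normr1; lra.
case: ex0 => ex3 ex2.
have A1 : `|expR x * (cos y - 1)| <= 3 * (e1 * N).
  by rewrite normrM ler_pM // (le_trans H2) // ler_wpM2l // ltW.
have A2 : `|expR x * (sin y - y)| <= 3 * (e1 * N).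
  by rewrite normrM ler_pM // (le_trans H3) // ler_wpM2l // ltW.
have A3 : `|(expR x - 1) * y| <= 2 * e1 * N by rewrite normrM ler_pM.
have A4 : `|expR x - 1 - x| <= e1 * N by rewrite (le_trans H1) // ler_wpM2l // ltW.
have A5 : e1 * N <= e / 20 * N by rewrite ler_wpM2r ?normc_ge0.
have := ler_normD (expR x * (cos y - 1)) (expR x - 1 - x).
have := ler_normD (expR x * (sin y - y)) ((expR x - 1) * y).
have : 0 <= e * N by rewrite mulr_ge0 ?normc_ge0 // ltW.
lra.
Qed.

Lemma Cexp_deriv z : is_derive z 1 (@Cexp R) (Cexp z).
Proof.
apply/cderivP => e e0.
pose K := normc (Cexp z); have K0 : 0 < K by rewrite normc_gt0 Cexp_neq0.
have [r r0 Hr] := (cderivP _ _ _).1 Cexp_deriv0 _ (divr_gt0 e0 K0).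
exists r => // w wr; have := Hr (w - z); rewrite subr0 => /(_ wr).
rewrite Cexp0 mul1r => H.
have -> : Cexp w - Cexp z - Cexp z * (w - z) = Cexp z * (Cexp (w - z) - 1 - (w - z)).
  have {1}-> : Cexp w = Cexp z * Cexp (w - z) by rewrite -CexpD addrC subrK.
  by rewrite !mulrBr mulr1.
rewrite normcM -/K; have : K * normc (Cexp (w - z) - 1 - (w - z)) <= K * (e / K * normc (w - z)).
  by rewrite ler_wpM2l // ltW.
by rewrite mulrA [K * (e / K)]mulrC divfK // gt_eqF.
Qed.

Lemma cosD2piz (x : R) (p : int) : cos (x + (pi *+ 2) *~ p) = cos x.
Proof.
have H (m : nat) (y : R) : cos (y + (pi *+ 2) *+ m) = cos y.
  by rewrite periodicn //; exact: cosD2pi.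
by case: p => m; [exact: H | rewrite NegzE mulrNz -(H m.+1) subrK].
Qed.

Lemma sinD2piz (x : R) (p : int) : sin (x + (pi *+ 2) *~ p) = sin x.
Proof.
have H (m : nat) (y : R) : sin (y + (pi *+ 2) *+ m) = sin y.
  by rewrite periodicn //; exact: sinD2pi.
by case: p => m; [exact: H | rewrite NegzE mulrNz -(H m.+1) subrK].
Qed.

(** Reduces y modulo 2 pi; cos is injective on each half of the period. *)
Lemma cos_eq1 (y : R) : cos y = 1 -> exists p : int, y = (pi *+ 2) *~ p.
Proof.
move=> cy; pose p := Num.floor (y / (pi *+ 2)); exists p.
have P0 : 0 < pi *+ 2 :> R by rewrite mulrn_wgt0 // pi_gt0.
pose y' := y + (pi *+ 2) *~ (- p).
suff y0 : y' = 0 by move: y0; rewrite /y' mulrNz => /eqP; rewrite subr_eq0 => /eqP.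
have cy' : cos y' = 1 by rewrite cosD2piz.
have /andP[] := floor_itv (y / (pi *+ 2)); rewrite -/p intrD ler_pdivlMr // ltr_pdivrMr //.
rewrite mulrDl mul1r => p1 p2.
have y1 : 0 <= y' by rewrite /y' mulrNz -mulrzl; lra.
have y2 : y' < pi *+ 2 by rewrite /y' mulrNz -mulrzl; lra.
have [yp|yp] := leP y' pi.
  by apply: (@cos_inj R); rewrite ?in_itv /= ?y1 ?lexx ?pi_ge0 // cy' cos0.
have : pi *+ 2 - y' = 0; last by lra.
apply: (@cos_inj R); rewrite ?in_itv /= ?lexx ?pi_ge0 //.
  by rewrite -mulr_natl; move: y2 yp; rewrite -mulr_natl => *; apply/andP; split; lra.
by rewrite addrC cosD2pi cosN cy' cos0.
Qed.

Lemma twopiiE : twopii R = 0 +i* (pi *+ 2).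
Proof. by rewrite /twopii mulr_natl. Qed.

Lemma twopii_mulz (p : int) : p%:~R * twopii R = 0 +i* ((pi *+ 2) *~ p).
Proof.
have nE (m : nat) : (m%:R : R[i]) = m%:R +i* 0.
  by elim: m => // m IH; rewrite -!natr1 IH; apply: eqc_ReIm => /=; rewrite ?addr0.
have H (m : nat) : m%:R * twopii R = 0 +i* ((pi *+ 2) *+ m).
  by rewrite twopiiE nE; apply: eqc_ReIm => /=; rewrite -[_ *+ m]mulr_natl; ring.
case: p => m; first exact: H.
by rewrite NegzE !mulrNz mulNr H; apply: eqc_ReIm => /=; rewrite ?oppr0.
Qed.

Lemma Cexp_periodic z (p : int) : Cexp (z + p%:~R * twopii R) = Cexp z.
Proof.
by case: z => a b; rewrite twopii_mulz /= addr0 cosD2piz sinD2piz.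
Qed.

Lemma Cexp_eq z w : Cexp z = Cexp w -> exists p : int, z = w + p%:~R * twopii R.
Proof.
move=> zw; have e1 : Cexp (z - w) = 1 by rewrite CexpD CexpN zw divff // Cexp_neq0.
have x0 : complex.Re (z - w) = 0.
  by apply: expR_inj; rewrite -normc_Cexp e1 normc1 expR0.
move: (e1); rewrite CexpE x0 expR0 !mul1r => -[/cos_eq1[p pE] _].
exists p; rewrite -[LHS](subrK w) addrC twopii_mulz; congr (_ + _).
exact: eqc_ReIm.
Qed.

Lemma Log_unique z : - pi < complex.Im z <= pi -> Log (Cexp z) = z.
Proof.
move=> /andP[bl bu]; have := normc_Cexp z; move: bl bu.
case: z => a b /= bl bu nE; rewrite /Log /= nE expRK; congr (_ +i* _).
have -> : expR a * cos b / expR a = cos b.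
  by rewrite mulrAC divff ?mul1r // expR_eq0.
rewrite pmulr_rge0 ?expR_gt0 //.
have [b0|b0] := leP 0 b.
  by rewrite sin_ge0_pi ?b0 // cosK // in_itv /= b0.
rewrite leNgt; have -> : sin b < 0.
  by rewrite -oppr_gt0 -sinN sin_gt0_pi // oppr_gt0 b0 /= ltrNl.
by rewrite /= cosKN ?opprK // (ltW b0) ltW.
Qed.

Lemma divc_norm z : z != 0 -> -1 <= complex.Re z / normc z <= 1.
Proof.
rewrite -normc_gt0 => z0; rewrite ler_pdivrMr // ler_pdivlMr // mulN1r mul1r.
by rewrite -ler_norml ler_Re_normc.
Qed.

Lemma Cexp_Log z : z != 0 -> Cexp (Log z) = z.
Proof.
move=> z0; have z0' : 0 < normc z by rewrite normc_gt0.
have h := divc_norm z0.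
have s : sin (acos (complex.Re z / normc z)) = `|complex.Im z| / normc z.
  rewrite sin_acos // -[RHS]ger0_norm ?divr_ge0 ?normc_ge0// -[RHS]sqrtr_sqr.
  congr (Num.sqrt _); rewrite !exprMn exprVn real_normK ?num_real //.
  rewrite -[1](@divff _ (normc z ^+ 2)) ?expf_neq0 ?gt_eqF //.
  by rewrite -mulrBl {1}sqr_normc_ReIm [X in X - _]addrC addrK.
have c : cos (acos (complex.Re z / normc z)) = complex.Re z / normc z.
  by rewrite acosK // in_itv.
rewrite CexpE /= lnK ?posrE //.
have -> : cos (Arg z) = complex.Re z / normc z.
  by rewrite -c /Arg; case: z {z0 z0' h s c} => x y; case: ifP => _; rewrite ?cosN.
have -> : sin (Arg z) = complex.Im z / normc z.
  have -> : sin (Arg z) = (-1) ^+ (complex.Im z < 0)%R * sin (acos (complex.Re z / normc z)).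
    rewrite /Arg; case: z {z0 z0' h s c} => x y; rewrite ltNge.
    by case: ifP => _; rewrite ?sinN ?expr0 ?expr1 ?mul1r ?mulN1r.
  by rewrite s mulrA; congr (_ * _); case: ltP => y0;
    [rewrite expr1 mulN1r ltr0_norm // opprK | rewrite expr0 mul1r ger0_norm].
by apply: eqc_ReIm; rewrite /= mulrC divfK // gt_eqF.
Qed.

Lemma Im_Log z : z != 0 -> - pi < complex.Im (Log z) <= pi.
Proof.
move=> z0; have h := divc_norm z0; rewrite /= /Arg.
case: z z0 h => x y z0 h; have [y0|y0] := leP 0 y.
  by rewrite acos_lepi // andbT (lt_le_trans _ (acos_ge0 h)) // oppr_lt0 pi_gt0.
rewrite ltrN2 acos_ltpi /=.
  by rewrite (le_trans _ (pi_ge0 R)) // oppr_le0 acos_ge0.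
case/andP: h => h1 ->; rewrite andbT lt_def h1 andbT.
apply/negP => /eqP E0; have n0 : normc (x +i* y) != 0 by rewrite normc_eq0.
have E : x = - normc (x +i* y) by rewrite -[LHS](divfK n0) -mulN1r; congr (_ * _).
have := sqr_normc_ReIm (x +i* y); rewrite [complex.Re _]/= [complex.Im _]/= {2}E sqrrN.
by move/eqP; rewrite addrC -subr_eq subrr eq_sym expf_eq0 /= lt_eqF.
Qed.

End ExpLog.

Section LogDeriv.
Variable R : realType.
Local Notation C := (R[i] : numFieldType).
Implicit Types (z w h d : C) (F G : C -> C).

Lemma cont_epsP (f : R -> R) (x : R) : {for x, continuous f} ->
  forall e : R, 0 < e -> exists2 r : R, 0 < r & forall y, `|y - x| < r -> `|f y - f x| < e.
Proof.
move=> /cvgrPdist_lt H e e0; have /nbhs_ballP[r r0 Hr] := H e e0.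
exists r => // y yr; rewrite distrC; apply: Hr.
by rewrite /ball /= distrC.
Qed.

Lemma ler_dist_normc z w : `|normc z - normc w| <= normc (z - w).
Proof.
have h1 := le_normcD (z - w) w; have h2 := le_normcD (w - z) z.
rewrite !subrK normc_distC in h1 h2; rewrite ler_norml normc_distC.
by apply/andP; split; lra.
Qed.

(** On the right half plane the argument is an arcsine, whose continuity at 0
    gives that of Log at 1. *)
Lemma Log_right_half z : 0 < complex.Re z ->
  Log z = ln (normc z) +i* asin (complex.Im z / normc z).
Proof.
move=> x0; have n0 : 0 < normc z.
  by rewrite normc_gt0; apply: contraTneq x0 => ->; rewrite ltxx.
set t := complex.Im z / normc z.
have t1 : -1 <= t <= 1.
  by rewrite ler_pdivrMr // ler_pdivlMr // mulN1r mul1r -ler_norml ler_Im_normc.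
rewrite -[RHS]Log_unique; last first.
  have := asin_geNpi2 t1; have := asin_lepi2 t1; have := pi_gt0 R => /= p0 h1 h2.
  by apply/andP; split; lra.
congr Log; rewrite CexpE /= lnK ?posrE // cos_asin // asinK ?in_itv //.
have -> : Num.sqrt (1 - t ^+ 2) = complex.Re z / normc z.
  rewrite -[RHS]ger0_norm ?divr_ge0 ?normc_ge0 ?ltW // -[RHS]sqrtr_sqr.
  congr (Num.sqrt _); rewrite /t !exprMn exprVn.
  rewrite -[1](@divff _ (normc z ^+ 2)) ?expf_neq0 ?gt_eqF //.
  by rewrite -mulrBl {1}sqr_normc_ReIm addrK.
by apply: eqc_ReIm; rewrite /= mulrC divfK // gt_eqF.
Qed.

Lemma near1_Re z : normc (z - 1) < 1 / 2 -> 1 / 2 < complex.Re z.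
Proof.
move=> h; have := le_lt_trans (ler_Re_normc _) h; rewrite ReB /= ltr_norml; lra.
Qed.

Lemma Log_cont1 (e : R) : 0 < e -> exists2 r : R, 0 < r <= 1 / 2 &
  forall z, normc (z - 1) < r -> normc (Log z) < e.
Proof.
move=> e0; have e2 : 0 < e / 2 by lra.
have cln : {for (1 : R), continuous (@ln R)} by exact: continuous_ln.
have casin : {for (0 : R), continuous (@asin R)} by apply: continuous_asin; lra.
have [r1 r10 H1] := cont_epsP cln e2; have [r2 r20 H2] := cont_epsP casin e2.
exists (Num.min (1 / 2) (Num.min r1 (r2 / 2))).
  by rewrite ge_min lexx andbT !lt_min r10 !divr_gt0.
move=> z; rewrite !lt_min => /and3P[h h1 h2].
have x0 := near1_Re h; have x0' : 0 < complex.Re z by lra.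
have n2 : 1 / 2 < normc z.
  by apply: lt_le_trans x0 _; rewrite (le_trans (ler_norm _)) // ler_Re_normc.
rewrite Log_right_half //; apply: le_lt_trans (ler_normc_ReIm _) _ => /=.
have A1 : `|ln (normc z)| < e / 2.
  have := H1 (normc z); rewrite ln1 subr0; apply; apply: le_lt_trans h1.
  by rewrite -[X in _ - X](normc1 R) ler_dist_normc.
have A2 : `|asin (complex.Im z / normc z)| < e / 2.
  have asin0 : asin (0 : R) = 0.
    have := pi_gt0 R => p0; rewrite -{1}(sin0 R) sinK // in_itv /=.
    by apply/andP; split; lra.
  have := H2 (complex.Im z / normc z); rewrite asin0 !subr0; apply.
  rewrite normrM normfV (ger0_norm (normc_ge0 z)) ltr_pdivrMr; last by lra.
  have : `|complex.Im z| <= normc (z - 1).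
    have -> : complex.Im z = complex.Im (z - 1) by case: (z) => a b /=; rewrite oppr0 addr0.
    exact: ler_Im_normc.
  have : r2 * (1 / 2) <= r2 * normc z by rewrite ler_wpM2l // ltW.
  lra.
lra.
Qed.

(** The complement of the cut of Log. *)
Definition offneg z : Prop := 0 < complex.Re z \/ complex.Im z != 0.

Lemma offneg_neq0 z : offneg z -> z != 0.
Proof. by case=> h; apply: contraTneq h => ->; rewrite ?ltxx ?eqxx. Qed.

Lemma offneg_Im_Log z : offneg z -> complex.Im (Log z) < pi.
Proof.
move=> z1; have z0 := offneg_neq0 z1; have n0 : 0 < normc z by rewrite normc_gt0.
have h := divc_norm z0; rewrite /= /Arg.
have h1 : -1 < complex.Re z / normc z.
  rewrite ltr_pdivlMr // mulN1r ltrNl; case: z1 => [x0|y0].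
    by rewrite (lt_trans _ n0) // oppr_lt0.
  apply: le_lt_trans (ler_norm _) _; rewrite normrN.
  rewrite -(@ltr_pXn2r _ 2) ?nnegrE ?normc_ge0// real_normK ?num_real //.
  by rewrite sqr_normc_ReIm ltrDl exprn_even_gt0 //= y0.
case/andP: h => _ h2.
case: z {z0 z1} n0 h1 h2 => x y n0 h1 h2; case: ifP => _.
  by rewrite acos_ltpi // h1.
by rewrite (le_lt_trans _ (pi_gt0 R)) // oppr_le0 acos_ge0 // ltW.
Qed.

Lemma Cexp_Log_branch z w : z != 0 -> w != 0 -> Cexp (Log z + Log (w / z)) = w.
Proof.
move=> z0 w0; rewrite CexpD !Cexp_Log //; first by rewrite mulrC divfK.
by rewrite mulf_neq0 // invr_neq0.
Qed.

(** Continuity of Log at z is reduced to continuity at 1: near z, the sum Log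
    z + Log (w / z) still has its imaginary part strictly between -pi and pi. *)
Lemma Log_local z : offneg z -> forall e : R, 0 < e -> exists2 r : R, 0 < r &
  forall w, normc (w - z) < r -> [/\ w != 0, Log w = Log z + Log (w / z) & normc (Log (w / z)) < e].
Proof.
move=> zc e e0; have z0 := offneg_neq0 zc; have n0 : 0 < normc z by rewrite normc_gt0.
have /andP[b1 _] := Im_Log z0; have b2 := offneg_Im_Log zc.
pose q := complex.Im (Log z); rewrite -/q in b1 b2.
pose e1 := Num.min e (Num.min (q + pi) (pi - q)).
have e10 : 0 < e1 by rewrite !lt_min e0; apply/andP; split; lra.
have [r /andP[r0 r1] Hr] := Log_cont1 e10.
exists (r * normc z); first exact: mulr_gt0.
move=> w wr; have wz : normc (w / z - 1) < r.
  have -> : w / z - 1 = (w - z) / z by rewrite mulrBl divff.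
  by rewrite normcM normcV ltr_pdivrMr.
have w0 : w != 0.
  apply/eqP => w0; have := near1_Re (lt_le_trans wz r1); rewrite w0 mul0r /=; lra.
have := Hr _ wz; rewrite /e1 !lt_min => /and3P[h1 h2 h3]; split => //.
rewrite -[RHS]Log_unique ?Cexp_Log_branch //.
have := ler_Im_normc (Log (w / z)); rewrite ler_norml => /andP[h4 h5].
have -> : complex.Im (Log z + Log (w / z)) = q + complex.Im (Log (w / z)) by [].
by apply/andP; split; lra.
Qed.

(** The inverse function rule: continuity of a local inverse of the
    exponential is enough for differentiability, since the exponential has a
    nonzero derivative. *)
Lemma cderiv_inv_exp G z : Cexp (G z) = z ->
  (exists2 r : R, 0 < r & forall w, normc (w - z) < r -> Cexp (G w) = w) ->
  (forall e : R, 0 < e -> exists2 r : R, 0 < r &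
    forall w, normc (w - z) < r -> normc (G w - G z) < e) ->
  is_derive z 1 G z^-1.
Proof.
move=> Gz [r0 r00 H0] cG; have z0 : z != 0 by rewrite -Gz Cexp_neq0.
have n0 : 0 < normc z by rewrite normc_gt0.
apply/cderivP => e e0.
(* The first bound makes D comparable to w - z, by ED below; the second makes
   the remainder small. *)
pose e1 := Num.min (normc z / 2) (e * normc z ^+ 2 / 2).
have e10 : 0 < e1 by rewrite lt_min !divr_gt0 // mulr_gt0 // exprn_gt0.
have [q q0 Hq] := (cderivP _ _ _).1 (Cexp_deriv (G z)) e1 e10.
have [r1 r10 H1] := cG q q0.
exists (Num.min r0 r1); first by rewrite lt_min r00.
move=> w; rewrite lt_min => /andP[/H0 Gw /H1/Hq]; rewrite Gw Gz.
set D := G w - G z => HD.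
have ED : normc z * normc D <= normc (w - z) + e1 * normc D.
  rewrite -normcM; have -> : z * D = (w - z) + - (w - z - z * D) by ring.
  by rewrite (le_trans (le_normcD _ _)) // normcN lerD2l.
have le1 : e1 * normc D <= normc z / 2 * normc D.
  by rewrite ler_wpM2r ?normc_ge0 // ge_min lexx.
have le2 : e1 * normc D <= e * normc z ^+ 2 / 2 * normc D.
  by rewrite ler_wpM2r ?normc_ge0 // ge_min lexx orbT.
have -> : D - z^-1 * (w - z) = - (z^-1 * (w - z - z * D)) by field.
rewrite normcN normcM normcV -(ler_pM2l n0) mulrA divff ?mul1r ?gt_eqF //.
apply: le_trans HD _; apply: le_trans le2 _.
have -> : normc z * (e * normc (w - z)) = (e * normc z) * normc (w - z) by ring.
have -> : e * normc z ^+ 2 / 2 * normc D = (e * normc z) * (normc z * normc D / 2) by ring.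
rewrite ler_pM2l ?mulr_gt0 //; move: ED le1; lra.
Qed.

Lemma Log_deriv z : offneg z -> is_derive z 1 (@Log R) z^-1.
Proof.
move=> zc; apply: cderiv_inv_exp; first exact/Cexp_Log/offneg_neq0.
  have [r r0 Hr] := Log_local zc ltr01.
  by exists r => // w /Hr[w0 _ _]; exact: Cexp_Log.
move=> e e0; have [r r0 Hr] := Log_local zc e0.
by exists r => // w /Hr[w0 -> h]; rewrite addrC addKr.
Qed.

(** On each side of the negative real axis, Log is described by a function
    which is holomorphic across the cut. The closed upper side is the one that
    contains the cut itself. *)
Lemma LogN z : 0 < complex.Re z -> Log (- z) =
  Log z + (if 0 <= complex.Im (- z) then 0 +i* pi else 0 +i* (- pi)).
Proof.
move=> x0; have z0 : z != 0 by apply: offneg_neq0; left.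
have p0 := pi_gt0 R.
have EI : Cexp (0 +i* pi : C) = -1 /\ Cexp (0 +i* (- pi) : C) = -1.
  by rewrite /= expR0 cosN sinN cospi sinpi !mul1r oppr0; split; apply: eqc_ReIm; rewrite /= ?oppr0.
have ImL : complex.Im (Log z) = asin (complex.Im z / normc z) by rewrite Log_right_half.
have n0 : 0 < normc z by rewrite normc_gt0.
set t := complex.Im z / normc z in ImL.
have t1 : -1 <= t <= 1.
  by rewrite ler_pdivrMr // ler_pdivlMr // mulN1r mul1r -ler_norml ler_Im_normc.
have a1 := asin_geNpi2 t1; have a2 := asin_lepi2 t1.
have sA : sin (asin t) = t by rewrite asinK // in_itv.
have IN : complex.Im (- z) = - complex.Im z by case: (z).
rewrite IN oppr_ge0; case: leP => y0.
  rewrite -[RHS]Log_unique ?CexpD ?EI.1 ?Cexp_Log ?mulrN1 //.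
  have -> : complex.Im (Log z + 0 +i* pi) = complex.Im (Log z) + pi by [].
  rewrite ImL.
  have : asin t <= 0.
    rewrite leNgt; apply/negP => h; have := sin_gt0_pi (x := asin t); rewrite h sA.
    have -> : asin t < pi by lra.
    by move=> /(_ isT); rewrite ltr_pdivlMr // mul0r; lra.
  by move=> h; apply/andP; split; lra.
rewrite -[RHS]Log_unique ?CexpD ?EI.2 ?Cexp_Log ?mulrN1 //.
have -> : complex.Im (Log z + 0 +i* (- pi)) = complex.Im (Log z) - pi by [].
rewrite ImL.
have : 0 < asin t.
  rewrite ltNge; apply/negP => h.
  have := sin_ge0_pi (x := - asin t); rewrite oppr_ge0 h sinN sA /=.
  have -> : - asin t <= pi by lra.
  by move=> /(_ isT); rewrite oppr_ge0 ler_pdivrMr // mul0r; lra.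
by move=> h; apply/andP; split; lra.
Qed.

Lemma Log_conj z : offneg z -> Log z^*%C = (Log z)^*%C.
Proof.
move=> zc; have z0 := offneg_neq0 zc.
have /andP[b1 _] := Im_Log z0; have b2 := offneg_Im_Log zc.
rewrite -[RHS]Log_unique.
  by congr Log; rewrite -{1}(Cexp_Log z0); case: (Log z) => a b /=; rewrite cosN sinN mulrN.
by move: b1 b2; case: (Log z) => a b /= b1 b2; apply/andP; split; lra.
Qed.

End LogDeriv.

(** * Integrable singularities on the real line *)

Section RealIntegral.
Variable R : realType.
Local Notation mu := (@lebesgue_measure R).
Implicit Types f F g : R -> R.

Lemma measurable_pointwise_continuous (D : set R) f : measurable D ->
  (forall t, D t -> {for t, continuous f}) -> measurable_fun D f.
Proof.
move=> mD cf; apply: subspace_continuous_measurable_fun => //.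
by apply: continuous_in_subspaceT => t; rewrite inE; exact: cf.
Qed.

(** The interval is open because the integrand may blow up at an end, as
    [sing] does; the bound follows from monotone convergence along [a +
    1/(n+1), b - 1/(n+1)]. *)
Lemma integral_oo_le_primitive f F (a b B : R) : 0 <= B ->
  (forall t, a < t < b -> is_derive t 1 F (f t)) ->
  (forall t, a < t < b -> {for t, continuous f}) ->
  (forall t, a < t < b -> 0 <= f t) ->
  (forall t, a < t < b -> `|F t| <= B) ->
  (\int[mu]_(x in `]a, b[) (f x)%:E <= (2 * B)%:E)%E.
Proof.
move=> B0 dF cf f0 FB.
pose e (n : nat) : R := n.+1%:R^-1.
have e0 n : 0 < e n by rewrite invr_gt0 ltr0n.
pose I (n : nat) : set R := `[a + e n, b - e n]%classic.
have eI n : I n `<=` `]a, b[%classic.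
  by move=> x; rewrite /I /= !in_itv /= => /andP[h1 h2]; have := e0 n => h; apply/andP; split; lra.
have mI n : measurable (I n) by exact: measurable_itv.
have mf : measurable_fun `]a, b[ f.
  by apply: measurable_pointwise_continuous => // t; rewrite /= in_itv /= => /cf.
have -> : `]a, b[%classic = \bigcup_n I n.
  apply/seteqP; split => x /=; last by move=> [n _ /eI].
  rewrite in_itv /= => /andP[ax xb].
  have m0 : 0 < Num.min (x - a) (b - x) by rewrite lt_min !subr_gt0 ax.
  exists (Num.truncn (Num.min (x - a) (b - x))^-1) => //.
  have : e (Num.truncn (Num.min (x - a) (b - x))^-1) < Num.min (x - a) (b - x).
    by rewrite /e invf_plt ?posrE ?ltr0n //; exact: truncnS_gt.
  by rewrite lt_min /I /= in_itv /= => /andP[h1 h2]; apply/andP; split; lra.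
have I0 n x : I n x -> (0 <= (f x)%:E)%E.
  by move=> /eI; rewrite /= in_itv /= lee_fin; exact: f0.
have cv : (\int[mu]_(x in I i) (f x)%:E)%E @[i --> \oo] -->
    (\int[mu]_(x in \bigcup_i I i) (f x)%:E)%E.
  apply: ge0_nondecreasing_set_cvg_integral => //.
  - move=> n m nm; apply/subsetPset => x; rewrite /I /= !in_itv /=.
    have : e m <= e n by rewrite lef_pV2 ?posrE ?ltr0n // ler_nat ltnS.
    by move=> h /andP[h1 h2]; apply/andP; split; lra.
  - by move=> n; apply/measurable_EFinP; apply: measurable_funS mf.
rewrite -(cvg_lim _ cv) //; apply: lime_le; first by apply/cvg_ex; eexists; exact: cv.
apply: nearW => n; have [ab|ab] := ltP (a + e n) (b - e n); last first.
  have B2 : (0 <= (2 * B)%:E)%E by rewrite lee_fin mulr_ge0.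
  rewrite /I; move: ab; rewrite le_eqVlt => /predU1P[->|ab].
    by rewrite set_itv1 integral_set1.
  by rewrite set_itv_ge ?integral_set0 // bnd_simp -ltNge.
have sub t : t \in `[a + e n, b - e n] -> a < t < b.
  by move=> h; have := eI n t h; rewrite /= in_itv.
rewrite (@continuous_FTC2 _ f F _ _ ab).
- rewrite -EFinB lee_fin.
  have h1 : `|F (b - e n)| <= B by apply/FB/sub; rewrite in_itv /= lexx ltW.
  have h2 : `|F (a + e n)| <= B by apply/FB/sub; rewrite in_itv /= lexx ltW.
  by move: h1 h2; rewrite !ler_norml => /andP[_ h1] /andP[h2 _]; lra.
- by apply: continuous_in_subspaceT => t; rewrite inE => /sub/cf.
- have cF t : t \in `[a + e n, b - e n] -> {for t, continuous F}.
    move=> /sub/dF h; apply/differentiable_continuous/derivable1_diffP.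
    exact: (@ex_derive _ _ _ _ _ _ _ h).
  split.
  + by move=> t /subset_itv_oo_cc /sub/dF h; exact: (@ex_derive _ _ _ _ _ _ _ h).
  + by apply/cvg_at_right_filter/cF; rewrite in_itv /= lexx ltW.
  + by apply/cvg_at_left_filter/cF; rewrite in_itv /= lexx ltW.
- move=> t /subset_itv_oo_cc /sub/dF h; rewrite derive1E.
  exact: (@derive_val _ _ _ _ _ _ _ h).
Qed.

(** An integrable function that dominates logarithmic singularities at c,
    uniformly in c. *)
Definition sing (c t : R) : R := (Num.sqrt `|t - c|)^-1.

Lemma sing_ge0 c t : 0 <= sing c t.
Proof. by rewrite invr_ge0 sqrtr_ge0. Qed.

Lemma sing_continuous c t : t != c -> {for t, continuous (sing c)}.
Proof.
move=> tc; apply: continuousV; first by rewrite gt_eqF // sqrtr_gt0 normr_gt0 subr_eq0.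
apply: continuous_comp; last exact: sqrt_continuous.
apply: continuous_comp; last exact: norm_continuous.
by apply: continuousB; [exact: cvg_id | exact: cvg_cst].
Qed.

Lemma sqrt2_le (x : R) : x < 2 -> 2 * Num.sqrt x <= 4.
Proof.
move=> x2; have : Num.sqrt x <= Num.sqrt 4 by rewrite ler_wsqrtr //; lra.
have -> : (4 : R) = 2 ^+ 2 by rewrite -natrX.
by rewrite sqrtr_sqr ger0_norm //; lra.
Qed.

Lemma sing_right_le (c : R) : (\int[mu]_(x in `]c, (c + 2)%R[) (sing c x)%:E <= 8%:R%:E)%E.
Proof.
have -> : 8%:R%:E = (2 * 4)%:E :> \bar R by rewrite -natrM.
apply: (@integral_oo_le_primitive (sing c) (fun t => 2 * Num.sqrt (t - c)) _ _ 4) => //.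
- move=> t /andP[ct _]; have t0 : 0 < t - c by rewrite subr_gt0.
  have := is_derive1_sqrt t0 => ds.
  have dt : is_derive t (1 : R) (fun t : R => t - c) 1 := is_derive_shift t 1 (- c).
  have := @is_derive1_comp _ Num.sqrt (fun t => t - c) t _ _ ds dt => dc.
  have E : sing c t = 2 *: ((2 * Num.sqrt (t - c))^-1 * 1).
    by rewrite /sing ger0_norm ?ltW // mulr1 /GRing.scale /= invfM mulrA divff ?mul1r.
  by rewrite E; exact: (is_deriveZ 2 dc).
- by move=> t /andP[ct _]; apply: sing_continuous; rewrite gt_eqF.
- by move=> t _; exact: sing_ge0.
- move=> t /andP[ct tc]; rewrite ger0_norm ?mulr_ge0 ?sqrtr_ge0 //.
  by apply: sqrt2_le; rewrite ltrBlDl.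
Qed.

Lemma sing_left_le (c : R) : (\int[mu]_(x in `](c - 2)%R, c[) (sing c x)%:E <= 8%:R%:E)%E.
Proof.
have -> : 8%:R%:E = (2 * 4)%:E :> \bar R by rewrite -natrM.
apply: (@integral_oo_le_primitive (sing c) (fun t => - 2 * Num.sqrt (c - t)) _ _ 4) => //.
- move=> t /andP[_ ct]; have t0 : 0 < c - t by rewrite subr_gt0.
  have := is_derive1_sqrt t0 => ds.
  have dt : is_derive t (1 : R) (fun t : R => c - t) (-1).
    by have := is_deriveB (is_derive_cst c t (1 : R)) (is_derive_id t (1 : R)); rewrite sub0r.
  have := @is_derive1_comp _ Num.sqrt (fun t => c - t) t _ _ ds dt => dc.
  have E : sing c t = (- 2) *: ((2 * Num.sqrt (c - t))^-1 * (-1)).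
    rewrite /sing distrC ger0_norm ?ltW // mulrN1 /GRing.scale /= mulrNN.
    by rewrite invfM mulrA divff ?mul1r.
  by rewrite E; exact: (is_deriveZ (-2) dc).
- by move=> t /andP[_ ct]; apply: sing_continuous; rewrite lt_eqF.
- by move=> t _; exact: sing_ge0.
- move=> t /andP[ct tc]; rewrite mulNr normrN ger0_norm ?mulr_ge0 ?sqrtr_ge0 //.
  by apply: sqrt2_le; lra.
Qed.

Lemma integrable_fin (f : R -> R) (A : set R) (K : R) : measurable A -> measurable_fun A f ->
  (forall t, A t -> 0 <= f t) -> (\int[mu]_(x in A) (f x)%:E <= K%:E)%E ->
  mu.-integrable A (EFin \o f) /\ \int[mu]_(x in A) f x <= K.
Proof.
move=> mA mf f0 fK; have i0 : (0 <= \int[mu]_(x in A) (f x)%:E)%E.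
  by apply: integral_ge0 => x /f0; rewrite lee_fin.
split.
  apply/integrableP; split; first exact/measurable_EFinP.
  have -> : (\int[mu]_(x in A) `|(EFin \o f) x| = \int[mu]_(x in A) (f x)%:E)%E.
    by apply: eq_integral => x; rewrite inE => /f0 h; rewrite /= ger0_norm.
  by rewrite (le_lt_trans fK) // ltry.
rewrite /Rintegral -lee_fin fineK // ge0_fin_numE //.
by rewrite (le_lt_trans fK) // ltry.
Qed.

Lemma measurable_sing c (A : set R) : measurable_fun A (sing c).
Proof.
apply: (measurable_funS (E := setT)) => //.
have -> : [set: R] = (~` [set c]) `|` [set c] by rewrite setUC setUv.
apply/measurable_funU => //; first exact: measurableC.
split; last exact: measurable_fun_set1.
apply: measurable_pointwise_continuous; first exact: measurableC.
by move=> t /= /eqP tc; exact: sing_continuous.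
Qed.

Lemma sing_integrable (c : R) : 0 < c <= 1 ->
  mu.-integrable `[0, 1] (EFin \o sing c) /\ \int[mu]_(t in `[0, 1]) sing c t <= 16.
Proof.
move=> /andP[c0 c1]; have sg x : (0 <= (sing c x)%:E)%E by rewrite lee_fin sing_ge0.
apply: integrable_fin => //; first exact: measurable_sing.
  by move=> t _; exact: sing_ge0.
(* Intervals of length 2 on both sides of c cover [0, 1] wherever c is. *)
pose A : set R := `]c - 2, c[%classic; pose B : set R := `]c, c + 2[%classic.
have mAB : measurable (A `|` B) by apply: measurableU; exact: measurable_itv.
apply: (@le_trans _ _ (\int[mu]_(x in (A `|` B) `|` [set c]) (sing c x)%:E)%E).
  apply: ge0_subset_integral => //; first by apply: measurableU.
    by apply/measurable_EFinP; exact: measurable_sing.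
  move=> t; rewrite /= !in_itv /= => /andP[t0 t1].
  case: (ltgtP t c) => tc; [left; left|left; right|by right]; rewrite /A /B /= in_itv /=.
    by rewrite tc andbT; lra.
  by rewrite tc /=; lra.
rewrite ge0_integral_setU //; first last.
  by rewrite disj_set2E; apply/eqP/seteqP; split => // t [[|]]; rewrite /A /B /= in_itv /= => /andP[h1 h2] tc; move: h1 h2; rewrite tc ltxx.
  by apply/measurable_EFinP; exact: measurable_sing.
rewrite integral_set1 adde0 ge0_integral_setU //; first last.
  by rewrite disj_set2E; apply/eqP/seteqP; split => // t []; rewrite /A /B /= !in_itv /= => /andP[h1 h2] /andP[h3 h4]; lra.
  by apply/measurable_EFinP; exact: measurable_sing.
  exact: measurable_itv.
  exact: measurable_itv.
have -> : 16%:R%:E = (8%:R%:E + 8%:R%:E)%E :> \bar R by rewrite -EFinD -natrD.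
by apply: leeD; [exact: sing_left_le | exact: sing_right_le].
Qed.

End RealIntegral.

(** * Integrals of complex functions over the unit interval *)

Section ComplexIntegral.
Variable R : realType.
Local Notation C := (R[i] : numFieldType).
Local Notation mu := (@lebesgue_measure R).
Implicit Types f g : R -> C.

Definition Cmeasurable (D : set R) f :=
  measurable_fun D (fun t => complex.Re (f t)) /\ measurable_fun D (fun t => complex.Im (f t)).

Definition Cintegrable f :=
  mu.-integrable `[0, 1] (EFin \o (fun t => complex.Re (f t))) /\
  mu.-integrable `[0, 1] (EFin \o (fun t => complex.Im (f t))).

Lemma CintegralB f g : Cintegrable f -> Cintegrable g ->
  Cintegrable (fun t => f t - g t) /\
  Cintegral01 (fun t => f t - g t) = Cintegral01 f - Cintegral01 g.
Proof.
move=> [f1 f2] [g1 g2]; split.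
  split.
    rewrite (_ : EFin \o _ = (EFin \o (fun t => complex.Re (f t))) \- (EFin \o (fun t => complex.Re (g t))))%E.
      exact: integrableB.
    by apply/funext => t /=; case: (f t) (g t) => ? ? [].
  rewrite (_ : EFin \o _ = (EFin \o (fun t => complex.Im (f t))) \- (EFin \o (fun t => complex.Im (g t))))%E.
    exact: integrableB.
  by apply/funext => t /=; case: (f t) (g t) => ? ? [].
apply: eqc_ReIm => /=.
  by rewrite -RintegralB //; apply: eq_Rintegral => t _; rewrite ReB.
by rewrite -RintegralB //; apply: eq_Rintegral => t _; case: (f t) (g t) => ? ? [].
Qed.

Lemma CintegralZ (c : C) f : Cintegrable f ->
  Cintegrable (fun t => c * f t) /\ Cintegral01 (fun t => c * f t) = c * Cintegral01 f.
Proof.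
case: c => a b [f1 f2]; have iZ (h : R -> R) (k : R) : mu.-integrable `[0, 1] (EFin \o h) ->
    mu.-integrable `[0, 1] (EFin \o (fun t => k * h t)).
  move=> hi; rewrite (_ : EFin \o _ = (fun t => k%:E * (EFin \o h) t)%E).
    exact: integrableZl.
  by apply/funext => t /=; rewrite EFinM.
have ReE t : complex.Re ((a +i* b) * f t) = a * complex.Re (f t) - b * complex.Im (f t).
  by case: (f t).
have ImE t : complex.Im ((a +i* b) * f t) = a * complex.Im (f t) + b * complex.Re (f t).
  by case: (f t).
split.
  split; rewrite /=.
    rewrite (_ : EFin \o _ = (EFin \o (fun t => (a * complex.Re (f t))%R)) \- (EFin \o (fun t => (b * complex.Im (f t))%R)))%E.
      by apply: integrableB => //; exact: iZ.
    by apply/funext => t /=; rewrite ReE EFinB.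
  rewrite (_ : EFin \o _ = (EFin \o (fun t => (a * complex.Im (f t))%R)) \+ (EFin \o (fun t => (b * complex.Re (f t))%R)))%E.
    by apply: integrableD => //; exact: iZ.
  by apply/funext => t /=; rewrite ImE EFinD.
apply: eqc_ReIm => /=.
  rewrite -!RintegralZl // -RintegralB //; [|exact: iZ|exact: iZ].
  by apply: eq_Rintegral => t _; exact: ReE.
rewrite -!RintegralZl // -RintegralD //; [|exact: iZ|exact: iZ].
by apply: eq_Rintegral => t _; exact: ImE.
Qed.

Lemma Cintegral_conj f : Cintegrable f ->
  Cintegral01 (fun t => (f t)^*%C) = (Cintegral01 f)^*%C.
Proof.
move=> [f1 f2]; apply: eqc_ReIm => /=.
  by apply: eq_Rintegral => t _; case: (f t).
rewrite -mulN1r -RintegralZl //; apply: eq_Rintegral => t _.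
by rewrite mulN1r; case: (f t).
Qed.

Lemma eq_Cintegral f g : (forall t : R, 0 <= t <= 1 -> f t = g t) ->
  Cintegral01 f = Cintegral01 g.
Proof.
by move=> fg; apply: eqc_ReIm => /=; apply: eq_Rintegral => t; rewrite inE /= in_itv /= => /fg ->.
Qed.

(** Pointwise bounds on integrands fail at one value of t, where the segment
    meets a singularity; a dominating function can be changed there. *)
Lemma dominating_extend f (g : R -> R) (c : R) : mu.-integrable `[0, 1] (EFin \o g) ->
  (forall t : R, 0 <= t <= 1 -> t != c -> normc (f t) <= g t) ->
  exists g' : R -> R, [/\ mu.-integrable `[0, 1] (EFin \o g'),
    \int[mu]_(t in `[0, 1]) g' t = \int[mu]_(t in `[0, 1]) g t &
    forall t : R, 0 <= t <= 1 -> normc (f t) <= g' t].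
Proof.
move=> ig fg; pose K := normc (f c) - g c.
pose g' t := g t + (if t == c then K else 0).
have mind : measurable_fun `[(0 : R), 1] (fun t : R => if t == c then K else 0).
  apply: (measurable_funS (E := setT)) => //.
  have -> : [set: R] = (~` [set c]) `|` [set c] by rewrite setUC setUv.
  apply/measurable_funU => //; first exact: measurableC.
  split; last exact: measurable_fun_set1.
  apply: (eq_measurable_fun (cst 0 : R -> R)); last exact: measurable_cst.
  by move=> t; rewrite inE /= => /eqP/negbTE ->.
have mg : measurable_fun `[(0 : R), 1] g by apply/measurable_EFinP; exact: measurable_int ig.
have mg' : measurable_fun `[(0 : R), 1] g' by exact: measurable_funD.
have ae : ae_eq mu `[(0 : R), 1]%classic (EFin \o g) (EFin \o g').
  exists [set c]; split => //; first exact: lebesgue_measure_set1.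
  move=> t /= H; apply: contra_notP H => /eqP tc _.
  by rewrite /g' (negbTE tc) addr0.
have [ig' Eg'] : mu.-integrable `[0, 1] (EFin \o g') /\
    (\int[mu]_(x in `[0%R, 1%R]) (EFin \o g') x = \int[mu]_(x in `[0%R, 1%R]) (EFin \o g) x)%E.
  split; last by symmetry; apply: ae_eq_integral => //; exact/measurable_EFinP.
  apply/integrableP; split; first exact/measurable_EFinP.
  case/integrableP: ig => _; apply: le_lt_trans; rewrite le_eqVlt; apply/orP; left.
  apply/eqP; apply: ae_eq_integral => //.
  - by apply: measurableT_comp => //; exact/measurable_EFinP.
  - by apply: measurableT_comp => //; exact/measurable_EFinP.
  - case: ae => N [mN N0 sN]; exists N; split => //.
    by apply: subset_trans sN => t /= H; apply: contra_not H => H D; have [->] := H D.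
exists g'; split => //; first by rewrite /Rintegral Eg'.
move=> t t01; rewrite /g'; case: (eqVneq t c) => [->|tc].
  by rewrite /K addrC subrK.
by rewrite addr0 fg.
Qed.

Lemma Cintegrable_dominated f (g : R -> R) (c : R) : Cmeasurable `[(0 : R), 1] f ->
  mu.-integrable `[0, 1] (EFin \o g) ->
  (forall t : R, 0 <= t <= 1 -> t != c -> normc (f t) <= g t) -> Cintegrable f.
Proof.
move=> [m1 m2] ig /(dominating_extend ig)[g' [ig' _ fg']].
split; (apply: le_integrable ig' => //; first exact/measurable_EFinP) => t;
  rewrite /= in_itv /= lee_fin => t01;
  (apply: le_trans (ler_norm _) => //; apply: le_trans (fg' _ t01)).
  exact: ler_Re_normc.
exact: ler_Im_normc.
Qed.

(** The factor 2, harmless here, comes from bounding the real and imaginary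
    parts separately. *)
Lemma Cintegral_bound f (g : R -> R) (c : R) : Cintegrable f ->
  mu.-integrable `[0, 1] (EFin \o g) ->
  (forall t : R, 0 <= t <= 1 -> t != c -> normc (f t) <= g t) ->
  normc (Cintegral01 f) <= 2 * \int[mu]_(t in `[0, 1]) g t.
Proof.
move=> [i1 i2] ig /(dominating_extend ig)[g' [ig' <- fg']].
apply: le_trans (ler_normc_ReIm _) _; rewrite mulr2n mulrDl mul1r /=.
have H (h : R -> R) : mu.-integrable `[0, 1] (EFin \o h) ->
    (forall t : R, 0 <= t <= 1 -> `|h t| <= g' t) ->
    `|\int[mu]_(t in `[0, 1]) h t| <= \int[mu]_(t in `[0, 1]) g' t.
  move=> ih hg; apply: le_trans (le_normr_Rintegral _ ih) _ => //.
  apply: le_Rintegral => //; first exact: integrable_norm.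
by apply: lerD; apply: H => // t t01; apply: le_trans (fg' t t01);
  [exact: ler_Re_normc | exact: ler_Im_normc].
Qed.

Definition Ccvg (u : nat -> C) (l : C) :=
  forall e : R, 0 < e -> exists N : nat, forall m, (N <= m)%N -> normc (u m - l) < e.

Lemma CcvgP u l : Ccvg u l <->
  (fun m => complex.Re (u m)) @ \oo --> complex.Re l /\
  (fun m => complex.Im (u m)) @ \oo --> complex.Im l.
Proof.
split=> [H|[H1 H2] e e0].
  have D m : complex.Re (u m) - complex.Re l = complex.Re (u m - l) /\
      complex.Im (u m) - complex.Im l = complex.Im (u m - l).
    by case: (u m) (l) => ? ? [].
  by split; apply/cvgrPdist_lt => e /H[N HN]; exists N => // m /HN h;
    rewrite distrC ?(D m).1 ?(D m).2; apply: le_lt_trans h;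
    [exact: ler_Re_normc | exact: ler_Im_normc].
have e2 : 0 < e / 2 by lra.
move/cvgrPdist_lt : H1 => /(_ _ e2)[N1 _ H1].
move/cvgrPdist_lt : H2 => /(_ _ e2)[N2 _ H2].
exists (maxn N1 N2) => m; rewrite geq_max => /andP[/H1 /= h1 /H2 /= h2].
apply: le_lt_trans (ler_normc_ReIm _) _.
have -> : complex.Re (u m - l) = - (complex.Re l - complex.Re (u m)).
  by case: (u m) (l) => ? ? [? ?] /=; ring.
have -> : complex.Im (u m - l) = - (complex.Im l - complex.Im (u m)).
  by case: (u m) (l) => ? ? [? ?] /=; ring.
rewrite !normrN; lra.
Qed.

(** Dominated convergence, with one exceptional point c for the logarithmic
    singularity of Li_1. *)
Lemma Cdominated (f_ : nat -> R -> C) f (g : R -> R) (c : R) :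
  (forall m, Cmeasurable `[(0 : R), 1] (f_ m)) -> Cmeasurable `[(0 : R), 1] f ->
  mu.-integrable `[0, 1] (EFin \o g) ->
  (forall m (t : R), 0 <= t <= 1 -> t != c -> normc (f_ m t) <= g t) ->
  (forall t : R, 0 <= t <= 1 -> t != c -> Ccvg (fun m => f_ m t) (f t)) ->
  Cintegrable f /\ Ccvg (fun m => Cintegral01 (f_ m)) (Cintegral01 f).
Proof.
move=> mf_ mf ig fg cv.
have H (h_ : nat -> R -> R) (h : R -> R) :
    (forall m, measurable_fun `[(0 : R), 1] (h_ m)) -> measurable_fun `[(0 : R), 1] h ->
    (forall m (t : R), 0 <= t <= 1 -> t != c -> `|h_ m t| <= g t) ->
    (forall t : R, 0 <= t <= 1 -> t != c -> h_ m t @[m --> \oo] --> h t) ->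
    mu.-integrable `[0, 1] (EFin \o h) /\
    (fun m => \int[mu]_(t in `[0, 1]) h_ m t) @ \oo --> \int[mu]_(t in `[0, 1]) h t.
  move=> mh_ mh hg hcv.
  have [] := @dominated_convergence _ _ _ mu `[0, 1]%classic _
     (fun m => EFin \o h_ m) (EFin \o h) (EFin \o g).
  - exact: measurable_itv.
  - by move=> m; apply/measurable_EFinP; exact: mh_.
  - by apply/measurable_EFinP.
  - exists [set c]; split => //; first exact: lebesgue_measure_set1.
    move=> t /= Ht; apply: contra_notP Ht => /eqP tc; rewrite in_itv /= => t01.
    by apply: cvg_EFin; [exact: nearW | exact: hcv].
  - exact: ig.
  - exists [set c]; split => //; first exact: lebesgue_measure_set1.
    move=> t /= Ht; apply: contra_notP Ht => /eqP tc m; rewrite in_itv /= => t01.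
    by rewrite lee_fin; exact: hg.
  move=> ih _ icv; split => //.
  apply: fine_cvg; rewrite fineK //; exact: integrable_fin_num.
have [||||i1 c1] := H (fun m t => complex.Re (f_ m t)) (fun t => complex.Re (f t)).
- by move=> m; exact: (mf_ m).1.
- exact: mf.1.
- by move=> m t t01 tc; apply: le_trans (fg m t t01 tc); exact: ler_Re_normc.
- by move=> t t01 tc; exact: ((CcvgP _ _).1 (cv t t01 tc)).1.
have [||||i2 c2] := H (fun m t => complex.Im (f_ m t)) (fun t => complex.Im (f t)).
- by move=> m; exact: (mf_ m).2.
- exact: mf.2.
- by move=> m t t01 tc; apply: le_trans (fg m t t01 tc); exact: ler_Im_normc.
- by move=> t t01 tc; exact: ((CcvgP _ _).1 (cv t t01 tc)).2.
by split => //; apply/CcvgP.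
Qed.

Definition Ccontinuous_at f (t : R) := forall e : R, 0 < e ->
  exists2 r : R, 0 < r & forall s : R, `|s - t| < r -> normc (f s - f t) < e.

Lemma ImB (z w : C) : complex.Im (z - w) = complex.Im z - complex.Im w.
Proof. by case: z w => ? ? []. Qed.

(** Neither 0, where integrands are divided by t, nor the singular point c
    affects measurability. *)
Lemma Cmeasurable_continuous f (c : R) :
  (forall t : R, 0 < t <= 1 -> t != c -> Ccontinuous_at f t) -> Cmeasurable `[(0 : R), 1] f.
Proof.
move=> cf; pose D : set R := `]0, 1]%classic `\` [set c].
have H (h : R -> R) : (forall t, D t -> {for t, continuous h}) -> measurable_fun `[(0 : R), 1] h.
  move=> ch; apply: (measurable_funS (E := (D `|` [set c]) `|` [set 0])).
  - by apply: measurableU => //; apply: measurableU => //; exact: measurableD.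
  - move=> t; rewrite /= in_itv /= => /andP[t0 t1].
    have [->|t0'] := eqVneq t 0; first by right.
    left; have [->|tc] := eqVneq t c; first by right.
    by left; split; [rewrite /= in_itv /= lt_def t0' t0 | exact/eqP].
  apply/measurable_funU => //; first by apply: measurableU => //; exact: measurableD.
  split; last exact: measurable_fun_set1.
  apply/measurable_funU => //; first exact: measurableD.
  split; last exact: measurable_fun_set1.
  by apply: measurable_pointwise_continuous => //; exact: measurableD.
by split; apply: H => t [/=]; rewrite in_itv /= => t01 /eqP tc;
  apply/cvgrPdist_lt => e e0; have [r r0 Hr] := cf t t01 tc e e0;
  apply/nbhs_ballP; exists r => // s; rewrite /ball /= distrC => /Hr h;
  apply: le_lt_trans h; rewrite distrC -?ReB -?ImB;
  [exact: ler_Re_normc | exact: ler_Im_normc].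
Qed.

End ComplexIntegral.

(** * Polylogarithms off their cut *)

Section PolylogOffCut.
Variable R : realType.
Local Notation C := (R[i] : numFieldType).
Local Notation mu := (@lebesgue_measure R).
Implicit Types (z w : C) (t s : R) (k : nat).

(** Starting the hierarchy of polylogarithms at z / (1 - z) makes the formula
    PL_(k+1)' = PL_k / z hold from k = 0 on. *)
Definition PL k z : C := if k is 0%N then z / (1 - z) else Li k z.

(** The complement of the cut of the polylogarithms, the real half-line from 1
    to infinity. *)
Definition offcut z : Prop := offneg (1 - z).

Lemma Li1E z : Li 1 z = - Log (1 - z).
Proof. by []. Qed.

Lemma PLS k z : PL k.+2 z = Cintegral01 (fun t => PL k.+1 (t%:C * z) / t%:C).
Proof. by []. Qed.

Lemma Li1_deriv z : offcut z -> is_derive z 1 (@Li R 1) (1 - z)^-1.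
Proof.
move=> zc; have d1 : is_derive z (1 : C) (fun y : C => 1 - y) (-1).
  by have := is_deriveB (is_derive_cst (1 : C) z (1 : C)) (is_derive_id z (1 : C)); rewrite sub0r.
have := is_deriveN (cderiv_comp d1 (Log_deriv zc)).
by rewrite mulrN1 opprK.
Qed.

Lemma offcut_scale t z : offcut z -> 0 <= t <= 1 -> offcut (t%:C * z).
Proof.
case: z => x y; rewrite /offcut /offneg /= => zc /andP[t0 t1].
rewrite !mul0r !subr0 !addr0; case: zc => [x1|]; [left|].
  have [x0|x0] := leP x 0; first by rewrite subr_gt0 (le_lt_trans _ ltr01) // mulr_ge0_le0.
  have := ler_wpM2r (ltW x0) t1; rewrite mul1r; lra.
rewrite !sub0r !oppr_eq0 => y0.
have [->|tn0] := eqVneq t 0; first by left; rewrite mul0r subr0.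
by right; rewrite mulf_neq0.
Qed.

(** A uniform distance from the point 1 to the segments that join 0 to the
    points of a small ball: every estimate below is uniform along these
    segments. *)
Lemma offcut_segment_dist z0 : offcut z0 -> exists2 d : R, 0 < d &
  forall z, normc (z - z0) < d -> offcut z /\ forall t, 0 <= t <= 1 -> d <= normc (1 - t%:C * z).
Proof.
case=> [x1|y1].
  have x1' : complex.Re z0 < 1 by move: x1; rewrite ReB /=; lra.
  pose d := Num.min 1 (1 - complex.Re z0) / 2.
  have m0 : 0 < Num.min 1 (1 - complex.Re z0) by rewrite lt_min ltr01 subr_gt0.
  have [d1 d2] : d <= 1 / 2 /\ d <= (1 - complex.Re z0) / 2.
    by rewrite /d !ler_pM2r ?invr_gt0 // !ge_min !lexx orbT.
  exists d => [|z zd]; first by rewrite divr_gt0.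
  have zx : complex.Re z < 1 - d.
    have := le_lt_trans (ler_norm _) (le_lt_trans (ler_Re_normc (z - z0)) zd).
    rewrite ReB; lra.
  have d0 : 0 < d by rewrite divr_gt0.
  split; first by left; rewrite ReB /=; lra.
  move=> t /andP[t0 t1]; apply: le_trans (ler_Re_normc _); apply: le_trans (ler_norm _).
  have -> : complex.Re (1 - t%:C * z) = 1 - t * complex.Re z.
    by case: (z) => a b /=; rewrite mul0r subr0.
  have [x0|x0] := leP (complex.Re z) 0.
    have : t * complex.Re z <= 0 by rewrite mulr_ge0_le0.
    lra.
  have := ler_wpM2r (ltW x0) t1; rewrite mul1r; lra.
have y0 : complex.Im z0 != 0 by move: y1; rewrite ImB /= sub0r oppr_eq0.
pose y := `|complex.Im z0| / 2; have yp : 0 < y by rewrite divr_gt0 // normr_gt0.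
pose M := normc z0 + y; have M0 : 0 < M by rewrite ltr_wpDl ?normc_ge0.
pose d := Num.min y (y / M).
have d0 : 0 < d by rewrite lt_min yp divr_gt0.
exists d => // z zd; have zdy : normc (z - z0) < y by apply: lt_le_trans zd _; rewrite ge_min lexx.
have zy : y < `|complex.Im z|.
  have := le_lt_trans (ler_Im_normc (z - z0)) zdy; rewrite ImB.
  have := ler_normD (complex.Im z) (complex.Im z0 - complex.Im z).
  rewrite addrC subrK [`|_ - complex.Im z|]distrC.
  have : `|complex.Im z0| = 2 * y by rewrite /y mulrC divfK.
  lra.
have zM : normc z <= M.
  by rewrite -[z](subrK z0) (le_trans (le_normcD _ _)) // addrC lerD2l ltW.
have zn0 : z != 0.
  by apply/eqP => z0'; move: zy; rewrite z0' normr0; lra.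
split.
  by right; rewrite ImB /= sub0r oppr_eq0 -normr_gt0 (lt_trans yp).
move=> t _.
have h : `|complex.Im z| <= normc (1 - t%:C * z) * normc z.
  rewrite -[normc z]normc_conj -normcM.
  apply: le_trans (ler_Im_normc _); rewrite -normrN.
  suff -> : complex.Im ((1 - t%:C * z) * z^*%C) = - complex.Im z by [].
  by case: (z) => a b /=; ring.
apply: (@le_trans _ _ (y / M)); first by rewrite ge_min lexx orbT.
rewrite ler_pdivrMr //; apply: le_trans (ltW zy) _; apply: le_trans h _.
by rewrite ler_wpM2l // normc_ge0.
Qed.

Lemma Ccontinuous_mulc (c : C) (f : R -> C) t : Ccontinuous_at f t ->
  Ccontinuous_at (fun t => c * f t) t.
Proof.
move=> cf e e0; have n0 : 0 < normc c + 1 by rewrite ltr_wpDl ?normc_ge0.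
have [r r0 Hr] := cf _ (divr_gt0 e0 n0); exists r => // s /Hr.
rewrite -mulrBr normcM ltr_pdivlMr // mulrC; apply: le_lt_trans.
by rewrite ler_wpM2r ?normc_ge0 // lerDl.
Qed.

Lemma eq_Ccontinuous (f g : R -> C) t : f =1 g -> Ccontinuous_at f t -> Ccontinuous_at g t.
Proof. by move=> /funext ->. Qed.

Lemma Ccontinuous_real (f : R -> C) t : Ccontinuous_at f t ->
  {for t, continuous (fun t => complex.Re (f t))}.
Proof.
move=> cf; apply/cvgrPdist_lt => e e0; have [r r0 Hr] := cf e e0.
apply/nbhs_ballP; exists r => // s; rewrite /ball /= distrC => /Hr h.
by apply: le_lt_trans h; rewrite distrC -?ReB; exact: ler_Re_normc.
Qed.

Lemma inv_continuous z t : offcut z -> 0 <= t <= 1 ->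
  Ccontinuous_at (fun t => (1 - t%:C * z)^-1) t.
Proof.
move=> zc t01 e e0; have [d d0 /(_ z)] := offcut_segment_dist zc.
rewrite subrr normc0 => /(_ d0)[_ /(_ t t01) h].
have Mz : 0 < normc z + 1 by rewrite ltr_wpDl ?normc_ge0.
have d2 : 0 < d / 2 by rewrite divr_gt0.
have dd : 0 < d * (d / 2) by rewrite mulr_gt0.
pose r := Num.min (d / 2 / (normc z + 1)) (e * (d * (d / 2)) / (normc z + 1)).
have r0 : 0 < r by rewrite lt_min !divr_gt0 // mulr_gt0.
exists r => // s; rewrite lt_min => /andP[h1 h2].
have sz : `|s - t| * normc z <= `|s - t| * (normc z + 1) by rewrite ler_wpM2l // lerDl.
rewrite ltr_pdivlMr // in h1; rewrite ltr_pdivlMr // in h2.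
have E : s%:C * z - t%:C * z = (s - t)%:C * z by rewrite rmorphB /= mulrBl.
have h3 : d / 2 <= normc (1 - s%:C * z).
  have -> : 1 - s%:C * z = (1 - t%:C * z) - (s - t)%:C * z by rewrite -E; ring.
  have := le_normcD (1 - t%:C * z - (s - t)%:C * z) ((s - t)%:C * z).
  rewrite subrK normcM normcR => h4.
  have h5 : d <= normc (1 - t%:C * z - (s - t)%:C * z) + d / 2.
    apply: le_trans h _; apply: le_trans h4 _; rewrite lerD2l.
    by apply: le_trans sz _; exact: ltW.
  by move: h5; lra.
have p1 : 0 < normc (1 - t%:C * z) by rewrite (lt_le_trans _ h).
have p2 : 0 < normc (1 - s%:C * z) by rewrite (lt_le_trans _ h3).
have -> : (1 - s%:C * z)^-1 - (1 - t%:C * z)^-1 =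
   (s%:C * z - t%:C * z) / ((1 - t%:C * z) * (1 - s%:C * z)).
  by field; rewrite -!normc_gt0 p1 p2.
rewrite E normcM normcV [normc (_ * (1 - _))]normcM [normc (_ * z)]normcM normcR.
rewrite ltr_pdivrMr ?mulr_gt0 //; apply: le_lt_trans sz _; apply: lt_le_trans h2 _.
by rewrite ler_pM2l // ler_pM // ltW.
Qed.

Lemma integrable_cst01 (K : R) : mu.-integrable `[0, 1] (EFin \o (fun _ : R => K)).
Proof.
apply: continuous_compact_integrable; first exact: segment_compact.
by apply: continuous_subspaceT => x; exact: cvg_cst.
Qed.

Lemma Rintegral_cst01 (K : R) : \int[mu]_(t in `[0, 1]) K = K.
Proof.
rewrite Rintegral_cst //; have -> : fine (mu `[0, 1]) = 1; last by rewrite mulr1.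
by rewrite lebesgue_measure_itv /= lte_fin ltr01 sube0.
Qed.

Lemma Cintegral_bound_cst (f : R -> C) (K c : R) : Cintegrable f ->
  (forall t : R, 0 <= t <= 1 -> t != c -> normc (f t) <= K) ->
  normc (Cintegral01 f) <= 2 * K.
Proof.
move=> fi fK; rewrite -[X in 2 * X]Rintegral_cst01.
exact: (Cintegral_bound fi (integrable_cst01 K) fK).
Qed.

Lemma Cintegral_primitive (F : C -> C) (z : C) (D : R -> C) :
  (forall t, 0 <= t <= 1 -> is_derive (t%:C * z : C) 1 F (D t)) ->
  (forall t, 0 <= t <= 1 -> Ccontinuous_at D t) ->
  Cintegral01 (fun t => D t * z) = F z - F 0.
Proof.
move=> dF cD.
have H (c : C) : \int[mu]_(t in `[0, 1]) complex.Re (c * D t * z) =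
    complex.Re (c * F z) - complex.Re (c * F 0).
  pose f t := complex.Re (c * D t * z); pose G t := complex.Re (c * F (t%:C * z)).
  have dG t : 0 <= t <= 1 -> is_derive t 1 G (f t).
    move=> /dF dt; have := @is_derive_re_line _ F 0 z c t (D t); rewrite add0r => /(_ dt).
    by rewrite /G; under eq_fun do rewrite add0r.
  have cf t : 0 <= t <= 1 -> {for t, continuous f}.
    move=> /cD ct; apply: Ccontinuous_real.
    have -> : (fun t => c * D t * z) = (fun t => (c * z) * D t).
      by apply/funext => u; ring.
    exact: Ccontinuous_mulc.
  have cG t : 0 <= t <= 1 -> {for t, continuous G}.
    move=> /dG h; apply/differentiable_continuous/derivable1_diffP.
    exact: (@ex_derive _ _ _ _ _ _ _ h).
  have I01 t : t \in `]0, 1[ -> 0 <= t <= 1.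
    by rewrite in_itv /= => /andP[/ltW -> /ltW ->].
  have := @continuous_FTC2 R f G 0 1 ltr01.
  rewrite /Rintegral => ->.
  - by rewrite -EFinB /= /G rmorph1 mul1r rmorph0 mul0r.
  - by apply: continuous_in_subspaceT => t; rewrite inE /= in_itv /=; exact: cf.
  - split.
    + by move=> t /I01/dG h; exact: (@ex_derive _ _ _ _ _ _ _ h).
    + by apply/cvg_at_right_filter/cG; rewrite lexx ler01.
    + by apply/cvg_at_left_filter/cG; rewrite lexx ler01.
  - by move=> t /I01/dG h; rewrite derive1E; exact: (@derive_val _ _ _ _ _ _ _ h).
apply: eqc_ReIm => /=.
  by rewrite ReB; have := H 1; rewrite !mul1r => <-; apply: eq_Rintegral => t _; rewrite mul1r.
have ImRe (w : C) : complex.Im w = complex.Re ((0 +i* (-1)) * w).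
  by case: w => a b /=; ring.
rewrite ImB !ImRe -H; apply: eq_Rintegral => t _.
by rewrite -mulrA -ImRe.
Qed.

Lemma Li1_0 : Li 1 (0 : C) = 0.
Proof.
rewrite Li1E subr0 /Log normc1 ln1 /= expr1n expr0n addr0 sqrtr1 divr1 lexx acos1.
by apply: eqc_ReIm; rewrite /= oppr0.
Qed.

(** Gives Li_1 the integral form that defines the higher polylogarithms, so
    that one induction covers them all. *)
Lemma Li1_integral z : offcut z ->
  Cintegrable (fun t => (1 - t%:C * z)^-1 * z) /\
  Cintegral01 (fun t => (1 - t%:C * z)^-1 * z) = Li 1 z.
Proof.
move=> zc; split; last first.
  have := @Cintegral_primitive (@Li R 1) z (fun t => (1 - t%:C * z)^-1).
  rewrite Li1_0 subr0; apply => t t01; last exact: inv_continuous.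
  by apply: Li1_deriv; exact: offcut_scale.
have [d d0 /(_ z)] := offcut_segment_dist zc.
rewrite subrr normc0 => /(_ d0)[_ dz].
apply: (@Cintegrable_dominated _ _ (fun=> normc z / d) 0).
- apply: (@Cmeasurable_continuous _ _ 0) => t /andP[t0 t1] _.
  have := @inv_continuous z t zc; rewrite t1 (ltW t0) => /(_ isT)/(Ccontinuous_mulc z).
  by apply: eq_Ccontinuous => s; rewrite mulrC.
- exact: integrable_cst01.
- move=> t t01 _; rewrite normcM normcV mulrC ler_wpM2l ?normc_ge0 //.
  by rewrite lef_pV2 ?posrE ?(lt_le_trans d0) ?dz.
Qed.

Lemma Cmeasurable_divr (f : R -> C) : Cmeasurable `[(0 : R), 1] f ->
  Cmeasurable `[(0 : R), 1] (fun t => f t / t%:C).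
Proof.
have mi : measurable_fun `[(0 : R), 1] (fun t : R => t^-1).
  apply: (measurable_funS (E := setT)) => //.
  have -> : [set: R] = (~` [set 0]) `|` [set 0] by rewrite setUC setUv.
  apply/measurable_funU => //; first exact: measurableC.
  split; last exact: measurable_fun_set1.
  apply: measurable_pointwise_continuous; first exact: measurableC.
  by move=> t /= /eqP t0; apply: continuousV => //; exact: cvg_id.
move=> [m1 m2]; split.
  apply: (eq_measurable_fun (fun t : R => complex.Re (f t) * t^-1)); last exact: measurable_funM.
  by move=> t _; rewrite -fmorphV ReMr.
apply: (eq_measurable_fun (fun t : R => complex.Im (f t) * t^-1)); last exact: measurable_funM.
by move=> t _; rewrite -fmorphV; case: (f t) => a b /=; rewrite mulr0 add0r mulrC.
Qed.

Lemma eq_Cmeasurable (f g : R -> C) : (forall t : R, 0 <= t <= 1 -> f t = g t) ->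
  Cmeasurable `[(0 : R), 1] f -> Cmeasurable `[(0 : R), 1] g.
Proof.
move=> fg [m1 m2]; split; [apply: eq_measurable_fun m1|apply: eq_measurable_fun m2] => t;
  by rewrite inE /= in_itv /= => /fg ->.
Qed.

Lemma Cintegral_off_point (f g : R -> C) (c : R) : Cintegrable f -> Cintegrable g ->
  (forall t : R, 0 <= t <= 1 -> t != c -> f t = g t) -> Cintegral01 f = Cintegral01 g.
Proof.
move=> fi gi fg; have [hi E] := CintegralB fi gi.
have := @Cintegral_bound_cst _ 0 c hi; rewrite E mulr0.
have H t : 0 <= t <= 1 -> t != c -> normc (f t - g t) <= 0.
  by move=> t01 tc; rewrite fg // subrr normc0.
move=> /(_ H) h; apply/eqP; rewrite -subr_eq0 -normc_eq0 eq_le h.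
exact: normc_ge0.
Qed.

End PolylogOffCut.

Section PolylogBall.
Variable R : realType.
Local Notation C := (R[i] : numFieldType).
Implicit Types (z w : C) (t s : R) (k : nat).

Variables (z0 : C) (d : R).
Hypotheses (d_gt0 : 0 < d) (dz0 : d <= normc z0 / 2).
Hypothesis dist : forall z, normc (z - z0) < d ->
  offcut z /\ forall t, 0 <= t <= 1 -> d <= normc (1 - t%:C * z).

Local Notation S z := (normc (z - z0) < d).

Lemma ball_neq0 z : S z -> z != 0.
Proof.
move=> Sz; apply/eqP => z00; move: Sz; rewrite z00 sub0r normcN.
apply/negP; rewrite -leNgt; apply: le_trans dz0 _.
by rewrite ler_pdivrMr // ler_peMr ?normc_ge0 // ler1n.
Qed.

Lemma ball_normc z : S z -> normc z <= normc z0 + d.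
Proof.
by move=> Sz; rewrite -[z](subrK z0) (le_trans (le_normcD _ _)) // addrC lerD2l ltW.
Qed.

Lemma ball_segment z w t : S z -> S w -> 0 <= t <= 1 -> S (z + t%:C * (w - z)).
Proof.
move=> Sz Sw /andP[t0 t1].
have -> : z + t%:C * (w - z) - z0 = (1 - t)%:C * (z - z0) + t%:C * (w - z0).
  by rewrite rmorphB /=; ring.
apply: le_lt_trans (le_normcD _ _) _; rewrite !normcM !normcR !ger0_norm ?subr_ge0 //.
have [->|tn0] := eqVneq t 0; first by rewrite subr0 mul1r mul0r addr0.
have tp : 0 < t by rewrite lt_def tn0.
have -> : d = (1 - t) * d + t * d by ring.
by apply: ler_ltD; [rewrite ler_wpM2l ?subr_ge0 // ltW | rewrite ltr_pM2l].
Qed.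

Lemma ball_dist z t : S z -> 0 <= t <= 1 -> d <= normc (1 - t%:C * z).
Proof. by move=> /dist[_]; apply. Qed.

Lemma ball_dist_neq0 z t : S z -> 0 <= t <= 1 -> 1 - t%:C * z != 0.
Proof. by move=> Sz t01; rewrite -normc_gt0 (lt_le_trans d_gt0) // ball_dist. Qed.

(** The base case of [PL_invariant]: Li_1 minus its tangent map at t z has a
    derivative of size O(t) on the segment to t w. *)
Lemma Li1_quad : exists2 M : R, 0 <= M & forall z w t, S z -> S w -> 0 < t <= 1 ->
  normc (PL 1 (t%:C * w) - PL 1 (t%:C * z) - (w - z) / z * PL 0 (t%:C * z))
    <= M * t * normc (w - z) ^+ 2.
Proof.
exists (d ^- 2); first by rewrite invr_ge0 exprn_ge0 // ltW.
move=> z w t Sz Sw /andP[t0 t1]; have t01 : 0 <= t <= 1 by rewrite t1 ltW.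
have zn := ball_neq0 Sz; have zd := ball_dist_neq0 Sz t01.
set a := (1 - t%:C * z)^-1; pose F (y : C) : C := Li 1 y - a * y.
set h := t%:C * (w - z).
have -> : PL 1 (t%:C * w) - PL 1 (t%:C * z) - (w - z) / z * PL 0 (t%:C * z) =
    F (t%:C * z + h) - F (t%:C * z).
  have -> : t%:C * z + h = t%:C * w by rewrite /h; ring.
  by rewrite /F /PL /a; field; rewrite zn zd.
have nh : normc h = t * normc (w - z) by rewrite /h normcM normcR ger0_norm // ltW.
apply: (@le_trans _ _ ((d ^- 2 * (t * normc (w - z))) * normc h)); last first.
  rewrite nh -!mulrA ler_wpM2l ?invr_ge0 ?exprn_ge0 ?(ltW d_gt0) //.
  rewrite ler_wpM2l ?(ltW t0) // mulrCA -expr2 ler_piMl ?exprn_ge0 ?normc_ge0 //.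
apply: segment_bound => s s01.
set y := t%:C * z + s%:C * h.
have Sy := ball_segment Sz Sw s01.
have yE : y = t%:C * (z + s%:C * (w - z)) by rewrite /y /h; ring.
have yc : offcut y by rewrite yE; apply: offcut_scale => //; exact: (dist Sy).1.
have yd : 1 - y != 0 by rewrite yE; exact: ball_dist_neq0.
exists ((1 - y)^-1 - a *: 1).
  exact: (is_deriveB (Li1_deriv yc) (is_deriveZ (a : C) (is_derive_id (y : C) (1 : C)))).
rewrite [a *: 1]mulr1 /a.
have -> : (1 - y)^-1 - (1 - t%:C * z)^-1 = (s%:C * h) / ((1 - y) * (1 - t%:C * z)).
  by rewrite /y; field; rewrite zd -/y yd.
rewrite normcM normcV [normc (_ * (1 - _))]normcM [normc (_ * h)]normcM normcR nh.
have /andP[s0 s1] := s01; rewrite ger0_norm // mulrC.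
apply: ler_pM.
- by rewrite invr_ge0 mulr_ge0 // normc_ge0.
- by rewrite mulr_ge0 // mulr_ge0 ?normc_ge0 // ltW.
  rewrite lef_pV2 ?posrE ?mulr_gt0 ?exprn_gt0 ?normc_gt0 //.
  rewrite expr2; apply: ler_pM; rewrite ?(ltW d_gt0) // ?yE ball_dist //.
by rewrite ler_piMl // mulr_ge0 ?normc_ge0 // ltW.
Qed.

Definition PLint k z t : C := PL k (t%:C * z) / t%:C.

Definition PLbounded k := exists2 K : R, 0 <= K & forall z t, S z -> 0 < t <= 1 ->
  normc (PL k (t%:C * z)) <= K * t.

Definition PLintegrable k := forall z s, S z -> 0 < s <= 1 ->
  Cintegrable (PLint k (s%:C * z)).

Definition PLprimitive k := forall z s, S z -> 0 < s <= 1 ->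
  PL k.+1 (s%:C * z) = Cintegral01 (PLint k (s%:C * z)).

(** The remainder in the derivative PL_k / z is bounded by M t |w - z|^2 along
    the whole rays. The factor t is what survives the division by t in the
    integral that defines the next polylogarithm. *)
Definition PLquad k := exists2 M : R, 0 <= M & forall z w t, S z -> S w -> 0 < t <= 1 ->
  normc (PL k.+1 (t%:C * w) - PL k.+1 (t%:C * z) - (w - z) / z * PL k (t%:C * z))
    <= M * t * normc (w - z) ^+ 2.

Lemma PL0_bounded : PLbounded 0.
Proof.
exists ((normc z0 + d) / d); first by rewrite divr_ge0 ?addr_ge0 ?normc_ge0 // ltW.
move=> z t Sz /andP[t0 t1]; rewrite /PL !normcM normcR normcV ger0_norm ?(ltW t0) //.
have h := ball_dist Sz (t := t); rewrite t1 (ltW t0) in h; have {}h := h isT.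
have -> : (normc z0 + d) / d * t = t * (normc z0 + d) / d by field; rewrite gt_eqF.
apply: ler_pM.
- by rewrite mulr_ge0 ?normc_ge0 // ltW.
- by rewrite invr_ge0 normc_ge0.
- by rewrite ler_pM2l // ball_normc.
- by rewrite lef_pV2 ?posrE // (lt_le_trans d_gt0).
Qed.

Lemma PLint_bound k (K : R) z s t : 0 <= K ->
  (forall z t, S z -> 0 < t <= 1 -> normc (PL k (t%:C * z)) <= K * t) ->
  S z -> 0 < s <= 1 -> 0 <= t <= 1 -> normc (PLint k (s%:C * z) t) <= K * s.
Proof.
move=> K0 HK Sz /andP[s0 s1] /andP[t0 t1]; rewrite /PLint.
have [->|tn] := eqVneq t 0.
  by rewrite invr0 mulr0 normc0 mulr_ge0 // (ltW s0).
have tp : 0 < t by rewrite lt_def tn.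
rewrite normcM normcV normcR ger0_norm // ler_pdivrMr // mulrA -rmorphM /=.
have := HK z (t * s) Sz; rewrite mulr_gt0 // mulr_ile1 ?(ltW s0) // => /(_ isT).
by rewrite -mulrA [s * t]mulrC.
Qed.

Definition PLmeasurable k := forall z s, S z -> 0 < s <= 1 ->
  Cmeasurable `[(0 : R), 1] (fun t => PL k (t%:C * (s%:C * z))).

Lemma ball_scale_offcut z s : S z -> 0 < s <= 1 -> offcut (s%:C * z).
Proof.
by move=> Sz /andP[s0 s1]; apply: offcut_scale; [exact: (dist Sz).1 | rewrite s1 ltW].
Qed.

Lemma PL0_measurable : PLmeasurable 0.
Proof.
move=> z s Sz s01; have zc := ball_scale_offcut Sz s01.
apply: (@eq_Cmeasurable _ (fun t => (1 - t%:C * (s%:C * z))^-1 - 1)).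
  move=> t t01; have : 1 - t%:C * (s%:C * z) != 0.
    exact: offneg_neq0 (offcut_scale zc t01).
  by rewrite /PL => h; field.
apply: (@Cmeasurable_continuous _ _ 0) => t /andP[t0 t1] _ e e0.
have := @inv_continuous _ _ t zc; rewrite t1 (ltW t0) => /(_ isT e e0)[r r0 Hr].
exists r => // u /Hr; set a := (_ - _)^-1; set b := (1 - t%:C * _)^-1.
by have -> : a - 1 - (b - 1) = a - b by ring.
Qed.

(** Continuity along rays follows from the quadratic estimate applied to z and
    w = (s / t) z, and provides measurability of the next integrand. *)
Lemma PL_continuous k z t : PLquad k -> PLbounded k -> S z -> 0 < t <= 1 ->
  Ccontinuous_at (fun t => PL k.+1 (t%:C * z)) t.
Proof.
move=> [M M0 HM] [K K0 HK] Sz t01 e e0; have /andP[t0 t1] := t01.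
have zn := ball_neq0 Sz; have nz : 0 < normc z by rewrite normc_gt0.
pose q := d - normc (z - z0); have q0 : 0 < q by rewrite subr_gt0.
pose B := K + M * normc z ^+ 2 / t + 1.
have B0 : 0 < B by rewrite ltr_wpDl // addr_ge0 // mulr_ge0 ?invr_ge0 ?mulr_ge0 ?exprn_ge0 ?normc_ge0 // ltW.
pose r := Num.min 1 (Num.min (q * t / normc z) (e / B)).
have r0 : 0 < r by rewrite !lt_min ltr01 !divr_gt0 // mulr_gt0.
exists r => // s; rewrite !lt_min => /and3P[h1 h2 h3].
pose w := (s / t)%:C * z; have tn : (t%:C : C) != 0 by rewrite -normc_gt0 normcR normr_gt0 gt_eqF.
have tw : t%:C * w = s%:C * z by rewrite /w mulrA -rmorphM /= mulrCA divff ?mulr1 // gt_eqF.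
have wz : w - z = ((s - t) / t)%:C * z.
  by rewrite /w mulrBl divff ?gt_eqF // rmorphB /= rmorph1 mulrBl mul1r.
have nwz : normc (w - z) = `|s - t| / t * normc z.
  by rewrite wz normcM normcR normrM normfV (ger0_norm (ltW t0)).
have Sw : S w.
  rewrite -[w](subrK z) -addrA; apply: le_lt_trans (le_normcD _ _) _.
  rewrite -ltrBrDr -/q nwz mulrAC ltr_pdivrMr //.
  by rewrite ltr_pdivlMr // in h2.
rewrite -tw; have := HM z w t Sz Sw t01; set D := PL k.+1 _ - _ => HD.
rewrite -[D](subrK ((w - z) / z * PL k (t%:C * z))).
apply: le_lt_trans (le_normcD _ _) _; apply: le_lt_trans (lerD HD (lexx _)) _.
have -> : (w - z) / z = ((s - t) / t)%:C by rewrite wz -mulrA divff // mulr1.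
rewrite normcM normcR normrM normfV (ger0_norm (ltW t0)) nwz.
apply: (@le_lt_trans _ _ (`|s - t| * B)); last by rewrite ltr_pdivlMr // in h3.
have A1 : `|s - t| / t * normc (PL k (t%:C * z)) <= `|s - t| * K.
  rewrite -mulrA ler_wpM2l // mulrC ler_pdivrMr //; exact: HK.
have A2 : M * t * (`|s - t| / t * normc z) ^+ 2 <= `|s - t| * (M * normc z ^+ 2 / t).
  have -> : M * t * (`|s - t| / t * normc z) ^+ 2 =
     (`|s - t| * (M * normc z ^+ 2 / t)) * `|s - t| by field; rewrite gt_eqF.
  by rewrite ler_piMr ?(ltW h1) // mulr_ge0 // !mulr_ge0 ?invr_ge0 ?exprn_ge0 ?normc_ge0 // ltW.
by rewrite /B !mulrDr; have := normr_ge0 (s - t); lra.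
Qed.

Lemma PL_measurable_step k : PLquad k -> PLbounded k -> PLmeasurable k.+1.
Proof.
move=> Hq Hb z s Sz /andP[s0 s1].
apply: (@Cmeasurable_continuous _ _ 0) => t /andP[t0 t1] _ e e0.
have ts : 0 < t * s <= 1 by rewrite mulr_gt0 // mulr_ile1 // ltW.
have [r r0 Hr] := PL_continuous Hq Hb Sz ts e0.
exists r => // u ur; rewrite !mulrA -!rmorphM /=; apply: Hr.
by rewrite -mulrBl normrM (ger0_norm (ltW s0)) (le_lt_trans _ ur) // ler_piMr.
Qed.

Lemma PL_integrable k : PLbounded k -> PLmeasurable k -> PLintegrable k.
Proof.
move=> [K K0 HK] Hm z s Sz s01.
apply: (@Cintegrable_dominated _ _ (fun=> K * s) 0).
- exact: Cmeasurable_divr (Hm z s Sz s01).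
- exact: integrable_cst01.
- by move=> t t01 _; exact: PLint_bound.
Qed.

(** For k = 0 the two integrands may differ at t = 0, where division by 0
    intervenes. *)
Lemma PL_primitive k : PLintegrable k -> PLprimitive k.
Proof.
case: k => [|k] Hi z s Sz s01; last by rewrite PLS.
have zc := ball_scale_offcut Sz s01; have [Hi' E] := Li1_integral zc.
rewrite [LHS]/= -/(Li 1 _) -E; apply: (@Cintegral_off_point _ _ _ 0) => //.
  exact: Hi.
move=> t _ t0; rewrite /PLint /PL; have tn : (t%:C : C) != 0.
  by rewrite -normc_gt0 normcR normr_gt0.
have aux (a b x : C) : a != 0 -> x * b = a * b * x / a by move=> a0; field.
exact: aux.
Qed.

Lemma PL_bounded_step k : PLbounded k -> PLintegrable k -> PLbounded k.+1.
Proof.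
move=> [K K0 HK] Hi; exists (2 * K); first by rewrite mulr_ge0.
move=> z t Sz t01; rewrite (PL_primitive Hi) // -mulrA.
apply: (@Cintegral_bound_cst _ _ _ 0); first exact: Hi.
by move=> s s01 _; exact: PLint_bound.
Qed.

(** The estimate of order k, divided by t, is integrated over the unit
    interval. *)
Lemma PL_quad_step k : PLintegrable k -> PLintegrable k.+1 -> PLquad k -> PLquad k.+1.
Proof.
move=> Hi Hi1 [M M0 HM]; exists (2 * M); first by rewrite mulr_ge0.
move=> z w s Sz Sw s01; have /andP[s0 s1] := s01.
rewrite (PL_primitive Hi1 Sz s01) (PL_primitive Hi1 Sw s01) (PL_primitive Hi Sz s01).
have [i1 <-] := CintegralB (Hi1 _ _ Sw s01) (Hi1 _ _ Sz s01).
have [i2 <-] := CintegralZ ((w - z) / z) (Hi _ _ Sz s01).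
have [i3 <-] := CintegralB i1 i2.
rewrite -2!mulrA; apply: (@Cintegral_bound_cst _ _ _ 0) => // t /andP[t0 t1] tn.
have tp : 0 < t by rewrite lt_def tn.
have -> : PLint k.+1 (s%:C * w) t - PLint k.+1 (s%:C * z) t - (w - z) / z * PLint k (s%:C * z) t =
   (PL k.+1 ((t * s)%:C * w) - PL k.+1 ((t * s)%:C * z) - (w - z) / z * PL k ((t * s)%:C * z)) / t%:C.
  have E (x : C) : t%:C * (s%:C * x) = (t * s)%:C * x by rewrite mulrA rmorphM.
  by rewrite /PLint !E [RHS]mulrBl [in RHS]mulrBl mulrA.
rewrite normcM normcV normcR (ger0_norm t0) ler_pdivrMr //.
have -> : M * (s * normc (w - z) ^+ 2) * t = M * (t * s) * normc (w - z) ^+ 2 by ring.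
by apply: HM => //; rewrite mulr_gt0 // mulr_ile1 // ltW.
Qed.

(** The three properties have to be proved together: integrability at order k
    gives the integral formula for PL_(k+1), hence its bound, its quadratic
    estimate, and through continuity its measurability. *)
Lemma PL_invariant k : [/\ PLbounded k, PLintegrable k & PLquad k].
Proof.
elim: k => [|k [Hb Hi Hq]].
  split; [exact: PL0_bounded | | exact: Li1_quad].
  exact: PL_integrable PL0_bounded PL0_measurable.
have Hb1 := PL_bounded_step Hb Hi.
have Hi1 := PL_integrable Hb1 (PL_measurable_step Hq Hb).
by split => //; exact: PL_quad_step.
Qed.

End PolylogBall.

Section PolylogDeriv.
Variable R : realType.
Local Notation C := (R[i] : numFieldType).
Implicit Types (z w : C) (k : nat).

Lemma offcut_ball z0 : offcut z0 -> z0 != 0 -> exists d : R, [/\ 0 < d, d <= normc z0 / 2 &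
  forall z, normc (z - z0) < d -> offcut z /\ forall t : R, 0 <= t <= 1 -> d <= normc (1 - t%:C * z)].
Proof.
move=> zc zn; have [d d0 Hd] := offcut_segment_dist zc.
have n0 : 0 < normc z0 by rewrite normc_gt0.
exists (Num.min d (normc z0 / 2)); split; rewrite ?lt_min ?d0 ?divr_gt0 ?ge_min ?lexx ?orbT //.
move=> z; rewrite lt_min => /andP[/Hd[z1 z2] _]; split => // t /z2 h.
by rewrite ge_min h.
Qed.

Lemma PL_deriv k z : offcut z -> z != 0 -> is_derive z 1 (@PL R k.+1) (PL k z / z).
Proof.
move=> zc zn; have [d [d0 dz Hd]] := offcut_ball zc zn.
have [_ _ [M M0 HM]] := PL_invariant d0 dz Hd k.
apply/cderivP => e e0; have M1 : 0 < M + 1 by rewrite ltr_wpDl.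
exists (Num.min d (e / (M + 1))); first by rewrite lt_min d0 divr_gt0.
move=> w; rewrite lt_min ltr_pdivlMr // => /andP[wd we].
have := HM z w 1; rewrite subrr normc0 ltr01 lexx rmorph1 !mul1r mulr1 => /(_ d0 wd isT).
have -> : (w - z) / z * PL k z = PL k z / z * (w - z) by field.
move=> h; apply: le_trans h _; rewrite expr2 mulrA ler_wpM2r ?normc_ge0 //.
apply: le_trans (ltW we); rewrite mulrC ler_wpM2l ?normc_ge0 // lerDl //.
Qed.

Lemma PL_integrable_offcut k z : offcut z -> z != 0 ->
  Cintegrable (fun t : R => PL k (t%:C * z) / t%:C).
Proof.
move=> zc zn; have [d [d0 dz Hd]] := offcut_ball zc zn.
have [_ Hi _] := PL_invariant d0 dz Hd k.
have := Hi z 1; rewrite subrr normc0 ltr01 lexx rmorph1 mul1r; exact.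
Qed.

End PolylogDeriv.

(** * Bounds on polylogarithms that are uniform near the cut *)

Section GlobalBounds.
Variable R : realType.
Local Notation C := (R[i] : numFieldType).
Local Notation mu := (@lebesgue_measure R).
Implicit Types (z w : C) (t s x : R) (k : nat).

Lemma pi_le4 : (pi : R) <= 4.
Proof. by have := @pihalf_lt2 R; lra. Qed.

(** Near 0 the bound is that of [sing], an integrable singularity. *)
Lemma ln_abs_bound (a : R) : 0 < a -> `|ln a| <= a + 2 / Num.sqrt a.
Proof.
move=> a0; have s0 : 0 < Num.sqrt a by rewrite sqrtr_gt0.
have i0 : 0 < 2 / Num.sqrt a by rewrite divr_gt0.
rewrite ler_norml; apply/andP; split; last first.
  by have := ln_sublinear a0; lra.
have e : a = Num.sqrt a ^+ 2 by rewrite sqr_sqrtr // ltW.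
have h : ln (Num.sqrt a)^-1 < (Num.sqrt a)^-1 by rewrite ln_sublinear // invr_gt0.
rewrite lnV ?posrE // in h.
have -> : ln a = ln (Num.sqrt a) *+ 2 by rewrite -lnXn // -e.
by rewrite mulr2n; lra.
Qed.

Lemma Li1_small z : normc z <= 1 / 2 -> normc (Li 1 z) <= 2 * normc z.
Proof.
move=> z2; have := @segment_bound R (@Li R 1) 0 z 2; rewrite add0r Li1_0 subr0; apply.
move=> t /andP[t0 t1]; rewrite add0r; set y := t%:C * z.
have y2 : normc y <= 1 / 2.
  by rewrite normcM normcR ger0_norm //; apply: le_trans z2; rewrite ler_piMl ?normc_ge0.
have ry : complex.Re y <= 1 / 2 by apply: le_trans (ler_norm _) (le_trans (ler_Re_normc y) y2).
have yc : offcut y by left; rewrite ReB /=; lra.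
exists (1 - y)^-1; first exact: Li1_deriv.
rewrite normcV invf_ple ?posrE // ?normc_gt0 ?(offneg_neq0 yc) //.
have := ler_Re_normc (1 - y); rewrite ReB /= => h; have := ler_norm (1 - complex.Re y).
by move: h; lra.
Qed.

(** The parameter at which the segment from 0 to the real number x is closest
    to 1, the singularity of Li_1. *)
Definition cutpoint x : R := Num.min 1 x^-1.

Lemma cutpoint_itv x : 0 < x -> 0 < cutpoint x <= 1.
Proof. by move=> x0; rewrite lt_min ltr01 invr_gt0 x0 ge_min lexx. Qed.

Lemma cutpoint_dist x t : 0 < x -> 0 <= t <= 1 -> `|t - cutpoint x| <= `|1 - t * x|.
Proof.
move=> x0 /andP[t0 t1]; rewrite /cutpoint; have [x1|x1] := leP 1 x^-1.
  have x1' : x <= 1 by move: x1; rewrite invf_ge1.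
  have tx : t * x <= t by rewrite ler_piMr.
  rewrite distrC !ger0_norm ?subr_ge0 ?lerB //.
  exact: le_trans tx t1.
have x1' : 1 <= x by rewrite ltW // -invf_lt1.
have -> : 1 - t * x = - (x * (t - x^-1)) by field; rewrite gt_eqF.
by rewrite normrN normrM ler_peMl // ger0_norm // ltW.
Qed.

(** This bound depends on z only through its modulus, so it dominates the
    integrands along a family of points that rotates onto the cut. *)
Lemma Li1_ray_bound z t : z != 0 -> 0 <= t <= 1 -> t != cutpoint (normc z) ->
  normc (Li 1 (t%:C * z) / t%:C) <= 11 * normc z * (1 + sing (cutpoint (normc z)) t).
Proof.
move=> zn t01 tc; have x0 : 0 < normc z by rewrite normc_gt0.
have /andP[t0 t1] := t01; set x := normc z in x0 tc *; set c := cutpoint x in tc *.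
have sg : 0 <= sing c t := sing_ge0 c t.
have xs : 0 <= x * sing c t by rewrite mulr_ge0 // ltW.
have [->|tn] := eqVneq t 0.
  by rewrite invr0 mulr0 normc0 mulr_ge0 ?mulr_ge0 ?addr_ge0 ?sing_ge0 // ltW.
have tp : 0 < t by rewrite lt_def tn.
rewrite normcM normcV normcR (ger0_norm t0) ler_pdivrMr //.
set y := t%:C * z; have ny : normc y = t * x by rewrite normcM normcR ger0_norm.
have yp : 0 < t * x by rewrite mulr_gt0.
have ys : 0 <= t * x * sing c t by rewrite mulr_ge0 // ltW.
have -> : 11 * x * (1 + sing c t) * t = 11 * (t * x) + 11 * (t * x * sing c t) by ring.
have [y2|y2] := leP (normc y) (1 / 2).
  by apply: le_trans (Li1_small y2) _; rewrite ny; lra.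
have dt : 0 < `|t - c| by rewrite normr_gt0 subr_eq0.
have da : `|t - c| <= normc (1 - y).
  apply: le_trans (cutpoint_dist x0 t01) _; rewrite -ny -[X in X - _](normc1 R).
  exact: ler_dist_normc.
set a := normc (1 - y) in da; have a0 : 0 < a := lt_le_trans dt da.
rewrite Li1E normcN; apply: le_trans (ler_normc_ReIm _) _.
have -> : complex.Re (Log (1 - y)) = ln a by [].
have hln := ln_abs_bound a0.
have hs : 2 / Num.sqrt a <= 2 * sing c t.
  rewrite ler_pM2l // /sing lef_pV2 ?posrE ?sqrtr_gt0 //.
  by rewrite ler_wsqrtr.
have ha : a <= 1 + t * x by rewrite -ny /a (le_trans (le_normcD _ _)) // normc1 normcN.
have him : `|complex.Im (Log (1 - y))| <= 4.
  have /andP[h1 h2] : - pi < complex.Im (Log (1 - y)) <= pi by apply: Im_Log; rewrite -normc_gt0.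
  by rewrite ler_norml; have := pi_le4 => h; apply/andP; split; lra.
have h2 : 2 * sing c t <= 4 * (t * x * sing c t).
  have : 0 <= (t * x - 1 / 2) * sing c t by rewrite mulr_ge0 // subr_ge0 -ny ltW.
  by lra.
by rewrite ny in y2; lra.
Qed.

Lemma Li1_ray_dominating x : 0 < x ->
  mu.-integrable `[0, 1] (EFin \o (fun t => 11 * x * (1 + sing (cutpoint x) t))) /\
  \int[mu]_(t in `[0, 1]) (11 * x * (1 + sing (cutpoint x) t)) <= 187 * x.
Proof.
move=> x0; have [i1 i2] := sing_integrable (cutpoint_itv x0).
have i3 : mu.-integrable `[0, 1] (EFin \o (fun t => 1 + sing (cutpoint x) t)).
  rewrite (_ : EFin \o _ = (EFin \o (fun _ : R => 1%R)) \+ (EFin \o sing (cutpoint x)))%E.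
    by apply: integrableD => //; exact: integrable_cst01.
  by apply/funext => t.
split.
  rewrite (_ : EFin \o _ = (fun t => (11 * x)%:E * (EFin \o (fun t => 1 + sing (cutpoint x) t)%R) t)%E).
    exact: integrableZl.
  by apply/funext => t /=; rewrite EFinM.
rewrite RintegralZl // RintegralD //; last exact: integrable_cst01.
rewrite Rintegral_cst01.
have -> : 187 * x = 11 * x * 17 by ring.
rewrite ler_pM2l ?mulr_gt0 //; move: i2; lra.
Qed.

(** A bound that does not degenerate near the cut, in contrast to that of
    [PL_invariant]. *)
Lemma Li_bound k : exists2 K : R, 0 <= K & forall z, offcut z -> z != 0 ->
  normc (Li k.+2 z) <= K * normc z.
Proof.
elim: k => [|k [K K0 HK]].
  exists (2 * 187); first by rewrite mulr_ge0.
  move=> z zc zn; have x0 : 0 < normc z by rewrite normc_gt0.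
  have [g1 g2] := Li1_ray_dominating x0.
  apply: le_trans (Cintegral_bound (c := cutpoint (normc z)) (PL_integrable_offcut 1 zc zn) g1 _) _.
    by move=> t t01 tc; exact: Li1_ray_bound.
  by rewrite -mulrA ler_pM2l.
exists (2 * K); first by rewrite mulr_ge0.
move=> z zc zn; rewrite -mulrA.
apply: (@Cintegral_bound_cst _ _ _ 0); first exact: (PL_integrable_offcut k.+2).
move=> t /andP[t0 t1] tn; have tp : 0 < t by rewrite lt_def tn.
rewrite normcM normcV normcR (ger0_norm t0) ler_pdivrMr //.
apply: le_trans (HK _ _ _) _.
- by apply: offcut_scale; rewrite // t0.
- by rewrite mulf_neq0 // -normc_gt0 normcR normr_gt0.
by rewrite normcM normcR ger0_norm // [t * _]mulrC mulrA.
Qed.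

End GlobalBounds.

(** * Polylogarithms on the cut as limits from below *)

Section OnCut.
Variable R : realType.
Local Notation C := (R[i] : numFieldType).
Local Notation mu := (@lebesgue_measure R).
Implicit Types (z w : C) (t s x : R) (k : nat).

Definition eta (m : nat) : R := m.+1%:R^-1.

(** Approaches x by rotation, so that all points have the same modulus and
    [Li1_ray_bound] dominates the integrands uniformly. *)
Definition below x (m : nat) : C := x%:C * Cexp (0 +i* (- eta m)).

Lemma eta_gt0 m : 0 < eta m.
Proof. by rewrite invr_gt0 ltr0n. Qed.

Lemma eta_le1 m : eta m <= 1.
Proof. by rewrite invf_le1 ?ltr0n // ler1n. Qed.

Lemma eta_small (e : R) : 0 < e -> exists N : nat, forall m, (N <= m)%N -> eta m < e.
Proof.
move=> e0; exists (Num.truncn e^-1) => m Nm.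
rewrite /eta invf_plt ?posrE ?ltr0n //; apply: lt_le_trans (truncnS_gt _) _.
by rewrite ler_nat ltnS.
Qed.

Lemma Ccvg_cst (c : C) : Ccvg (fun _ => c) c.
Proof. by move=> e e0; exists 0%N => m _; rewrite subrr normc0. Qed.

Lemma Ccvg_continuous (F : C -> C) (u : nat -> C) l :
  (forall e : R, 0 < e -> exists2 r : R, 0 < r & forall w, normc (w - l) < r -> normc (F w - F l) < e) ->
  Ccvg u l -> Ccvg (fun m => F (u m)) (F l).
Proof.
move=> cF cu e e0; have [r r0 Hr] := cF e e0; have [N HN] := cu r r0.
by exists N => m /HN/Hr.
Qed.

Lemma CcvgD (u v : nat -> C) a b : Ccvg u a -> Ccvg v b -> Ccvg (fun m => u m + v m) (a + b).
Proof.
move=> cu cv e e0; have e2 : 0 < e / 2 by lra.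
have [N HN] := cu _ e2; have [M HM] := cv _ e2.
exists (maxn N M) => m; rewrite geq_max => /andP[/HN h1 /HM h2].
have -> : u m + v m - (a + b) = (u m - a) + (v m - b) by ring.
apply: le_lt_trans (le_normcD _ _) _; lra.
Qed.

Lemma CcvgZ (c : C) (u : nat -> C) a : Ccvg u a -> Ccvg (fun m => c * u m) (c * a).
Proof.
move=> cu e e0; have n0 : 0 < normc c + 1 by rewrite ltr_wpDl ?normc_ge0.
have [N HN] := cu _ (divr_gt0 e0 n0); exists N => m /HN.
rewrite -mulrBr normcM ltr_pdivlMr // mulrC; apply: le_lt_trans.
by rewrite ler_wpM2r ?normc_ge0 // lerDl.
Qed.

Lemma eq_Ccvg (u v : nat -> C) a : (exists N : nat, forall m, (N <= m)%N -> u m = v m) ->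
  Ccvg u a -> Ccvg v a.
Proof.
move=> [N E] cu e e0; have [M HM] := cu e e0; exists (maxn N M) => m.
by rewrite geq_max => /andP[/E <- /HM].
Qed.

Lemma Ccvg_conj (u : nat -> C) a : Ccvg u a -> Ccvg (fun m => (u m)^*%C) a^*%C.
Proof.
by move=> cu e /cu[N HN]; exists N => m /HN; rewrite -rmorphB normc_conj.
Qed.

Lemma normc_im (y : R) : normc (0 +i* y) = `|y|.
Proof. by rewrite /= expr0n add0r sqrtr_sqr. Qed.

Lemma below_cvg x : Ccvg (below x) x%:C.
Proof.
have -> : (x%:C : C) = x%:C * Cexp 0 by rewrite Cexp0 mulr1.
apply: CcvgZ; apply: Ccvg_continuous; first exact: cderiv_cont (Cexp_deriv _).
move=> e /eta_small[N HN]; exists N => m /HN; rewrite subr0 normc_im normrN.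
by rewrite ger0_norm // ltW // eta_gt0.
Qed.

Lemma belowZ t x m : t%:C * below x m = below (t * x) m.
Proof. by rewrite /below mulrA -rmorphM. Qed.

Lemma normc_below x m : 0 < x -> normc (below x m) = x.
Proof.
by move=> x0; rewrite normcM normcR normc_Cexp expR0 mulr1 ger0_norm // ltW.
Qed.

Lemma Im_below x m : 0 < x -> complex.Im (below x m) < 0.
Proof.
move=> x0; have -> : complex.Im (below x m) = x * sin (- eta m).
  by rewrite /below /= expR0; ring.
rewrite sinN mulrN oppr_lt0 mulr_gt0 // sin_gt0_pi // eta_gt0.
by have := eta_le1 m; have := @pihalf_ge1 R; lra.
Qed.

Lemma offcut_Im z : complex.Im z != 0 -> offcut z.
Proof. by move=> h; right; rewrite ImB /= sub0r oppr_eq0. Qed.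

Lemma offcut_lt1 x : x < 1 -> offcut (x%:C : C).
Proof. by move=> x1; left; rewrite /= subr_gt0. Qed.

Lemma below_offcut x m : 0 < x -> offcut (below x m).
Proof. by move=> x0; apply: offcut_Im; rewrite lt_eqF // Im_below. Qed.

Lemma below_neq0 x m : 0 < x -> below x m != 0.
Proof. by move=> x0; rewrite -normc_gt0 normc_below. Qed.

Lemma Li1_below z : 1 < complex.Re z -> complex.Im z <= 0 -> Li 1 z = - (Log (z - 1) + 0 +i* pi).
Proof.
move=> rz iz; rewrite Li1E -opprB LogN; last by rewrite ReB /= subr_gt0.
by rewrite opprB ImB /= sub0r oppr_ge0 iz.
Qed.

Lemma Li1_above z : 1 < complex.Re z -> 0 < complex.Im z -> Li 1 z = - (Log (z - 1) + 0 +i* (- pi)).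
Proof.
move=> rz iz; rewrite Li1E -opprB LogN; last by rewrite ReB /= subr_gt0.
by rewrite opprB ImB /= sub0r oppr_ge0 leNgt iz.
Qed.

Lemma near_Re z (a : R) : a < complex.Re z -> exists2 r : R, 0 < r &
  forall w, normc (w - z) < r -> a < complex.Re w.
Proof.
move=> az; exists (complex.Re z - a); first by rewrite subr_gt0.
move=> w h; have := le_lt_trans (ler_Re_normc _) h; rewrite ReB ltr_norml; lra.
Qed.

(** The principal logarithm of 1 - x, for x > 1, takes its value from the
    closed upper half plane, hence Li_1 is continuous from below. *)
Lemma Li1_below_cvg x : 0 < x -> x != 1 -> Ccvg (fun m => Li 1 (below x m)) (Li 1 x%:C).
Proof.
move=> x0; rewrite neq_lt => /orP[x1|x1].
  apply: Ccvg_continuous (below_cvg x).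
  exact: cderiv_cont (Li1_deriv (offcut_lt1 x1)).
have x1' : 1 < complex.Re (x%:C : C) by [].
have [r r0 Hr] := near_Re x1'; have [N HN] := below_cvg x r0.
rewrite Li1_below //.
apply: (@eq_Ccvg (fun m => (-1) * (Log (below x m - 1) + 0 +i* pi))).
  exists N => m /HN/Hr rm; rewrite mulN1r Li1_below //.
  by rewrite ltW // Im_below.
rewrite -[X in Ccvg _ X]mulN1r; apply: CcvgZ; apply: CcvgD; last exact: Ccvg_cst.
apply: (Ccvg_continuous (F := fun z => Log (z - 1))) (below_cvg x).
have d1 : is_derive (x%:C : C) (1 : C) (fun y : C => y - 1) 1 := is_derive_shift _ _ _.
have xo : offneg ((x%:C : C) - 1) by left; rewrite ReB /= subr_gt0.
exact: cderiv_cont (cderiv_comp d1 (Log_deriv xo)).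
Qed.

Lemma Cintegrable_measurable (f : R -> C) : Cintegrable f -> Cmeasurable `[(0 : R), 1] f.
Proof.
by move=> [i1 i2]; split; apply/measurable_EFinP; [exact: measurable_int i1|exact: measurable_int i2].
Qed.

Definition Li_cvg_below k := forall x, 0 < x -> (k = 0%N -> x != 1) ->
  Ccvg (fun m => Li k.+1 (below x m)) (Li k.+1 x%:C).

(** Dominated convergence transfers the limit from Li_(k+1) to Li_(k+2); the
    limit at x = 1 is missing for Li_1, which concerns one value of t only. *)
Lemma Li_below_step k : Li_cvg_below k -> forall x, 0 < x ->
  Cintegrable (fun t => Li k.+1 (t%:C * x%:C) / t%:C) /\
  Ccvg (fun m => Li k.+2 (below x m)) (Li k.+2 x%:C).
Proof.
move=> Hk x x0; pose c := cutpoint x.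
pose f_ m t : C := Li k.+1 (t%:C * below x m) / t%:C.
pose f t : C := Li k.+1 (t%:C * x%:C) / t%:C.
have mf_ m : Cmeasurable `[(0 : R), 1] (f_ m).
  apply: Cintegrable_measurable.
  exact: (PL_integrable_offcut k.+1 (below_offcut m x0) (below_neq0 m x0)).
have cvf t : 0 <= t <= 1 -> t != c -> Ccvg (fun m => f_ m t) (f t).
  move=> /andP[t0 t1] tc; rewrite /f_ /f; have [->|tn] := eqVneq t 0.
    by rewrite invr0 mulr0; apply: eq_Ccvg (Ccvg_cst 0); exists 0%N => m _; rewrite mulr0.
  have tp : 0 < t by rewrite lt_def tn.
  have := @CcvgZ (t%:C)^-1 _ _ (Hk (t * x) (mulr_gt0 tp x0) _).
  have -> : Li k.+1 (t%:C * x%:C) / t%:C = (t%:C)^-1 * Li k.+1 (t * x)%:C.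
    by rewrite mulrC rmorphM.
  move=> H; apply: eq_Ccvg (H _).
    by exists 0%N => m _; rewrite mulrC belowZ.
  move=> _; have := cutpoint_dist x0 (t := t); rewrite t0 t1 => /(_ isT) h.
  apply: contraNneq tc => tx; rewrite tx subrr normr0 in h.
  by rewrite -subr_eq0 -normr_eq0 eq_le h normr_ge0.
have mf : Cmeasurable `[(0 : R), 1] f.
  have H (h_ : nat -> R -> R) (h : R -> R) :
      (forall m, measurable_fun `[(0 : R), 1] (h_ m)) ->
      (forall t, 0 <= t <= 1 -> t != c -> h_ m t @[m --> \oo] --> h t) ->
      measurable_fun `[(0 : R), 1] h.
    move=> mh hh; pose D : set R := `[0, 1]%classic `\` [set c].
    have mD : measurable D by exact: measurableD.
    apply: (measurable_funS (E := D `|` [set c])); first exact: measurableU.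
      by move=> t t01; have [->|/eqP tc] := eqVneq t c; [right | left; split].
    apply/measurable_funU => //; split; last exact: measurable_fun_set1.
    apply: (@measurable_fun_cvg _ _ _ _ h_) => [m|t [/=]].
      by apply: measurable_funS (mh m) => // t [].
    by rewrite in_itv /= => t01 /eqP tc; exact: hh.
  split.
    apply: (H (fun m t => complex.Re (f_ m t))) => [m|t t01 tc]; first exact: (mf_ m).1.
    exact: ((CcvgP _ _).1 (cvf t t01 tc)).1.
  apply: (H (fun m t => complex.Im (f_ m t))) => [m|t t01 tc]; first exact: (mf_ m).2.
  exact: ((CcvgP _ _).1 (cvf t t01 tc)).2.
have [g [ig fg]] : exists g : R -> R, mu.-integrable `[0, 1] (EFin \o g) /\
    forall m t, 0 <= t <= 1 -> t != c -> normc (f_ m t) <= g t.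
  case: k Hk @f_ @f mf_ cvf mf => [|k] Hk f_ f mf_ cvf mf.
    (* Only Li_1 is singular on the segment, so only the first step needs a
       dominating function that is unbounded. *)
    exists (fun t => 11 * x * (1 + sing c t)); split.
      exact: (Li1_ray_dominating x0).1.
    move=> m t t01 tc; have := @Li1_ray_bound _ (below x m) t (below_neq0 m x0) t01.
    by rewrite normc_below //; apply.
  have [K K0 HK] := Li_bound R k; exists (fun=> K * x); split.
    exact: integrable_cst01.
  move=> m t /andP[t0 t1] _; rewrite /f_; have [->|tn] := eqVneq t 0.
    by rewrite invr0 mulr0 normc0 mulr_ge0 // ltW.
  have tp : 0 < t by rewrite lt_def tn.
  rewrite normcM normcV normcR (ger0_norm t0) ler_pdivrMr // belowZ.
  have tx : 0 < t * x by rewrite mulr_gt0.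
  apply: le_trans (HK _ (below_offcut m tx) (below_neq0 m tx)) _.
  by rewrite normc_below // [t * x]mulrC mulrA.
have [i cv] := Cdominated mf_ mf ig fg cvf; split => //.
Qed.

Lemma Li_below_cvg k : Li_cvg_below k.
Proof.
elim: k => [|k IH] x x0 xk; first by apply: Li1_below_cvg => //; exact: xk.
exact: (Li_below_step IH x0).2.
Qed.

Lemma Li_integrable_pos k x : 0 < x -> Cintegrable (fun t => Li k.+1 (t%:C * x%:C) / t%:C).
Proof. by move=> x0; exact: (Li_below_step (@Li_below_cvg k) x0).1. Qed.

End OnCut.

(** * The imaginary part of polylogarithms on the cut *)

Section ImOnCut.
Variable R : realType.
Local Notation C := (R[i] : numFieldType).
Local Notation mu := (@lebesgue_measure R).
Implicit Types (z w : C) (t s x : R) (k : nat).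

Lemma LogR (y : R) : 0 < y -> Log (y%:C : C) = (ln y)%:C.
Proof.
move=> y0; rewrite -[LHS](_ : Log (Cexp ((ln y)%:C : C)) = _); last by rewrite CexpR lnK.
by rewrite Log_unique //= oppr_lt0 pi_gt0 pi_ge0.
Qed.

Lemma ln_pow_continuous (a b : R) k t : 0 < t ->
  {for t, continuous (fun t => b * (ln t + a) ^+ k * t^-1)}.
Proof.
move=> t0; apply: continuousM; last by apply: continuousV; [rewrite gt_eqF | exact: cvg_id].
apply: continuousM; first exact: cvg_cst.
apply: (continuous_comp (f := fun t => ln t + a) (g := fun y => y ^+ k)).
  by apply: continuousD; [exact: continuous_ln | exact: cvg_cst].
exact: exprn_continuous.
Qed.

(** The change of variables s = ln t + a. *)
Lemma integral_ln_pow (a : R) k : 0 < a ->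
  \int[mu]_(t in `[expR (- a), 1]) (- pi / k`!%:R * (ln t + a) ^+ k * t^-1) =
  - pi / k.+1`!%:R * a ^+ k.+1.
Proof.
move=> a0; pose h t : R := - pi / k`!%:R * (ln t + a) ^+ k * t^-1.
pose H t : R := - pi / k.+1`!%:R * (ln t + a) ^+ k.+1.
have c0 : 0 < expR (- a) := expR_gt0 _.
have c1 : expR (- a) < 1 by rewrite expR_lt1 oppr_lt0.
have dl t : 0 < t -> is_derive t 1 (fun t => ln t + a) t^-1.
  move=> t0; have := is_deriveD (is_derive1_ln t0) (is_derive_cst a t (1 : R)).
  by rewrite addr0.
have dH t : 0 < t -> is_derive t 1 H (h t).
  move=> t0; have d1 := dl _ t0; have d2 := is_deriveZ (- pi / k.+1`!%:R) (is_deriveX k.+1 d1); rewrite exprfctE in d2.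
  have -> : h t = - pi / k.+1`!%:R *: ((k.+1%:R * (ln t + a) ^+ k.+1.-1) *: t^-1); last exact: d2.
  rewrite /h /GRing.scale /= factS natrM; field.
  by rewrite (gt_eqF t0) nat1r !pnatr_eq0 -!lt0n fact_gt0.
have ch t : 0 < t -> {for t, continuous h} by exact: ln_pow_continuous.
have cH t : 0 < t -> {for t, continuous H}.
  move=> /dH d1; apply/differentiable_continuous/derivable1_diffP.
  exact: (@ex_derive _ _ _ _ _ _ _ d1).
have := @continuous_FTC2 R h H _ _ c1; rewrite /Rintegral => ->.
- rewrite -EFinB /= /H ln1 add0r expRK addNr expr0n mulr0 subr0 //.
- apply: continuous_in_subspaceT => t; rewrite inE /= in_itv /= => /andP[t0 _].
  exact: ch (lt_le_trans c0 t0).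
- split.
  + move=> t; rewrite in_itv /= => /andP[t0 _].
    have d1 := dH _ (lt_trans c0 t0); exact: (@ex_derive _ _ _ _ _ _ _ d1).
  + exact/cvg_at_right_filter/cH.
  + exact/cvg_at_left_filter/cH.
- move=> t; rewrite in_itv /= => /andP[t0 _].
  by rewrite derive1E; have d1 := dH _ (lt_trans c0 t0); exact: (@derive_val _ _ _ _ _ _ _ d1).
Qed.

Lemma Im_Li_step k x : complex.Im (Li k.+2 (x%:C : C)) =
  \int[mu]_(t in `[0, 1]) complex.Im (Li k.+1 (t%:C * x%:C) / t%:C).
Proof. by []. Qed.

Lemma Im_divR z t : complex.Im (z / t%:C) = complex.Im z / t.
Proof. by rewrite -fmorphV; case: z => a b /=; rewrite mulr0 add0r mulrC. Qed.

Lemma Im_Li_lt1 k x : 0 < x < 1 -> complex.Im (Li k.+1 (x%:C : C)) = 0.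
Proof.
elim: k x => [|k IH] x /andP[x0 x1].
  rewrite Li1E; have -> : 1 - x%:C = (1 - x)%:C :> C by rewrite rmorphB.
  by rewrite LogR ?subr_gt0 //= oppr0.
rewrite Im_Li_step // (eq_Rintegral _ (g := fun=> 0)) ?Rintegral_cst01 // => t.
rewrite inE /= in_itv /= => /andP[t0 t1]; rewrite Im_divR -rmorphM /=.
have [->|tn] := eqVneq t 0; first by rewrite invr0 mulr0.
have tp : 0 < t by rewrite lt_def tn.
by rewrite IH ?mul0r // mulr_gt0 //= (le_lt_trans _ x1) // ler_piMl // ltW.
Qed.

(** Only the part of the segment beyond 1 contributes to the imaginary part,
    and there Im Li_(k+1)(t x) is - pi (ln t + ln x)^k / k!, by induction. *)
Lemma Im_Li_gt1 k x : 1 < x -> complex.Im (Li k.+1 (x%:C : C)) = - pi / k`!%:R * ln x ^+ k.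
Proof.
elim: k x => [|k IH] x x1.
  have -> : complex.Im (Li 1 (x%:C : C)) = - (complex.Im (Log (x%:C - 1 : C)) + pi).
    by rewrite Li1_below.
  rewrite -rmorphB /= -/(complex.Im _) expr0 divr1 mulr1.
  have := @LogR (x - 1); rewrite subr_gt0 => /(_ x1) /(congr1 (@complex.Im R)) /= ->.
  by rewrite add0r.
have x0 : 0 < x by rewrite (lt_trans ltr01).
pose F t := complex.Im (Li k.+1 (t%:C * (x%:C : C)) / t%:C).
pose a := ln x; have a0 : 0 < a by rewrite ln_gt0.
pose c := expR (- a); have cE : c = x^-1 by rewrite /c expRN lnK.
have c0 : 0 < c := expR_gt0 _.
have c1 : c < 1 by rewrite /c expR_lt1 oppr_lt0.
have iF : mu.-integrable `[0, 1] (EFin \o F) := (Li_integrable_pos k x0).2.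
have -> : complex.Im (Li k.+2 (x%:C : C)) = \int[mu]_(t in `[0, 1]) F t by [].
have U : `[(0 : R), 1]%classic = `[0, c[ `|` `[c, 1].
  apply/seteqP; split => t /=; rewrite !in_itv /=.
    by case: (ltP t c) => tc /andP[-> ->]; [left|right].
  by move=> [|] /andP[h1 h2]; apply/andP; split; lra.
have D : [disjoint `[0, c[%classic & `[c, 1]%classic].
  apply/eqP/seteqP; split => // t []; rewrite /= !in_itv /= => /andP[h1 h2] /andP[h3 h4]; lra.
rewrite U Rintegral_setU // -?U //.
have -> : \int[mu]_(t in `[0, c[) F t = 0.
  transitivity (\int[mu]_(t in `[0, c[) (0 : R)); last by rewrite Rintegral_cst // mul0r.
  apply: eq_Rintegral => t; rewrite inE /= in_itv /= => /andP[t0 tc].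
  rewrite /F Im_divR -rmorphM /=; have [->|tn] := eqVneq t 0; first by rewrite invr0 mulr0.
  have tp : 0 < t by rewrite lt_def tn.
  by rewrite Im_Li_lt1 ?mul0r // mulr_gt0 //= -ltr_pdivlMr // mul1r -cE.
rewrite add0r -(integral_ln_pow k a0) -/c.
rewrite -Rintegral_itv_obnd_cbnd; last first.
  apply: integrableS iF => // t /=; rewrite !in_itv /= => /andP[h1 h2]; apply/andP; split; lra.
pose h t : R := - pi / k`!%:R * (ln t + a) ^+ k * t^-1.
have ih : mu.-integrable `[c, 1] (EFin \o h).
  apply: continuous_compact_integrable; first exact: segment_compact.
  apply: continuous_in_subspaceT => t; rewrite inE /= in_itv /= => /andP[t0 _].
  exact: ln_pow_continuous (lt_le_trans c0 t0).
rewrite -[RHS](@Rintegral_itv_obnd_cbnd _ _ _ h); last first.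
  apply: integrableS ih => // t /=; rewrite !in_itv /= => /andP[h1 h2]; apply/andP; split; lra.
apply: eq_Rintegral => t; rewrite inE /= in_itv /= => /andP[ct t1].
have t0 : 0 < t := lt_trans c0 ct.
by rewrite /F Im_divR -rmorphM /= IH ?lnM ?posrE // -ltr_pdivrMr // div1r -cE.
Qed.

End ImOnCut.

(** * Holomorphic branches of the polylogarithms of the exponential *)

Section Branch.
Variable R : realType.
Local Notation C := (R[i] : numFieldType).
Implicit Types (z w u : C) (t s x : R) (k : nat) (F g : C -> C).

Lemma Li_conj k z : complex.Im z != 0 -> Li k.+1 z^*%C = (Li k.+1 z)^*%C.
Proof.
elim: k z => [|k IH] z z0.
  have -> : Li 1 z^*%C = - Log (1 - z)^*%C by rewrite Li1E rmorphB rmorph1.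
  by rewrite Log_conj ?Li1E ?rmorphN //; exact: offcut_Im.
have zn : z != 0 by apply: contraNneq z0 => ->.
have -> : Li k.+2 z^*%C = Cintegral01 (fun t => Li k.+1 (t%:C * z^*%C) / t%:C) by [].
have -> : Li k.+2 z = Cintegral01 (fun t => Li k.+1 (t%:C * z) / t%:C) by [].
rewrite -Cintegral_conj; last exact: (PL_integrable_offcut k.+1 (offcut_Im z0) zn).
apply: eq_Cintegral => t _; have [->|tn] := eqVneq t 0.
  by rewrite invr0 !mulr0 rmorph0.
have -> : t%:C * z^*%C = (t%:C * z)^*%C by rewrite rmorphM /= oppr0.
rewrite IH; first by rewrite -fmorphV [RHS]rmorphM /= oppr0.
by case: z z0 {zn} => a b /= b0; rewrite mul0r addr0 mulf_neq0.
Qed.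

Lemma cderiv_local F g z d : (exists2 r : R, 0 < r & forall w, normc (w - z) < r -> F w = g w) ->
  is_derive z 1 g d -> is_derive z 1 F d.
Proof.
move=> [r r0 E] /cderivP H; apply/cderivP => e /H[q q0 Hq].
exists (Num.min r q); first by rewrite lt_min r0.
move=> w; rewrite lt_min => /andP[/E -> /Hq]; rewrite (E z) // subrr normc0 //.
Qed.

Lemma CReIm z : z = (complex.Re z)%:C + 0 +i* complex.Im z.
Proof. by case: z => a b; apply: eqc_ReIm; rewrite /= ?addr0 ?add0r. Qed.

(** A function which is holomorphic off the real line, whose derivative g
    extends continuously, and which is continuous along vertical lines is
    differentiable on the real line. The function F - g(s) id is nearly
    constant, with small slope, on each side of the real line; vertical
    continuity carries this estimate to the real line itself, and two points
    are compared through the detour a -> a + i c -> s + i c -> s. *)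
Lemma glue_deriv F g s (rho : R) : 0 < rho ->
  (forall w, normc (w - s%:C) < rho -> complex.Im w != 0 -> is_derive w 1 F (g w)) ->
  (forall x, `|x - s| < rho -> Ccvg (fun m => F (x%:C + 0 +i* eta R m)) (F x%:C) /\
                               Ccvg (fun m => F (x%:C + 0 +i* (- eta R m))) (F x%:C)) ->
  (forall e : R, 0 < e -> exists2 r : R, 0 < r &
     forall w, normc (w - s%:C) < r -> normc (g w - g s%:C) < e) ->
  is_derive (s%:C : C) 1 F (g s%:C).
Proof.
move=> rho0 dF vF cg; apply/cderivP => e e0.
have e4 : 0 < e / 4 by rewrite divr_gt0.
have [r r0 Hr] := cg _ e4.
pose q := Num.min r rho; have q0 : 0 < q by rewrite lt_min r0.
have qr w : normc (w - s%:C) < q -> normc (w - s%:C) < r /\ normc (w - s%:C) < rho.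
  by rewrite lt_min => /andP[].
pose G := g s%:C; pose Phi w : C := F w - G * w.
have S1 z w : normc (z - s%:C) < q -> normc (w - s%:C) < q ->
    0 < complex.Im z * complex.Im w -> normc (Phi w - Phi z) <= e / 4 * normc (w - z).
  move=> zq wq zw; have := @segment_bound R Phi z (w - z) (e / 4); rewrite [z + (w - z)]addrC subrK; apply.
  move=> t t01; set y := z + _.
  have yq : normc (y - s%:C) < q by exact: ball_segment.
  have [yr yrho] := qr _ yq.
  have yi : complex.Im y != 0.
    have -> : complex.Im y = (1 - t) * complex.Im z + t * complex.Im w.
      by rewrite /y; case: (z) (w) => a b [a' b'] /=; ring.
    have /andP[t0 t1] := t01; have t1' : 0 <= 1 - t by rewrite subr_ge0.
    have [zp|zp] := ltP 0 (complex.Im z).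
      have wp : 0 < complex.Im w by rewrite pmulr_rgt0 in zw.
      have [->|tn] := eqVneq t 0; first by rewrite mul0r addr0 subr0 mul1r gt_eqF.
      by rewrite gt_eqF // ltr_wpDl ?mulr_ge0 ?(ltW zp) // mulr_gt0 // lt_def tn.
    have zn : complex.Im z < 0.
      by rewrite lt_def zp andbT; apply: contraTneq zw => <-; rewrite mul0r ltxx.
    have wn : complex.Im w < 0 by rewrite nmulr_rgt0 in zw.
    have [->|tn] := eqVneq t 0; first by rewrite mul0r addr0 subr0 mul1r lt_eqF.
    rewrite lt_eqF // ltr_wnDl //; first by rewrite mulr_ge0_le0.
    by rewrite pmulr_rlt0 // lt_def tn.
  exists (g y - G *: 1).
    exact: (is_deriveB (dF y yrho yi) (is_deriveZ (G : C) (is_derive_id (y : C) (1 : C)))).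
  by rewrite [G *: 1]mulr1; exact/ltW/Hr.
have nE x (b : R) : normc (x%:C + 0 +i* b - s%:C) <= `|x - s| + `|b|.
  apply: le_trans (ler_normc_ReIm _) _.
  by rewrite /= addr0 add0r oppr0 addr0.
have V x (b : R) : `|x - s| < q / 2 -> b != 0 -> `|b| < q / 2 ->
    normc (Phi (x%:C + 0 +i* b) - Phi x%:C) <= e / 4 * `|b|.
  move=> xq b0 bq; apply/ler_addgt0Pr => d d0.
  have sx : `|x - s| < rho.
    apply: lt_le_trans xq _; have : q <= rho by rewrite ge_min lexx orbT.
    lra.
  pose sg : R := Num.sg b.
  (* Approach x from the side on which x + i b lies. *)
  have cv : Ccvg (fun m => F (x%:C + 0 +i* (sg * eta R m))) (F x%:C).
    have [v1 v2] := vF x sx; rewrite /sg; case: sgrP b0 => // _ _.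
      by apply: eq_Ccvg v1; exists 0%N => m _; rewrite mul1r.
    by apply: eq_Ccvg v2; exists 0%N => m _; rewrite mulN1r.
  have nsg : `|sg| = 1 by rewrite normr_sg b0.
  have cx : Ccvg (fun m => x%:C + 0 +i* (sg * eta R m)) x%:C.
    move=> d1 /eta_small[N HN]; exists N => m /HN h.
    by rewrite addrC addKr normc_im normrM nsg mul1r ger0_norm // ltW // eta_gt0.
  have cPhi : Ccvg (fun m => Phi (x%:C + 0 +i* (sg * eta R m))) (Phi x%:C).
    have := CcvgD cv (CcvgZ (- G) cx); rewrite mulNr; apply: eq_Ccvg.
    by exists 0%N => m _; rewrite mulNr.
  have [N HN] := cPhi d d0.
  have b0' : 0 < `|b| by rewrite normr_gt0.
  have [N' HN'] := eta_small b0'.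
  pose m := maxn N N'; have hm := HN m (leq_maxl _ _); have hm' := HN' m (leq_maxr _ _).
  set p := x%:C + 0 +i* (sg * eta R m) in hm.
  have bE : b = sg * `|b| by rewrite -numEsg.
  have h1 : normc (Phi (x%:C + 0 +i* b) - Phi p) <= e / 4 * `|b|.
    apply: le_trans (S1 _ _ _ _ _) _.
    - apply: le_lt_trans (nE _ _) _; rewrite normrM nsg mul1r ger0_norm ?(ltW (eta_gt0 _ _)) //; lra.
    - by apply: le_lt_trans (nE _ _) _; lra.
    - have -> : complex.Im p * complex.Im (x%:C + 0 +i* b) = `|b| * eta R m.
        by rewrite /p /= normrEsg -/sg; ring.
      by rewrite mulr_gt0 // eta_gt0.
    - rewrite ler_pM2l //.
      have -> : x%:C + 0 +i* b - p = 0 +i* (sg * (`|b| - eta R m)).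
        by rewrite /p {1}bE; apply: eqc_ReIm => /=; ring.
      rewrite normc_im normrM nsg mul1r ger0_norm ?subr_ge0 ?(ltW hm') //.
      by rewrite lerBlDr lerDl ltW // eta_gt0.
  have -> : Phi (x%:C + 0 +i* b) - Phi x%:C = (Phi (x%:C + 0 +i* b) - Phi p) + (Phi p - Phi x%:C).
    by ring.
  apply: le_trans (le_normcD _ _) _; apply: lerD => //; exact: ltW.
exists (q / 2); first by rewrite divr_gt0.
move=> w wq; pose a := complex.Re w; pose b := complex.Im w.
have wE : w = a%:C + 0 +i* b by exact: CReIm.
have as_ : `|a - s| <= normc (w - s%:C).
  by have := ler_Re_normc (w - s%:C); rewrite ReB.
have bs : `|b| <= normc (w - s%:C).
  by have := ler_Im_normc (w - s%:C); rewrite ImB subr0.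
have -> : F w - F s%:C - g s%:C * (w - s%:C) = Phi w - Phi s%:C by rewrite /Phi /G; ring.
have ss : `|s - s| < q / 2 by rewrite subrr normr0 divr_gt0.
have Hz (c : R) : c != 0 -> `|c| < q / 2 ->
    normc (Phi (a%:C + 0 +i* c) - Phi (s%:C + 0 +i* c)) <= e / 4 * `|a - s|.
  move=> c0 cq; apply: le_trans (S1 _ _ _ _ _) _.
  - by apply: le_lt_trans (nE _ _) _; rewrite subrr normr0 add0r; lra.
  - by apply: le_lt_trans (nE _ _) _; move: as_ wq cq; lra.
  - by rewrite /= !add0r -expr2 exprn_even_gt0.
  - rewrite ler_pM2l //; have -> : a%:C + 0 +i* c - (s%:C + 0 +i* c) = (a - s)%:C.
      by rewrite rmorphB /=; ring.
    by rewrite normcR.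
(* The detour through a + i c and s + i c, at a height c that has to be
   nonzero: c is the imaginary part of w, or a - s when w is real. *)
have comb (c : R) (p : C) : c != 0 -> `|c| < q / 2 ->
   normc (p - Phi (a%:C + 0 +i* c)) <= e / 4 * `|c| ->
   normc (p - Phi s%:C) <= e / 4 * (`|a - s| + 2 * `|c|).
  move=> c0 cq pc.
  have -> : p - Phi s%:C = (p - Phi (a%:C + 0 +i* c)) +
    ((Phi (a%:C + 0 +i* c) - Phi (s%:C + 0 +i* c)) + (Phi (s%:C + 0 +i* c) - Phi s%:C)) by ring.
  apply: le_trans (le_normcD _ _) _; apply: le_trans (lerD pc (le_normcD _ _)) _.
  by have := Hz c c0 cq; have := V s c ss c0 cq; lra.
have n0 := normc_ge0 (w - s%:C).
have [b0|b0] := eqVneq b 0.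
  have w_a : w = a%:C by rewrite wE b0; apply: eqc_ReIm => /=; rewrite ?addr0.
  have [as0|as0] := eqVneq a s.
    by rewrite w_a as0 !subrr normc0 mulr0.
  have c0 : a - s != 0 by rewrite subr_eq0.
  have cq : `|a - s| < q / 2 by apply: le_lt_trans as_ wq.
  apply: le_trans (comb (a - s) _ c0 cq _) _.
    by rewrite w_a normc_distC; exact: V.
  have : e / 4 * (`|a - s| + 2 * `|a - s|) <= e / 4 * (4 * normc (w - s%:C)).
    by rewrite ler_pM2l //; have := normr_ge0 (a - s); lra.
  by move/le_trans; apply; rewrite mulrA divfK.
have bq : `|b| < q / 2 by apply: le_lt_trans bs wq.
apply: le_trans (comb b _ b0 bq _) _.
  by rewrite -wE subrr normc0 mulr_ge0 // ltW.
have : e / 4 * (`|a - s| + 2 * `|b|) <= e / 4 * (4 * normc (w - s%:C)).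
  by rewrite ler_pM2l //; lra.
by move/le_trans; apply; rewrite mulrA divfK.
Qed.

End Branch.

Section LocalBranch.
Variable R : realType.
Local Notation C := (R[i] : numFieldType).
Implicit Types (z w u : C) (t s x : R) (k : nat) (F g : C -> C).

Definition PLexp k u : C := PL k (Cexp u).

Lemma PLexp_deriv k u : offcut (Cexp u) -> is_derive u 1 (PLexp k.+1) (PLexp k u).
Proof.
move=> uc; have := cderiv_comp (Cexp_deriv u) (PL_deriv k uc (Cexp_neq0 u)).
by rewrite divfK ?Cexp_neq0.
Qed.

(** For u near the positive real axis, the difference between the
    continuations of Li_(k+1)(e^u) from above and from below the cut. *)
Definition jump k u : C := twopii R / k`!%:R * u ^+ k.

Lemma pow_deriv k u : is_derive u 1 (fun v : C => v ^+ k.+1) (k.+1%:R * u ^+ k).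
Proof.
have := is_deriveX k.+1 (is_derive_id u (1 : C)).
by rewrite exprfctE /GRing.scale /= mulr1.
Qed.

Lemma fact_neq0C k : (k`!%:R : C) != 0.
Proof. by rewrite pnatr_eq0 -lt0n fact_gt0. Qed.

Lemma jump_deriv k u : is_derive u 1 (jump k.+1) (jump k u).
Proof.
have := is_deriveZ (twopii R / k.+1`!%:R) (pow_deriv k u).
have -> : (twopii R / k.+1`!%:R) *: (k.+1%:R * u ^+ k) = jump k u; last by [].
rewrite /jump /GRing.scale /= factS natrM; field.
by rewrite fact_neq0C nat1r pnatr_eq0.
Qed.

Lemma jump0_deriv u : is_derive u 1 (jump 0) 0.
Proof.
have -> : jump 0 = cst (twopii R) by apply/funext => v; rewrite /jump expr0 mulr1 divr1.
exact: is_derive_cst.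
Qed.

(** The value on the lower side of the cut and on the cut, corrected by the
    jump on the upper side. It is meant near a positive real number. *)
Definition glued k u : C :=
  if k is k'.+1 then PLexp k u - (if complex.Im u <= 0 then 0 else jump k' u) else PLexp 0 u.

Lemma Im_Cexp_sign u : `|complex.Im u| < 1 ->
  [/\ complex.Im u <= 0 -> complex.Im (Cexp u) <= 0,
      0 < complex.Im u -> 0 < complex.Im (Cexp u) &
      complex.Im u != 0 -> complex.Im (Cexp u) != 0].
Proof.
rewrite CexpE /=; set a := complex.Re u; set b := complex.Im u => b1.
have p2 := @pihalf_ge1 R; have [b2 b3] : - 1 < b /\ b < 1 by move: b1; rewrite ltr_norml => /andP.
have sp : 0 < b -> 0 < sin b by move=> b0; apply: sin_gt0_pi; rewrite b0; lra.
have sn : b < 0 -> sin b < 0.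
  by move=> b0; rewrite -oppr_gt0 -sinN; apply: sin_gt0_pi; apply/andP; split; lra.
have e0 := expR_gt0 a; split.
- by rewrite le_eqVlt => /predU1P[->|/sn h]; rewrite ?sin0 ?mulr0 // pmulr_rle0 // ltW.
- by move=> /sp h; rewrite mulr_gt0.
- by rewrite neq_lt => /orP[/sn h|/sp h]; rewrite mulf_neq0 ?(lt_eqF h) ?(gt_eqF h) ?gt_eqF.
Qed.

Lemma glued_le k u : complex.Im u <= 0 -> glued k.+1 u = Li k.+1 (Cexp u).
Proof. by move=> u0; rewrite /glued u0 subr0. Qed.

Lemma glued_gt k u : 0 < complex.Im u -> glued k.+1 u = Li k.+1 (Cexp u) - jump k u.
Proof. by move=> u0; rewrite /glued leNgt u0. Qed.

Lemma glued_lower k w : complex.Im w < 0 -> offcut (Cexp w) -> is_derive w 1 (glued k.+1) (glued k w).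
Proof.
move=> w0 wc; have -> : glued k w = PLexp k w.
  by case: k => // k; rewrite /glued (ltW w0) subr0.
apply: cderiv_local (PLexp_deriv k wc); exists (- complex.Im w); first by rewrite oppr_gt0.
move=> v h; have := le_lt_trans (ler_Im_normc _) h; rewrite ImB ltr_norml => /andP[_ h2].
by rewrite /glued ifT ?subr0 //; lra.
Qed.

Lemma glued_upper k w : 0 < complex.Im w -> offcut (Cexp w) -> is_derive w 1 (glued k.+1) (glued k w).
Proof.
move=> w0 wc; apply: (@cderiv_local _ _ (PLexp k.+1 - jump k)).
  exists (complex.Im w) => // v h; have := le_lt_trans (ler_Im_normc _) h.
  by rewrite ImB ltr_norml => /andP[h2 _]; rewrite /glued ifF //; apply/negbTE; rewrite -ltNge; lra.
have -> : glued k w = PLexp k w - (if k is k'.+1 then jump k' w else 0).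
  by case: k => [|k]; rewrite /glued ?subr0 // ifF //; apply/negbTE; rewrite -ltNge.
apply: is_deriveB; first exact: PLexp_deriv.
by case: k => [|k]; [exact: jump0_deriv | exact: jump_deriv].
Qed.

Lemma Cexp_below x m : Cexp (x%:C + 0 +i* (- eta R m) : C) = below (expR x) m.
Proof. by rewrite CexpD CexpR. Qed.

Lemma Cexp_above x m : Cexp (x%:C + 0 +i* eta R m : C) = (below (expR x) m)^*%C.
Proof.
rewrite CexpD CexpR /below /= expR0 !mul1r cosN sinN.
by apply: eqc_ReIm => /=; ring.
Qed.

(** From below this is [Li_below_cvg]. From above, conjugation symmetry
    reduces to the limit from below, and the jump is twice the imaginary part
    on the cut. *)
Lemma glued_vertical k x : 0 < x ->
  Ccvg (fun m => glued k.+1 (x%:C + 0 +i* eta R m)) (glued k.+1 x%:C) /\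
  Ccvg (fun m => glued k.+1 (x%:C + 0 +i* (- eta R m))) (glued k.+1 x%:C).
Proof.
move=> x0; have e0 : 0 < expR x := expR_gt0 x; have e1 : 1 < expR x by rewrite expR_gt1.
have pE : glued k.+1 x%:C = Li k.+1 (expR x)%:C by rewrite glued_le // CexpR.
have cv : Ccvg (fun m => Li k.+1 (below (expR x) m)) (Li k.+1 (expR x)%:C).
  by apply: Li_below_cvg => // _; rewrite gt_eqF.
split; rewrite pE; last first.
  apply: eq_Ccvg cv; exists 0%N => m _.
  by rewrite glued_le ?Cexp_below //= add0r oppr_le0 ltW // eta_gt0.
have cx : Ccvg (fun m => x%:C + 0 +i* eta R m) x%:C.
  move=> d1 /eta_small[N HN]; exists N => m /HN h.
  by rewrite addrC addKr normc_im ger0_norm // ltW // eta_gt0.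
have cj : Ccvg (fun m => jump k (x%:C + 0 +i* eta R m)) (jump k x%:C).
  apply: Ccvg_continuous cx; case: k {pE cv} => [|k]; apply: cderiv_cont.
    exact: jump0_deriv.
  exact: jump_deriv.
have := CcvgD (Ccvg_conj cv) (CcvgZ (-1) cj).
have -> : (Li k.+1 (expR x)%:C)^*%C + -1 * jump k x%:C = Li k.+1 (expR x)%:C.
  have := Im_Li_gt1 k e1; rewrite expRK; set L := Li k.+1 _ => iL.
  rewrite [L]complexReIm /= iL /jump /twopii.
  have -> : x%:C ^+ k = (x ^+ k)%:C by rewrite rmorphXn.
  have -> : (k`!%:R : C)^-1 = (k`!%:R^-1)%:C by rewrite fmorphV rmorph_nat.
  by apply: eqc_ReIm => /=; ring.
apply: eq_Ccvg; exists 0%N => m _.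
rewrite glued_gt; last by rewrite /= add0r eta_gt0.
by rewrite Cexp_above Li_conj ?mulN1r // lt_eqF // Im_below.
Qed.

(** At order 1 the two sides are given by the same holomorphic function - (Log
    (e^u - 1) + i pi). At higher orders [glue_deriv] applies, the derivative
    being continuous by the previous order. *)
Lemma glued_deriv s : 0 < s -> exists2 rho : R, 0 < rho &
  forall k w, normc (w - s%:C) < rho -> is_derive w 1 (glued k.+1) (glued k w).
Proof.
move=> s0; have e1 : 1 < complex.Re (Cexp (s%:C : C)) by rewrite CexpR /= expR_gt1.
have [r r0 Hr] := near_Re e1.
have [q q0 Hq] := cderiv_cont (Cexp_deriv (s%:C : C)) r0.
pose rho := Num.min q (Num.min 1 s).
exists rho; first by rewrite !lt_min q0 ltr01.
have D w : normc (w - s%:C) < rho ->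
    [/\ 1 < complex.Re (Cexp w), `|complex.Im w| < 1 & 0 < complex.Re w].
  rewrite !lt_min => /and3P[/Hq/Hr h1 h2 h3]; split => //.
    by apply: le_lt_trans h2; have := ler_Im_normc (w - s%:C); rewrite ImB subr0.
  by have := le_lt_trans (ler_Re_normc (w - s%:C)) h3; rewrite ReB ltr_norml => /andP[h _]; move: h => /=; lra.
have nonreal k w : normc (w - s%:C) < rho -> complex.Im w != 0 -> is_derive w 1 (glued k.+1) (glued k w).
  move=> /D[_ w1 _] w0; have [_ _ /(_ w0) e0] := Im_Cexp_sign w1.
  have wc := offcut_Im e0; move: w0; rewrite neq_lt => /orP[w0|w0].
    exact: glued_lower.
  exact: glued_upper.
elim=> [|k IH] w wr; have [w0|w0] := eqVneq (complex.Im w) 0; try exact: nonreal.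
  have -> : glued 0 w = - (Cexp w / (Cexp w - 1)).
    by rewrite /glued /PLexp /PL -opprB invrN mulrN.
  pose G v : C := - (Log (Cexp v - 1) + 0 +i* pi).
  have [w1 w2 _] := D w wr.
  have [r' r'0 near] : exists2 r' : R, 0 < r' & forall v, normc (v - w) < r' -> normc (v - s%:C) < rho.
    exists (rho - normc (w - s%:C)); first by rewrite subr_gt0.
    move=> v h; have -> : v - s%:C = (v - w) + (w - s%:C) by ring.
    by apply: le_lt_trans (le_normcD _ _) _; lra.
  apply: (@cderiv_local _ _ G).
    exists r' => // v /near/D[v1 v2 _]; have [h1 h2 _] := Im_Cexp_sign v2.
    rewrite /glued /PLexp /PL /G; case: leP => [/h1 i0|/h2 i0].
      by rewrite subr0 Li1_below.
    rewrite Li1_above // /jump expr0 mulr1 divr1 /twopii.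
    have aux (A : C) (y : R) : - (A + 0 +i* (- y)) - 0 +i* (2 * y) = - (A + 0 +i* y).
      by case: A => a b; apply: eqc_ReIm => /=; ring.
    exact: aux.
  have o1 : offneg (Cexp w - 1) by left; rewrite ReB /= subr_gt0.
  have d1 : is_derive w (1 : C) (fun v => Cexp v - 1) (Cexp w).
    have := is_deriveB (Cexp_deriv w) (is_derive_cst (1 : C) w (1 : C)); rewrite subr0; exact.
  have d2 := cderiv_comp d1 (Log_deriv o1).
  have := is_deriveN (is_deriveD d2 (is_derive_cst (0 +i* pi : C) w (1 : C))).
  by rewrite addr0 mulrC.
have wE : w = (complex.Re w)%:C by rewrite [LHS]CReIm w0; apply: eqc_ReIm => /=; rewrite ?addr0.
have [_ _ rw] := D w wr; set x := complex.Re w in wE rw *; rewrite wE.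
have sub (v : C) : normc (v - x%:C) < rho - normc (w - s%:C) -> normc (v - s%:C) < rho.
  rewrite {1}wE => h; have -> : v - s%:C = (v - x%:C) + (x%:C - s%:C) by ring.
  apply: le_lt_trans (le_normcD _ _) _; lra.
apply: (@glue_deriv _ _ _ _ (rho - normc (w - s%:C))).
- by rewrite subr_gt0.
- by move=> v /sub; exact: nonreal.
- move=> y yx; apply: glued_vertical; have /D[_ _] : normc (y%:C - s%:C : C) < rho; last by [].
  by apply: sub; rewrite -rmorphB normcR.
- by rewrite -wE; apply: cderiv_cont; exact: IH.
Qed.

(** Off the cut the functions Li_k(e^u) themselves will do. On the cut, u0
    differs from a positive real number by a period 2 pi i p, and the glued
    functions are translated by this period. *)
Lemma local_branch u0 : Cexp u0 != 1 -> exists phi : nat -> C -> C, exists2 rho : R, 0 < rho &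
  forall u, normc (u - u0) < rho ->
  [/\ forall k, is_derive u 1 (phi k.+1) (phi k u),
      phi 0%N u = Cexp u / (1 - Cexp u) &
      exists m p : int, forall k, phi k.+1 u =
        Li k.+1 (Cexp u) + m%:~R * (twopii R / k`!%:R * (u - p%:~R * twopii R) ^+ k)].
Proof.
move=> u1; have [uc|unc] := pselect (offcut (Cexp u0)).
  have [d d0 Hd] := offcut_segment_dist uc.
  have [r r0 Hr] := cderiv_cont (Cexp_deriv u0) d0.
  exists PLexp, r => // u /Hr/Hd[oc _]; split => //; first by move=> k; exact: PLexp_deriv.
  by exists 0, 0 => k; rewrite mul0r addr0.
have i0 : complex.Im (Cexp u0) = 0.
  by apply/eqP; apply: contra_notT unc; exact: offcut_Im.
have x1 : 1 < complex.Re (Cexp u0).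
  rewrite lt_def; apply/andP; split.
    by apply: contraNneq u1 => E; apply/eqP; apply: eqc_ReIm.
  by rewrite leNgt; apply: contra_notN unc => h; left; rewrite ReB /= subr_gt0.
set x := complex.Re (Cexp u0) in x1; have x0 : 0 < x by rewrite (lt_trans ltr01).
have eE : Cexp u0 = Cexp ((ln x)%:C : C).
  by rewrite CexpR lnK //; apply: eqc_ReIm.
have [p pE] := Cexp_eq eE; have s0 : 0 < ln x by rewrite ln_gt0.
have [rho rho0 Hrho] := glued_deriv s0.
exists (fun k u => glued k (u - p%:~R * twopii R)), rho => // u ur.
set v := u - p%:~R * twopii R.
have vr : normc (v - (ln x)%:C) < rho by rewrite /v -addrA -opprD [_ + (ln x)%:C]addrC -pE.
have ev : Cexp v = Cexp u by rewrite -(Cexp_periodic v p) subrK.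
have dv : is_derive u (1 : C) (fun u => u - p%:~R * twopii R) 1 := is_derive_shift _ _ _.
split.
- by move=> k; have := cderiv_comp dv (Hrho k v vr); rewrite mulr1.
- by rewrite -/v /glued /PLexp ev.
(* The coefficient m records on which side of the cut the point lies. *)
exists (if complex.Im v <= 0 then 0 else - 1), p => k; rewrite -/v /glued /PLexp ev /jump.
by case: ifP => _; rewrite ?mul0r ?subr0 ?addr0 // mulN1r.
Qed.

End LocalBranch.

(** * Homomorphisms out of the symbol group *)

Section UniversalMaps.
Implicit Types V W : zmodType.

Definition preservesB V W (f : V -> W) : Prop := forall x y, f (x - y) = f x - f y.

Lemma preservesB0 V W (f : V -> W) : preservesB f -> f 0 = 0.
Proof. by move=> fB; rewrite -[0 in LHS](subrr 0) fB subrr. Qed.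

Lemma preservesBN V W (f : V -> W) x : preservesB f -> f (- x) = - f x.
Proof. by move=> fB; rewrite -[- x]sub0r fB preservesB0 // sub0r. Qed.

Lemma preservesBD V W (f : V -> W) x y : preservesB f -> f (x + y) = f x + f y.
Proof. by move=> fB; have := fB x (- y); rewrite (preservesBN y fB) !opprK. Qed.

Lemma preservesB_sum V W (f : V -> W) (I : finType) (g : I -> V) : preservesB f ->
  f (\sum_i g i) = \sum_i f (g i).
Proof.
by move=> fB; apply: (big_morph f _ (preservesB0 fB)) => x y; exact: preservesBD.
Qed.

Lemma preservesBMz V W (f : V -> W) x (k : int) : preservesB f -> f (x *~ k) = f x *~ k.
Proof.
move=> fB; have H (n : nat) : f (x *+ n) = f x *+ n.
  by elim: n => [|n IH]; rewrite ?preservesB0 // !mulrS preservesBD // IH.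
by case: k => n; [exact: H | rewrite NegzE !mulrNz preservesBN // H].
Qed.

Lemma zprojB V (S : set V) : preservesB (zproj S).
Proof. by move=> x y; exact: (@raddfB _ _ (\pi_(Quotient.quot (gen_subgroup S)))%qT x y). Qed.

Lemma zproj_eq0 V (S : set V) x : (zproj S x == 0) = (x \in gen_subgroup S).
Proof.
by rewrite -[x in RHS]subr0 Quotient.idealrBE -(preservesB0 (zprojB S)).
Qed.

Lemma gen_subgroup_ker V W (S : set V) (f : V -> W) x : preservesB f ->
  (forall y, S y -> f y = 0) -> x \in gen_subgroup S -> f x = 0.
Proof.
move=> fB fS; rewrite unfold_in => /asboolP /(_ [set y | f y = 0]); apply; split; last exact: fS.
split; first exact: preservesB0.
by move=> y z /= y0 z0; rewrite fB y0 z0 subrr.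
Qed.

Lemma zquot_lift V W (S : set V) (f : V -> W) : preservesB f -> (forall y, S y -> f y = 0) ->
  exists2 h : zquot S -> W, preservesB h & forall x, h (zproj S x) = f x.
Proof.
move=> fB fS; have fE x y : zproj S x = zproj S y -> f x = f y.
  move=> xy; apply/eqP; rewrite -subr_eq0 -fB; apply/eqP.
  apply: (gen_subgroup_ker fB fS); rewrite -zproj_eq0 zprojB xy subrr //.
have rE (q : zquot S) : zproj S (repr q) = q by rewrite /zproj reprK.
exists (fun q => f (repr q)) => [q q'|x]; last by apply: fE; rewrite rE.
by rewrite -fB; apply: fE; rewrite rE zprojB !rE.
Qed.

Lemma freeg_lift (T : choiceType) W (f : T -> W) :
  exists2 h : {freeg T} -> W, preservesB h & forall x, h << x >> = f x.
Proof.
exists (fglift (f : T -> zmodule W)) => [x y|x].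
  exact: (@lift_is_additive _ _ (zmodule W)).
by rewrite liftU; exact: (scale1r (f x : zmodule W)).
Qed.

Lemma tensor_lift (A B W : zmodType) (f : A -> B -> W) :
  (forall b, preservesB (f ^~ b)) -> (forall a, preservesB (f a)) ->
  exists2 h : tensor A B -> W, preservesB h & forall a b, h (tens a b) = f a b.
Proof.
move=> f1 f2; have [g gB gE] := freeg_lift (fun p : A * B => f p.1 p.2).
have [|h hB hE] := @zquot_lift _ _ (tensor_rel (A := A) (B := B)) g gB.
  move=> _ [[a [a' [b ->]]]|[a [b [b' ->]]]]; rewrite !gB !gE /=.
    by rewrite (preservesBD _ _ (f1 b)) addrAC addrK subrr.
  by rewrite (preservesBD _ _ (f2 a)) addrAC addrK subrr.
by exists h => // a b; rewrite /tens hE gE.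
Qed.

Lemma ext2_lift (A W : zmodType) (f : A -> A -> W) :
  (forall b, preservesB (f ^~ b)) -> (forall a, preservesB (f a)) -> (forall a, f a a = 0) ->
  exists2 h : ext2 A -> W, preservesB h & forall a b, h (wedge a b) = f a b.
Proof.
move=> f1 f2 f0; have [g gB gE] := tensor_lift f1 f2.
have [|h hB hE] := @zquot_lift _ _ (ext2_rel (A := A)) g gB.
  by move=> _ [a ->]; rewrite gE f0.
by exists h => // a b; rewrite /wedge hE gE.
Qed.

(** The product of the values phi(v_i) is multilinear and symmetric. *)
Lemma sympower_lift m (A : zmodType) (K : fieldType) (phi : A -> K) : preservesB phi ->
  exists2 h : sympower m A -> K, preservesB h & forall a, h (sym_pow m a) = phi a ^+ m.
Proof.
move=> pB; pose f (v : {ffun 'I_m -> A}) : K := \prod_i phi (v i).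
have [g gB gE] := freeg_lift f.
have [|h hB hE] := @zquot_lift _ _ (sym_rel (m := m) (A := A)) g gB.
  move=> _ [[v [i [a [b ->]]]]|[v [s ->]]]; rewrite !gB !gE /f.
    have U c : \prod_j phi (upd v i c j) = phi c * \prod_(j | j != i) phi (v j).
      rewrite (bigD1 i) //= ffunE eqxx; congr (_ * _).
      by apply: eq_bigr => j /negbTE ji; rewrite ffunE ji.
    by rewrite !U (preservesBD a b pB) mulrDl addrAC addrK subrr.
  rewrite [X in _ - X](reindex_inj (@perm_inj _ s)) /=; apply/eqP; rewrite subr_eq0; apply/eqP.
  by apply: eq_bigr => j _; rewrite ffunE.
exists h => // a; rewrite /sym_pow hE gE /f.
under eq_bigr do rewrite ffunE.
by rewrite prodr_const card_ord.
Qed.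

End UniversalMaps.

Section SymbolPairing.
Variables (F K : fieldType).

(** The alternating form f(x) g(y) - f(y) g(x) tensored with a power of f. *)
Lemma symb_pairing (n : nat) (phi psi : mulgrp F -> K) : preservesB phi -> preservesB psi ->
  exists2 h : symb_target F n -> K, preservesB h &
    forall x y, h (tens (wedge x y) (sym_pow (n - 2) x)) =
      (phi x * psi y - phi y * psi x) * phi x ^+ (n - 2).
Proof.
move=> pB qB; pose f x y := phi x * psi y - phi y * psi x.
have [|||E EB EE] := @ext2_lift _ _ f.
- by move=> b x y; rewrite /f pB qB; ring.
- by move=> a x y; rewrite /f pB qB; ring.
- by move=> a; rewrite /f subrr.
have [S SB SE] := sympower_lift (n - 2) pB.
have [||h hB hE] := @tensor_lift _ _ _ (fun e s => E e * S s).
- by move=> s x y; rewrite EB mulrBl.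
- by move=> e x y; rewrite SB mulrBr.
by exists h => // x y; rewrite hE EE SE.
Qed.

Lemma symb_kernel_pairing (n M : nat) (r : 'I_M -> int) (x y : 'I_M -> mulgrp F)
  (phi psi : mulgrp F -> K) : preservesB phi -> preservesB psi ->
  (forall i, val (y i) = 1 - val (x i)) ->
  symb n (\sum_(i < M) << r i *g Some (val (x i)) >>) = 0 ->
  \sum_(i < M) (phi (x i) * psi (y i) - phi (y i) * psi (x i)) * phi (x i) ^+ (n - 2) *~ r i = 0.
Proof.
move=> pB qB xy S0; have [h hB hE] := symb_pairing n pB qB.
pose s : {freeg (P1 F)} -> symb_target F n := symb n.
have sB : preservesB s.
  by move=> a b; exact: (@lift_is_additive _ _ (zmodule (symb_target F n))).
have := congr1 h S0; rewrite (preservesB0 hB) -/(s _) (preservesB_sum _ sB) (preservesB_sum _ hB).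
move=> E; rewrite -[RHS]E; apply: eq_bigr => i _.
have -> : s << r i *g Some (val (x i)) >> = tens (wedge (x i) (y i)) (sym_pow (n - 2) (x i)) *~ r i.
  rewrite /s /symb liftU /symb_gen -xy !valK.
  by rewrite -[RHS]scalezrE.
by rewrite (preservesBMz _ _ hB) hE.
Qed.

End SymbolPairing.

(** * Additive maps with prescribed values *)

Section AdditiveExtension.
Variables (V : zmodType) (K : numFieldType).
Implicit Types (G H : set (V * K)).

(** An additive map defined on a subgroup of V, encoded by its graph so that
    extensions are inclusions and unions of chains are unions of sets. *)
Definition partial_hom G : Prop :=
  [/\ G 0, forall p q, G p -> G q -> G (p - q) & forall c, G (0, c) -> c = 0].

Lemma partial_homN G p : partial_hom G -> G p -> G (- p).
Proof. by move=> [G0 GB _] Gp; rewrite -sub0r; exact: GB. Qed.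

Lemma partial_homD G p q : partial_hom G -> G p -> G q -> G (p + q).
Proof. by move=> hG Gp Gq; rewrite -[q]opprK; have [_ GB _] := hG; apply: GB => //; exact: partial_homN. Qed.

Lemma partial_homMz G p (k : int) : partial_hom G -> G p -> G (p *~ k).
Proof.
move=> hG Gp; have H (n : nat) : G (p *+ n).
  by elim: n => [|n IH]; [have [] := hG | rewrite mulrS; exact: partial_homD].
by case: k => n; [exact: H | rewrite NegzE mulrNz; apply: (partial_homN hG); exact: H].
Qed.

Lemma partial_hom_eq G x c d : partial_hom G -> G (x, c) -> G (x, d) -> c = d.
Proof.
move=> [_ GB Gf] Gc Gd; apply/eqP; rewrite -subr_eq0; apply/eqP/Gf.
have -> : (0, c - d) = (x, c) - (x, d) :> V * K by congr (_, _); rewrite /= subrr.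
exact: GB.
Qed.

Lemma pairMz (x : V) (c : K) (k : int) : (x, c) *~ k = (x *~ k, c *~ k).
Proof.
have H (n : nat) : (x, c) *+ n = (x *+ n, c *+ n).
  by elim: n => // n IH; rewrite !mulrS IH.
by case: k => n; [exact: H | rewrite NegzE !mulrNz -[_ *~ _]/(_ *+ _) H].
Qed.

(** The divisibility of K allows one more element x in the domain: if m x is
    already in the domain for some m != 0, the value at x has to be that at m
    x divided by m; otherwise it can be 0. *)
Lemma partial_hom_adjoin G x : partial_hom G ->
  exists H, [/\ partial_hom H, G `<=` H & exists c, H (x, c)].
Proof.
move=> hG; have [G0 GB Gf] := hG.
have [c Hc] : exists c : K, forall (n : int) e, G (x *~ n, e) -> e = c *~ n.
  have [[m [d [m0 Gd]]]|nex] := pselect (exists m : int, exists d : K, m != 0 /\ G (x *~ m, d)).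
    exists (d / m%:~R) => n e Ge.
    have mK : m%:~R != 0 :> K by rewrite intr_eq0.
    have G1 := partial_homMz m hG Ge; have G2 := partial_homMz n hG Gd.
    rewrite pairMz -mulrzA in G1; rewrite pairMz -mulrzA mulrC in G2.
    have := partial_hom_eq hG G1 G2; rewrite -mulrzr => E.
    by apply: (mulIf mK); rewrite E mulrzAl divfK.
  exists 0 => n e Ge; rewrite mul0rz; have [n0|n0] := eqVneq n 0.
    by apply: Gf; rewrite n0 mulr0z in Ge.
  by case: nex; exists n, e.
exists [set p | exists g, exists n : int, G g /\ p = g + (x, c) *~ n]; split.
- split.
  + by exists 0, 0; split => //; rewrite mulr0z addr0.
  + move=> _ _ [g [n [Gg ->]]] [h [m [Gh ->]]]; exists (g - h), (n - m); split; first exact: GB.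
    by rewrite mulrzBr opprD addrACA.
  + move=> e [[y f] [n [Gy]]]; rewrite pairMz => -[/eqP].
    rewrite eq_sym addr_eq0 => /eqP yE ->.
    have Ge : G (x *~ n, - f).
      by have := partial_homN hG Gy; rewrite yE; congr G; congr (_, _); rewrite /= opprK.
    by rewrite -(Hc n _ Ge) subrr.
- by move=> g Gg; exists g, 0; split => //; rewrite mulr0z addr0.
- by exists c, 0, 1; split => //; rewrite mulr1z add0r.
Qed.

(** Zorn's lemma for the graphs that contain the one prescribed by the values
    w_j; independence makes the latter a graph. The predicate [P] is stated on
    unions with this graph so that it also holds for the union of the empty
    chain. *)
Lemma additive_extension N (a : 'I_N -> V) (w : 'I_N -> K) :
  (forall e : 'I_N -> int, \sum_j a j *~ e j = 0 -> forall j, e j = 0) ->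
  exists2 phi : V -> K, preservesB phi & forall j, phi (a j) = w j.
Proof.
move=> indep.
pose G0 : set (V * K) := [set p | exists e : 'I_N -> int, p = (\sum_j a j *~ e j, \sum_j w j *~ e j)].
have hG0 : partial_hom G0.
  split.
  - exists (fun=> 0); congr (_, _); rewrite big1 // => j _; exact: mulr0z.
  - move=> _ _ [e ->] [f ->]; exists (fun j => e j - f j).
    by congr (_, _); rewrite /= -sumrB; apply: eq_bigr => j _; rewrite mulrzBr.
  - move=> c [e [/esym /indep e0 ->]]; rewrite big1 // => j _; rewrite e0; exact: mulr0z.
pose P (G : set (V * K)) := partial_hom (G0 `|` G).
have [|A [PA Amax]] := @Zorn_bigcup _ P.
  move=> F FP Ft; have [G00 GB0 Gf0] := hG0; split.
  - by left.
  - move=> p q [Gp|[X FX Xp]] [Gq|[Y FY Yq]].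
    + by left; exact: GB0.
    + have [_ B _] := FP _ FY; have [h|h] := B p q (or_introl Gp) (or_intror Yq); [by left|].
      by right; exists Y.
    + have [_ B _] := FP _ FX; have [h|h] := B p q (or_intror Xp) (or_introl Gq); [by left|].
      by right; exists X.
    + have [XY|YX] := Ft _ _ FX FY.
        have [_ B _] := FP _ FY; have [h|h] := B p q (or_intror (XY _ Xp)) (or_intror Yq); [by left|].
        by right; exists Y.
      have [_ B _] := FP _ FX; have [h|h] := B p q (or_intror Xp) (or_intror (YX _ Yq)); [by left|].
      by right; exists X.
  - move=> c [/Gf0 //|[X FX Xc]]; have [_ _ B] := FP _ FX; apply: B; by right.
have total x : exists c, (G0 `|` A) (x, c).
  have [H [hH AH [c Hc]]] := partial_hom_adjoin x PA.
  have [HA|nHA] := pselect (H `<=` G0 `|` A); first by exists c; exact: HA.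
  exfalso; apply: (Amax H); last first.
    by rewrite /P (_ : G0 `|` H = H) //; apply/setUidPr => p Gp; apply: AH; left.
  split; first by move=> p Ap; apply: AH; right.
  by move=> HA; apply: nHA => p /HA; right.
have [phi phiE] : exists phi : V -> K, forall x, (G0 `|` A) (x, phi x).
  exists (fun x => sval (cid (total x))) => x; exact: svalP (cid (total x)).
exists phi.
  move=> x y; apply: (partial_hom_eq PA (phiE _)).
  have [_ B _] := PA; exact: B (phiE x) (phiE y).
move=> j; apply: (partial_hom_eq PA (phiE _)); left.
exists (fun i => if i == j then 1 else 0); congr (_, _);
  rewrite (bigD1 j) //= eqxx mulr1z big1 ?addr0 // => i /negbTE ->; exact: mulr0z.
Qed.

End AdditiveExtension.

(** * The symbol and logarithmic differentiation *)

Section MulGroup.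
Variable F : fieldType.
Implicit Types x y : mulgrp F.

Lemma val_mulgrpD x y : val (x + y) = val x * val y.
Proof. by []. Qed.

Lemma val_mulgrpMz x (k : int) : val (x *~ k) = val x ^ k.
Proof.
have H (n : nat) : val (x *+ n) = val x ^+ n.
  by elim: n => // n IH; rewrite mulrS val_mulgrpD IH exprS.
by case: k => n; [exact: H | rewrite NegzE mulrNz -[LHS]/((val (x *+ n.+1))^-1) H].
Qed.

Lemma val_mulgrp_sum N (f : 'I_N -> mulgrp F) : val (\sum_j f j) = \prod_j val (f j).
Proof. by apply: (big_morph val val_mulgrpD). Qed.

Lemma mult_independent_mulgrp N (a : 'I_N -> mulgrp F) : mult_independent (fun j => val (a j)) ->
  forall e : 'I_N -> int, \sum_j a j *~ e j = 0 -> forall j, e j = 0.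
Proof.
move=> ai e e0; apply: ai; have := congr1 val e0.
by rewrite val_mulgrp_sum => E; rewrite -[RHS]E; apply: eq_bigr => j _; rewrite val_mulgrpMz.
Qed.

(** The pairing with the symbol needs homomorphisms on all of F^*, while c and
    d prescribe values at the a_j only; independence lets these values be
    extended. *)
Lemma symb_kernel_log (K : numFieldType) n M N (r : 'I_M -> int) (z : 'I_M -> F)
    (a : 'I_N -> F) (k l : 'I_N -> 'I_M -> int) (c d : 'I_N -> K) :
  (forall j, a j != 0) -> mult_independent a ->
  (forall i, z i = \prod_(j < N) a j ^ k j i) ->
  (forall i, 1 - z i = \prod_(j < N) a j ^ l j i) ->
  symb n (\sum_(i < M) << r i *g Some (z i) >>) = 0 ->
  \sum_(i < M) ((\sum_j c j *~ k j i) * (\sum_j d j *~ l j i)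
    - (\sum_j c j *~ l j i) * (\sum_j d j *~ k j i)) * (\sum_j c j *~ k j i) ^+ (n - 2) *~ r i = 0.
Proof.
move=> a0 a_indep zE zE' S0.
pose A j : mulgrp F := Sub (a j) (a0 j).
pose X (h : 'I_N -> 'I_M -> int) i := \sum_j A j *~ h j i.
have valX h i : val (X h i) = \prod_j a j ^ h j i.
  by rewrite val_mulgrp_sum; apply: eq_bigr => j _; rewrite val_mulgrpMz.
have A_indep := mult_independent_mulgrp (a := A) a_indep.
have [f fB fA] := additive_extension c A_indep.
have [g gB gA] := additive_extension d A_indep.
have fX h i : f (X h i) = \sum_j c j *~ h j i.
  by rewrite (preservesB_sum _ fB); apply: eq_bigr => j _; rewrite (preservesBMz _ _ fB) fA.
have gX h i : g (X h i) = \sum_j d j *~ h j i.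
  by rewrite (preservesB_sum _ gB); apply: eq_bigr => j _; rewrite (preservesBMz _ _ gB) gA.
have := @symb_kernel_pairing _ _ n M r (X k) (X l) f g fB gB.
move=> H; rewrite -[RHS]H; first by apply: eq_bigr => i _; rewrite !fX !gX.
  by move=> i; rewrite !valX -zE' -zE.
by rewrite -S0; congr symb; apply: eq_bigr => i _; rewrite valX -zE.
Qed.

End MulGroup.

(** * Values of rational functions *)

Section RationalEvaluation.
Variable K : fieldType.
Local Notation "p %:F" := (@FracField.tofrac {poly K} p).
Implicit Types (f g : {fraction {poly K}}) (x c d : K).

(** Being given by some fraction whose denominator does not vanish at x is
    visibly stable under the field operations, while the reduced fraction of a
    sum or product is not computed from those of the terms. *)
Definition has_value x f c : Prop := exists p q : {poly K},
  [/\ q.[x] != 0, f = p%:F / q%:F & c = p.[x] / q.[x]].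

Lemma value_poly_neq0 (q : {poly K}) x : q.[x] != 0 -> q%:F != 0.
Proof. by move=> q0; rewrite tofrac_eq0; apply: contraNneq q0 => ->; rewrite horner0. Qed.

Lemma has_value_unique x f c d : has_value x f c -> has_value x f d -> c = d.
Proof.
move=> [p [q [q0 -> ->]]] [p' [q' [q'0 E ->]]].
move/eqP: E; rewrite (eqr_div _ _ (value_poly_neq0 q0) (value_poly_neq0 q'0)).
rewrite -!tofracM tofrac_eq => /eqP/(congr1 (horner^~ x)); rewrite !hornerM => H.
by apply/eqP; rewrite eqr_div // H.
Qed.

Lemma has_value1 x : has_value x 1 1.
Proof. by exists 1, 1; rewrite hornerC oner_neq0 tofrac1 !divr1. Qed.

Lemma has_valueM x f g c d : has_value x f c -> has_value x g d -> has_value x (f * g) (c * d).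
Proof.
move=> [p [q [q0 -> ->]]] [p' [q' [q'0 -> ->]]]; exists (p * p'), (q * q').
by rewrite !hornerM mulf_neq0 // !tofracM !mulf_div.
Qed.

Lemma has_valueD x f g c d : has_value x f c -> has_value x g d -> has_value x (f + g) (c + d).
Proof.
move=> [p [q [q0 -> ->]]] [p' [q' [q'0 -> ->]]]; exists (p * q' + p' * q), (q * q').
rewrite hornerD !hornerM mulf_neq0 // tofracD !tofracM; split => //.
  by rewrite (addf_div _ _ (value_poly_neq0 q0) (value_poly_neq0 q'0)).
by rewrite addf_div.
Qed.

Lemma has_valueV x f c : c != 0 -> has_value x f c -> has_value x f^-1 c^-1.
Proof.
move=> c0 [p [q [q0 -> cE]]]; exists q, p; rewrite !invf_div cE invf_div; split => //.
by move: c0; rewrite cE; apply: contraNneq => ->; rewrite mul0r.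
Qed.

Lemma has_valueXz x f c (k : int) : c != 0 -> has_value x f c -> has_value x (f ^ k) (c ^ k).
Proof.
move=> c0 fc; have H (n : nat) : has_value x (f ^+ n) (c ^+ n).
  elim: n => [|n IH]; first exact: has_value1.
  by rewrite !exprS; exact: has_valueM.
case: k => n; first exact: H.
by rewrite NegzE -!exprnN; apply: has_valueV => //; rewrite expf_neq0.
Qed.

Lemma has_value_prod x N (f : 'I_N -> {fraction {poly K}}) (c : 'I_N -> K) :
  (forall j, has_value x (f j) (c j)) -> has_value x (\prod_j f j) (\prod_j c j).
Proof.
move=> H; elim/big_ind2: _ => [|? ? ? ? h1 h2|j _]; first exact: has_value1.
  exact: has_valueM.
exact: H.
Qed.

Lemma fraction_repr f : f * (frac (repr f)).2%:F = (frac (repr f)).1%:F.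
Proof.
rewrite -[X in X * _ = _]reprK; apply/eqP; move: (repr f) => y.
change (FracField.mul (\pi_({fraction {poly K}}) y)%qT (frac y).2%:F == (frac y).1%:F).
rewrite !piE FracField.equivfE /FracField.mulf.
by rewrite !numden_Ratio ?mulf_neq0 ?denom_ratioP ?oner_eq0 // !mulr1 mulrC.
Qed.

Lemma rf_eval_value x f : rf_regular f x -> has_value x f (rf_eval f x).
Proof.
rewrite /rf_regular /rf_eval => h.
exists (rf_num f), (rf_den f); split => //.
have d0 := value_poly_neq0 h.
apply: (mulIf d0); rewrite divfK //.
have := fraction_repr f; have := denom_ratioP (repr f).
move: d0; rewrite /rf_num /rf_den; case: (frac (repr f)) => p q /= d0 q0.
rewrite -[in X in _ * X = _](divpK (dvdp_gcdr p q)).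
rewrite -[in X in _ = X](divpK (dvdp_gcdl p q)).
rewrite !tofracM mulrA; apply: mulIf.
by rewrite tofrac_eq0 gcdp_eq0 negb_and q0 orbT.
Qed.

End RationalEvaluation.

(** * Locally constant functions on connected open sets *)

Section Calculus.
Variable R : realType.
Local Notation C := (R[i] : numFieldType).
Implicit Types (z w h d : C) (F G : C -> C).

Lemma cderivD F G z d d' : is_derive z 1 F d -> is_derive z 1 G d' ->
  is_derive z 1 (fun w => F w + G w) (d + d').
Proof. by move=> dF dG; exact: is_deriveD. Qed.

Lemma cderivM F G z d d' : is_derive z 1 F d -> is_derive z 1 G d' ->
  is_derive z 1 (fun w => F w * G w) (d * G z + F z * d').
Proof.
move=> dF dG; have := is_deriveM dF dG.
by rewrite /GRing.scale /= addrC [G z * d]mulrC.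
Qed.

Lemma cderivZ F z c d : is_derive z 1 F d -> is_derive z 1 (fun w => c * F w) (c * d).
Proof. by move=> dF; have := is_deriveZ c dF. Qed.

Lemma cderiv_sum N (F : 'I_N -> C -> C) z (d : 'I_N -> C) :
  (forall i, is_derive z 1 (F i) (d i)) ->
  is_derive z 1 (fun w => \sum_i F i w) (\sum_i d i).
Proof.
move=> dF; have := is_derive_sum dF; congr is_derive; apply/funext => w.
by rewrite fct_sumE.
Qed.

Lemma cderiv_unique F z d d' : is_derive z 1 F d -> is_derive z 1 F d' -> d = d'.
Proof. by move=> h h'; rewrite -(@derive_val _ _ _ _ _ _ _ h) (@derive_val _ _ _ _ _ _ _ h'). Qed.

Lemma openCP (A : set C) :
  open A <-> forall z, A z -> exists2 r : R, 0 < r & forall w, normc (w - z) < r -> A w.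
Proof.
split=> [oA z Az|H].
  have /nbhs_ballP[e /= e0 He] := open_nbhs_nbhs (conj oA Az).
  have [r rE] : exists r, e = r%:C.
    by exists (complex.Re e); case: e e0 {He} => a b; rewrite ltcE /= => /andP[/eqP-> _].
  move: e0 He; rewrite rE ltcR => r0 He; exists r => // w wr; apply: He.
  by rewrite /ball /= normrE ltcR normc_distC.
rewrite openE => z /H[r r0 Hr]; apply/nbhs_ballP; exists r%:C; first by rewrite /= ltcR.
by move=> w; rewrite /ball /= normrE ltcR normc_distC; exact: Hr.
Qed.

Lemma locally_constant_connected T (f : C -> T) (U : set C) : open U -> connected U ->
  (forall z, U z -> exists2 r : R, 0 < r & forall w, normc (w - z) < r -> U w -> f w = f z) ->
  forall z w, U z -> U w -> f w = f z.
Proof.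
move=> /openCP oU cU H z w Uz Uw.
have opn (P : T -> Prop) : open [set x | U x /\ P (f x)].
  apply/openCP => x [Ux Px]; have [r1 r10 H1] := oU _ Ux; have [r2 r20 H2] := H _ Ux.
  exists (Num.min r1 r2); first by rewrite lt_min r10.
  move=> y; rewrite lt_min => /andP[/H1 Uy /H2 /(_ Uy) fy]; split => //=.
  by rewrite fy.
have [] : [set x | U x /\ f x = f z] w; last by [].
rewrite (cU [set x | U x /\ f x = f z]) //; first by exists z.
  by exists [set x | U x /\ f x = f z]; [exact: (opn (fun t => t = f z)) | apply/seteqP; split => x []].
exists (~` [set x | U x /\ f x <> f z]); first by rewrite closedC; exact: (opn (fun t => t <> f z)).
apply/seteqP; split => x /= [Ux]; first by move=> fx; split=> // -[].
by move=> h; split => //; apply: contrapT => nf; apply: h.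
Qed.

Lemma deriv0_constant F z (rho : R) :
  (forall w, normc (w - z) < rho -> is_derive w 1 F 0) ->
  forall w, normc (w - z) < rho -> F w = F z.
Proof.
move=> dF w wz; have := @segment_bound _ F z (w - z) 0.
rewrite [z + (w - z)]addrC subrK mul0r => H; apply/eqP; rewrite -subr_eq0 -normc_eq0.
rewrite eq_le normc_ge0 andbT; apply: H => t /andP[t0 t1]; exists 0; last by rewrite normc0.
apply: dF; rewrite addrC addKr normcM normcR ger0_norm //.
by apply: le_lt_trans wz; rewrite ler_piMl ?normc_ge0.
Qed.

End Calculus.

(** * Local lifts of the function Lhat *)

Section LiftedPolylog.
Variable R : realType.
Local Notation C := (R[i] : numFieldType).
Implicit Types (u v w : C) (phi : nat -> C).

(** Separates what is multivalued in Lhat_n, the polylogarithms, from the rest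
    of its definition. *)
Definition Lhat_formula n phi u v : C :=
  \sum_(r < n) (-1) ^+ r / r`!%:R * phi (n - r)%N * u ^+ r
  - (-1) ^+ n / n`!%:R * u ^+ n.-1 * v.

Lemma divided_binomial m w u :
  \sum_(r < m.+1) (-1) ^+ r / r`!%:R * (w ^+ (m - r) / (m - r)`!%:R) * u ^+ r =
  (w - u) ^+ m / m`!%:R.
Proof.
rewrite exprBn mulr_suml; apply: eq_bigr => r _.
have rm : (r <= m)%N by rewrite -ltnS.
rewrite -mulr_natr -(bin_fact rm) !natrM; field.
by rewrite !fact_neq0C /= pnatr_eq0 -lt0n bin_gt0.
Qed.

Lemma period_in m (a b : int) :
  a%:~R * twopii R * (b%:~R * twopii R) ^+ m / m`!%:R
    \in gen_subgroup [set twopii R ^+ m.+1 / m`!%:R : C].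
Proof.
have -> : a%:~R * twopii R * (b%:~R * twopii R) ^+ m / m`!%:R =
    (twopii R ^+ m.+1 / m`!%:R) *~ (a * b ^+ m).
  by rewrite -[RHS]mulrzr intrM rmorphXn /= exprMn exprS; field; exact: fact_neq0C.
by apply: rpredMz; rewrite unfold_in; apply/asboolP => H [_]; exact.
Qed.

(** The source of all independence of choices: a change of the phi_k by a
    w^(k-1) / (k-1)! is felt as a (w - u)^(n-1) / (n-1)!. *)
Lemma Lhat_formulaB m phi psi u v a w :
  (forall k, phi k.+1 = psi k.+1 + a * (w ^+ k / k`!%:R)) ->
  Lhat_formula m.+1 phi u v - Lhat_formula m.+1 psi u v = a * ((w - u) ^+ m / m`!%:R).
Proof.
move=> E; rewrite /Lhat_formula opprB addrA subrK -sumrB -divided_binomial mulr_sumr.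
apply: eq_bigr => r _; have rm : (r <= m)%N by rewrite -ltnS.
by rewrite subSn // E; ring.
Qed.

(** Both the terms that carry the sheet number and the jumps of the Li_k
    change the formula by elements of the subgroup generated by the period,
    since Log(e^u) - u is in 2 pi i Z. *)
Lemma Lhat_branch m u v (phi : nat -> C) (a p : int) :
  (forall k, phi k.+1 = Li k.+1 (Cexp u) + a%:~R * (twopii R / k`!%:R * (u - p%:~R * twopii R) ^+ k)) ->
  Lhat m.+1 u v = zproj _ (Lhat_formula m.+1 phi u v).
Proof.
move=> phiE.
have [p' LE] := Cexp_eq (Cexp_Log (Cexp_neq0 u)).
have E1 := @Lhat_formulaB m (fun k => calLi k (Cexp u) (sheet u v)) (fun k => Li k (Cexp u)) u v
  (- ((sheet u v)%:~R * twopii R)) (Log (Cexp u)).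
have E2 := @Lhat_formulaB m phi (fun k => Li k (Cexp u)) u v
  (a%:~R * twopii R) (u - p%:~R * twopii R).
apply/eqP; rewrite /Lhat -subr_eq0 -zprojB zproj_eq0.
have -> : Lhat_lift m.+1 u v =
  Lhat_formula m.+1 (fun k => calLi k (Cexp u) (sheet u v)) u v by [].
rewrite -[X in X \in _](subrKA (Lhat_formula m.+1 (fun k => Li k (Cexp u)) u v)).
rewrite E1; last by move=> k; rewrite /calLi /=; ring.
rewrite -[X in _ + X]opprB E2; last by move=> k; rewrite phiE; ring.
rewrite LE [u + _ - u]addrAC [u - _ - u]addrAC subrr add0r sub0r.
have -> : - (p%:~R * twopii R) = (- p)%:~R * twopii R by rewrite mulrNz mulNr.
have -> : - ((sheet u v)%:~R * twopii R) = (- sheet u v)%:~R * twopii R by rewrite mulrNz mulNr.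
by rewrite !mulrA; apply: rpredB; exact: period_in.
Qed.

(** The derivative of the term of index r has two parts, the second of which
    cancels the first part of the term of index r - 1: partial sums up to j
    have the derivative of their last phi alone. *)
Lemma Lhat_formula_deriv m (phi : nat -> C -> C) (uf vf : C -> C) (x u' v' : C) :
  is_derive x 1 uf u' -> is_derive x 1 vf v' ->
  (forall k, is_derive (uf x) 1 (phi k.+1) (phi k (uf x))) ->
  is_derive x 1 (fun y => Lhat_formula m.+2 (fun k => phi k (uf y)) (uf y) (vf y))
    ((-1) ^+ m.+1 / m.+1`!%:R * (phi 0 (uf x) * u') * uf x ^+ m.+1
     - (-1) ^+ m.+2 / m.+2`!%:R * (m.+1%:R * uf x ^+ m * u' * vf x + uf x ^+ m.+1 * v')).
Proof.
move=> du dv dphi.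
have dX k : is_derive x 1 (fun y => uf y ^+ k.+1) (k.+1%:R * uf x ^+ k * u').
  exact: cderiv_comp du (pow_deriv k (uf x)).
have dP k : is_derive x 1 (fun y => phi k.+1 (uf y)) (phi k (uf x) * u').
  exact: cderiv_comp du (dphi k).
have dS j : (j <= m.+1)%N -> is_derive x 1
    (fun y => \sum_(r < j.+1) (-1) ^+ r / r`!%:R * phi (m.+2 - r)%N (uf y) * uf y ^+ r)
    ((-1) ^+ j / j`!%:R * (phi (m.+1 - j)%N (uf x) * u') * uf x ^+ j).
  elim: j => [_|j IH jm].
    have -> : (fun y => \sum_(r < 1) (-1) ^+ r / r`!%:R * phi (m.+2 - r)%N (uf y) * uf y ^+ r) =
        fun y => phi m.+2 (uf y).
      by apply/funext => y; rewrite big_ord1 subn0 expr0 divr1 mul1r mulr1.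
    by rewrite subn0 !expr0 divr1 mul1r mulr1.
  have -> : (fun y => \sum_(r < j.+2) (-1) ^+ r / r`!%:R * phi (m.+2 - r)%N (uf y) * uf y ^+ r) =
      fun y => (\sum_(r < j.+1) (-1) ^+ r / r`!%:R * phi (m.+2 - r)%N (uf y) * uf y ^+ r) +
         (-1) ^+ j.+1 / j.+1`!%:R * (phi (m.+1 - j.+1).+1 (uf y) * uf y ^+ j.+1).
    by apply/funext => y; rewrite big_ord_recr /= mulrA subSn.
  have := cderivD (IH (ltnW jm)) (cderivZ ((-1) ^+ j.+1 / j.+1`!%:R) (cderivM (dP (m.+1 - j.+1)%N) (dX j))).
  congr is_derive; rewrite -subSn // subSS factS natrM exprS; field.
  by rewrite fact_neq0C nat1r pnatr_eq0.
have := cderivD (dS m.+1 (leqnn _))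
  (cderivZ (- ((-1) ^+ m.+2 / m.+2`!%:R)) (cderivM (dX m) dv)).
rewrite subnn mulNr; congr is_derive; apply/funext => y.
by rewrite /Lhat_formula /=; ring.
Qed.

Lemma Chat_deriv (uf vf : C -> C) (x u' v' : C) (rho : R) : 0 < rho ->
  (forall y, normc (y - x) < rho -> Chat (uf y, vf y)) ->
  is_derive x 1 uf u' -> is_derive x 1 vf v' ->
  v' = - (Cexp (uf x) / (1 - Cexp (uf x)) * u').
Proof.
move=> rho0 H du dv.
have Hx : Cexp (uf x) + Cexp (vf x) = 1 by apply: (H x); rewrite subrr normc0.
have D := cderivD (cderiv_comp du (Cexp_deriv _)) (cderiv_comp dv (Cexp_deriv _)).
have D1 : is_derive x 1 (fun y => Cexp (uf y) + Cexp (vf y)) 0.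
  by apply: cderiv_local (is_derive_cst (1 : C) x 1); exists rho.
have e0 := cderiv_unique D D1.
have vE : 1 - Cexp (uf x) = Cexp (vf x) by rewrite -Hx addrC addKr.
have n0 := Cexp_neq0 (vf x).
rewrite vE; apply: (mulfI n0).
have -> : Cexp (vf x) * - (Cexp (uf x) / Cexp (vf x) * u') = - (Cexp (uf x) * u') by field.
by apply/eqP; rewrite -addr_eq0 addrC e0.
Qed.

End LiftedPolylog.

(** * The relation *)

Section Relation.
Variable R : realType.
Local Notation C := (R[i] : numFieldType).

Lemma uniform_radius M (P : 'I_M -> C -> Prop) (x : C) :
  (forall i, exists2 r : R, 0 < r & forall w, normc (w - x) < r -> P i w) ->
  exists2 r : R, 0 < r & forall w, normc (w - x) < r -> forall i, P i w.
Proof.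
move=> H; have [rho Hrho] := choice (fun i => let: ex_intro2 r r0 Hr := H i in ex_intro _ r (conj r0 Hr)).
exists (\big[Order.min/1]_i rho i).
  by apply/bigmin_gtP; split => // i _; have [] := Hrho i.
by move=> w /bigmin_gtP[_ wr] i; have [_] := Hrho i; apply; exact: wr.
Qed.

(** Substituting v' = - phi_0 u', the two kinds of terms combine with
    coefficient 1/(m+1)! - 1/(m+2)! = (m+1)/(m+2)! to a multiple of u^m (u v'
    - v u'). *)
Lemma relation_deriv0 m M (r : 'I_M -> int) (phi : 'I_M -> nat -> C -> C)
    (u v : 'I_M -> C -> C) (u' v' : 'I_M -> C) (x : C) :
  (forall i, is_derive x 1 (u i) (u' i)) -> (forall i, is_derive x 1 (v i) (v' i)) ->
  (forall i k, is_derive (u i x) 1 (phi i k.+1) (phi i k (u i x))) ->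
  (forall i, v' i = - (phi i 0 (u i x) * u' i)) ->
  \sum_i (u i x * v' i - v i x * u' i) * u i x ^+ m *~ r i = 0 ->
  is_derive x 1 (fun y => \sum_i
    Lhat_formula m.+2 (fun k => phi i k (u i y)) (u i y) (v i y) *~ r i) 0.
Proof.
move=> du dv dphi vE S0.
have := cderiv_sum (fun i => cderivZ (r i)%:~R (Lhat_formula_deriv m (du i) (dv i) (dphi i))).
congr is_derive.
  by apply/funext => y; apply: eq_bigr => i _; rewrite mulrC mulrzr.
transitivity ((-1) ^+ m * m.+1%:R / m.+2`!%:R *
  \sum_i (u i x * v' i - v i x * u' i) * u i x ^+ m *~ r i); last by rewrite S0 mulr0.
rewrite mulr_sumr; apply: eq_bigr => i _.
have -> : phi i 0 (u i x) * u' i = - v' i by rewrite vE opprK.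
have fE : m.+2`!%:R = (m.+1%:R + 1) * m.+1`!%:R :> C by rewrite factS natrM natr1.
rewrite -[_ *~ r i]mulrzr fE !exprS; field.
by rewrite fact_neq0C nat1r natr1 pnatr_eq0.
Qed.

Lemma log_combination_value N (a : 'I_N -> {fraction {poly R[i]}}) (k : 'I_N -> int)
    (la : 'I_N -> C) (x : C) :
  (forall j, rf_regular (a j) x) -> (forall j, Cexp (la j) = rf_eval (a j) x) ->
  has_value x (\prod_j a j ^ k j) (Cexp (\sum_j la j *~ k j)).
Proof.
move=> areg lE; rewrite Cexp_sum; apply: has_value_prod => j; rewrite CexpMz.
apply: has_valueXz (Cexp_neq0 _) _; rewrite lE; exact: rf_eval_value.
Qed.

End Relation.

Theorem corollary3p11 (R : realType) (n M N : nat) (hn : (2 <= n)%N)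
  (r : 'I_M -> int) (z : 'I_M -> {fraction {poly R[i]}})
  (beta : {freeg (P1 {fraction {poly R[i]}})})
  (beta_def : beta = \sum_(i < M) << r i *g Some (z i) >>)
  (beta_ker : symb n beta = 0)
  (a : 'I_N -> {fraction {poly R[i]}})
  (a_neq0 : forall j, a j != 0)
  (a_indep : mult_independent a)
  (k l : 'I_N -> 'I_M -> int)
  (z_def : forall i, z i = \prod_(j < N) a j ^ k j i)
  (onem_z_def : forall i, 1 - z i = \prod_(j < N) a j ^ l j i)
  (U : set (R[i] : numFieldType)) (U_open : open U) (U_conn : connected U)
  (a_hol : forall j x, U x -> rf_regular (a j) x)
  (a_nonvan : forall j x, U x -> rf_eval (a j) x != 0)
  (la : 'I_N -> (R[i] : numFieldType) -> (R[i] : numFieldType))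
  (la_hol : forall j x, U x -> derivable (la j) x 1)
  (la_log : forall j x, U x -> Cexp (la j x) = rf_eval (a j) x) :
  let u i x := \sum_(j < N) la j x *~ k j i in
  let v i x := \sum_(j < N) la j x *~ l j i in
  (forall i x, U x -> Chat (u i x, v i x)) /\
  exists c : Lhat_target R n,
    forall x, U x -> \sum_(i < M) Lhat n (u i x) (v i x) *~ r i = c.
Proof.
move=> u v.
have ChatU i x : U x -> Chat (u i x, v i x).
  move=> Ux; rewrite /Chat /=.
  have Hu := log_combination_value (k^~ i) (fun j => a_hol j x Ux) (fun j => la_log j x Ux).
  have Hv := log_combination_value (l^~ i) (fun j => a_hol j x Ux) (fun j => la_log j x Ux).
  rewrite -z_def in Hu; rewrite -onem_z_def in Hv.
  by apply: (has_value_unique (has_valueD Hu Hv)); rewrite addrC subrK; exact: has_value1.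
split=> //.
have [[x0 Ux0]|U0] := pselect (exists x, U x); last first.
  by exists 0 => x Ux; case: U0; exists x.
exists (\sum_(i < M) Lhat n (u i x0) (v i x0) *~ r i) => x Ux.
case: n hn beta_ker => [//|[//|m]] _ beta_ker.
apply: (@locally_constant_connected R _ (fun x => \sum_(i < M) Lhat m.+2 (u i x) (v i x) *~ r i) U) => //.
move=> {x Ux x0 Ux0} x0 Ux0.
have [rU rU0 HU] := (openCP U).1 U_open x0 Ux0.
pose dlog (h : 'I_N -> 'I_M -> int) i x : R[i] := \sum_j 'D_1 (la j) x *~ h j i.
have dcomb (h : 'I_N -> 'I_M -> int) i (x : R[i] : numFieldType) : U x ->
    is_derive x 1 (fun y => \sum_j la j y *~ h j i) (dlog h i x).
  move=> Ux; apply: cderiv_sum => j.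
  have := cderivZ (h j i)%:~R (derivableP (la_hol j x Ux)).
  rewrite [_%:~R * _]mulrC mulrzr; congr is_derive.
  by apply/funext => y; rewrite mulrC mulrzr.
have S0 (x : R[i] : numFieldType) : U x ->
    \sum_i (u i x * dlog l i x - v i x * dlog k i x) * u i x ^+ m *~ r i = 0.
  rewrite beta_def in beta_ker; move=> Ux.
  have := symb_kernel_log (fun j => la j x) (fun j => 'D_1 (la j) x)
    a_neq0 a_indep z_def onem_z_def beta_ker.
  by rewrite subn2.
have nE1 i : Cexp (u i x0) != 1.
  have := ChatU i x0 Ux0; rewrite /Chat /= => <-.
  by rewrite -subr_eq0 opprD addNKr oppr_eq0 Cexp_neq0.
have [phi Hphi] := choice (fun i => local_branch (nE1 i)).
have [rho rho0 Hrho] : exists2 rho : R, 0 < rho & forall w, normc (w - x0) < rho -> forall i,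
  [/\ forall k, is_derive (u i w) 1 (phi i k.+1) (phi i k (u i w)),
      phi i 0%N (u i w) = Cexp (u i w) / (1 - Cexp (u i w)) &
      exists m p : int, forall k, phi i k.+1 (u i w) =
        Li k.+1 (Cexp (u i w)) + m%:~R * (twopii R / k`!%:R * (u i w - p%:~R * twopii R) ^+ k)].
  apply: uniform_radius => i; have [q q0 Hq] := Hphi i.
  have [q' q'0 Hq'] := cderiv_cont (dcomb k i x0 Ux0) q0.
  by exists q' => // w /Hq' /Hq.
exists (Num.min rU rho); first by rewrite lt_min rU0.
move=> w wx0 _.
pose H y := \sum_i Lhat_formula m.+2 (fun k => phi i k (u i y)) (u i y) (v i y) *~ r i.
have HE y : normc (y - x0) < Num.min rU rho ->
    \sum_(i < M) Lhat m.+2 (u i y) (v i y) *~ r i = zproj _ (H y).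
  rewrite lt_min => /andP[_ /Hrho Hy].
  rewrite (preservesB_sum _ (zprojB _)); apply: eq_bigr => i _.
  have [_ _ [b [p Hp]]] := Hy i.
  by rewrite (preservesBMz _ _ (zprojB _)); congr (_ *~ _); exact: Lhat_branch Hp.
rewrite !HE //; last by rewrite subrr normc0 lt_min rU0.
congr (zproj _ _); apply: deriv0_constant wx0 => y; rewrite lt_min => /andP[yU /Hrho Hy].
have Uy := HU y yU.
apply: (relation_deriv0 (fun i => dcomb k i y Uy) (fun i => dcomb l i y Uy)) => //.
- by move=> i k'; have [+ _ _] := Hy i; exact.
- move=> i; have [_ -> _] := Hy i.
  have [q q0 Hq] := (openCP U).1 U_open y Uy.
  exact: (Chat_deriv q0 (fun x h => ChatU i x (Hq x h)) (dcomb k i y Uy) (dcomb l i y Uy)).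
- exact: S0.
Qed.
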